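(* Let $G$ be a connected subcubic $n$-vertex graph (i.e. $\Delta(G)\le 3$) that has no induced $6$-cycles and that is not isomorphic to any graph in $\mathcal{E}$. Then $$\iota(G,P_3)\le \left\lfloor \frac{n}{4}\right\rfloor.$$ Moreover, equality holds if $G=B_{n,P_3}$.
   Context: All graphs are finite and simple. For a graph $G$ and $D\subseteq V(G)$, $N[D]$ is the closed neighbourhood $\bigcup_{v\in D}(\{v\}\cup N(v))$. A set $D\subseteq V(G)$ is a $P_3$-isolating set of $G$ if $G-N[D]$ contains no copy of the $3$-vertex path $P_3$ (equivalently, no two edges of $G-N[D]$ share a vertex); $\iota(G,P_3)$ is the minimum size of a $P_3$-isolating set of $G$. An induced $6$-cycle is an induced subgraph isomorphic to $C_6$. $P_n$ is the path on $[n]$ with edges $\{i,i+1\}$, $C_n$ the cycle on $[n]$. The family $\mathcal{E}$ consists of the following $12$ graphs: $P_3$, $C_3$, $C_7$, $C_{11}$, and $G_{7,1}$ on $[7]$ with edges $17,27,67,23,34,35,45,56$; $G_{7,2}$ on $[7]$ with edges $17,27,67,12,23,34,35,45,56$; $G_{7,3}$ on $[7]$ with edges $17,27,67,23,34,35,45,56,14$; $G_{7,4}$ on $[7]$ with edges $17,27,67,12,23,34,35,45,56,14$; $G_{7,5}$ on $[7]$ with edges $12,17,23,27,34,35,46,56,67$; $G_{7,6}$ on $[7]$ with edges $12,17,23,27,34,35,45,46,56,67$; $G_{11}$ on $[11]$ with edges $\{1,2\},\{1,11\},\{2,11\},\{2,3\},\{3,4\},\{3,9\},\{4,5\},\{4,10\},\{5,6\},\{6,7\},\{7,8\},\{8,9\},\{9,10\},\{10,11\}$;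 $G_{15}$ on $[15]$ with edges $\{1,2\},\{1,15\},\{2,15\},\{2,3\},\{3,4\},\{3,13\},\{4,5\},\{4,14\},\{5,6\},\{6,7\},\{6,11\},\{7,8\},\{7,12\},\{8,9\},\{8,10\},\{9,10\},\{10,11\},\{11,12\},\{12,13\},\{13,14\},\{14,15\}$ (here $ij$ denotes the edge $\{i,j\}$). The graph $B_{n,P_3}$: if $n\le 3$, $B_{n,P_3}=P_n$. If $n\ge 4$, let $a=\lfloor n/4\rfloor$ and $b=n-3a$; take vertices $[b]$ together with pairwise disjoint copies $F_1,\dots,F_a$ of $P_3$ (disjoint from $[b]$); the edges are those of the path $1,2,\dots,a$, the edges $\{a,j\}$ for $j\in[b]\setminus[a]$, the edges of each $F_i$, and the edges $\{i,u\}$ for each $i\in[a]$ and $u\in V(F_i)$. *)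

(* Defs.v *)
From Stdlib Require List.
From mathcomp Require Import all_boot.
Set Implicit Arguments. Unset Strict Implicit. Unset Printing Implicit Defensive.

Record sgraph := SGraph {
  vertex :> finType;
  adj : rel vertex;
  adj_sym : symmetric adj;
  adj_irr : irreflexive adj }.

Section FromRel.
Variables (T : finType) (r : rel T).

Definition simple_closure : rel T := [rel x y | (x != y) && (r x y || r y x)].

Lemma simple_closure_sym : symmetric simple_closure.
Proof. by move=> x y; rewrite /simple_closure /= eq_sym orbC. Qed.

Lemma simple_closure_irr : irreflexive simple_closure.
Proof. by move=> x; rewrite /simple_closure /= eqxx. Qed.

Definition graph_of_rel : sgraph := SGraph simple_closure_sym simple_closure_irr.
End FromRel.

Definition iso (G H : sgraph) : Prop :=
  exists f : G -> H, bijective f /\ forall x y, adj (f x) (f y) = adj x y.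

Section Graph.
Variable G : sgraph.

Definition nbhd (x : G) : {set G} := [set y | adj x y].

Definition closed_nbhd (D : {set G}) : {set G} :=
  \bigcup_(v in D) (v |: nbhd v).

Definition max_degree : nat := \max_(x : G) #|nbhd x|.

Definition connected : Prop := forall x y : G, connect (@adj G) x y.

Definition induced_adj (S : {set G}) : rel {x : G | x \in S} :=
  [rel x y | adj (val x) (val y)].

Lemma induced_adj_sym (S : {set G}) : symmetric (@induced_adj S).
Proof. by move=> x y; apply: adj_sym. Qed.

Lemma induced_adj_irr (S : {set G}) : irreflexive (@induced_adj S).
Proof. by move=> x; apply: adj_irr. Qed.

Definition induced (S : {set G}) : sgraph :=
  SGraph (@induced_adj_sym S) (@induced_adj_irr S).
End Graph.

Definition subcubic (G : sgraph) : Prop := max_degree G <= 3.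

(* A copy of F in G is a not necessarily induced subgraph isomorphic to F. *)
Definition has_copy (F G : sgraph) : bool :=
  [exists f : {ffun F -> G},
    injectiveb f && [forall x, forall y, adj x y ==> adj (f x) (f y)]].

Definition isolating (F G : sgraph) (D : {set G}) : bool :=
  ~~ has_copy F (induced (~: closed_nbhd D)).

(* V(G) is F-isolating as soon as F has a vertex, so the argmin is a genuine
   minimum in that case; see isolation_numberP. *)
Definition isolation_number (G F : sgraph) : nat :=
  #|[arg min_(D < [set: G] | isolating F D) #|D|]|.

Lemma isolating_setT (F G : sgraph) : 0 < #|F| -> isolating F [set: G].
Proof.
case/card_gt0P=> x _; apply/existsP => -[f _].
have := valP (f x); rewrite inE => /negP[].
by apply/bigcupP; exists (val (f x)); rewrite ?inE ?eqxx.
Qed.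

Lemma isolation_numberP (F G : sgraph) : 0 < #|F| ->
  (exists2 D : {set G}, isolating F D & #|D| = isolation_number G F) /\
  (forall D : {set G}, isolating F D -> isolation_number G F <= #|D|).
Proof.
move=> F0; rewrite /isolation_number.
case: arg_minnP => [|D isoD minD]; first exact: isolating_setT.
by split; [exists D | exact: minD].
Qed.

(* In all concrete graphs on [n], vertex k in {1, ..., n} is the element
   k - 1 of 'I_n. *)
Definition path_graph (n : nat) : sgraph :=
  @graph_of_rel 'I_n [rel i j : 'I_n | j == i.+1 :> nat].

(* The usual C_n only for n >= 3. *)
Definition cycle_graph (n : nat) : sgraph :=
  @graph_of_rel 'I_n [rel i j : 'I_n | j == i.+1 %% n :> nat].

Definition edge_graph (n : nat) (s : seq (nat * nat)) : sgraph :=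
  @graph_of_rel 'I_n [rel i j : 'I_n | (i.+1, j.+1) \in s].

Definition has_induced_C6 (G : sgraph) : Prop :=
  exists S : {set G}, iso (induced S) (cycle_graph 6).

Definition G7_1 := edge_graph 7
  [:: (1,7); (2,7); (6,7); (2,3); (3,4); (3,5); (4,5); (5,6)].
Definition G7_2 := edge_graph 7
  [:: (1,7); (2,7); (6,7); (1,2); (2,3); (3,4); (3,5); (4,5); (5,6)].
Definition G7_3 := edge_graph 7
  [:: (1,7); (2,7); (6,7); (2,3); (3,4); (3,5); (4,5); (5,6); (1,4)].
Definition G7_4 := edge_graph 7
  [:: (1,7); (2,7); (6,7); (1,2); (2,3); (3,4); (3,5); (4,5); (5,6); (1,4)].
Definition G7_5 := edge_graph 7
  [:: (1,2); (1,7); (2,3); (2,7); (3,4); (3,5); (4,6); (5,6); (6,7)].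
Definition G7_6 := edge_graph 7
  [:: (1,2); (1,7); (2,3); (2,7); (3,4); (3,5); (4,5); (4,6); (5,6); (6,7)].
Definition G11 := edge_graph 11
  [:: (1,2); (1,11); (2,11); (2,3); (3,4); (3,9); (4,5); (4,10); (5,6);
      (6,7); (7,8); (8,9); (9,10); (10,11)].
Definition G15 := edge_graph 15
  [:: (1,2); (1,15); (2,15); (2,3); (3,4); (3,13); (4,5); (4,14); (5,6);
      (6,7); (6,11); (7,8); (7,12); (8,9); (8,10); (9,10); (10,11); (11,12);
      (12,13); (13,14); (14,15)].

Definition family_E : seq sgraph :=
  [:: path_graph 3; cycle_graph 3; cycle_graph 7; cycle_graph 11;
      G7_1; G7_2; G7_3; G7_4; G7_5; G7_6; G11; G15].

Definition iso_to_E (G : sgraph) : Prop :=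
  exists2 H, List.In H family_E & iso G H.

(* [inl i] is the vertex i + 1 of [b]; [inr (k, u)] is the vertex u of the
   copy F_(k+1) of P_3. *)
Definition Bgraph_rel (a b : nat) : rel ('I_b + 'I_a * path_graph 3)%type :=
  fun x y => match x, y with
  | inl i, inl j => (j == i.+1 :> nat) && (j < a) || (i.+1 == a) && (a <= j)
  | inl i, inr (k, _) => i == k :> nat
  | inr (k, u), inr (l, v) => (k == l) && adj u v
  | inr _, inl _ => false
  end.

Definition Bgraph (n : nat) : sgraph :=
  if n <= 3 then path_graph n
  else graph_of_rel (@Bgraph_rel (n %/ 4) (n - 3 * (n %/ 4))).

Lemma card_Bgraph (n : nat) : #|Bgraph n| = n.
Proof.
rewrite /Bgraph; case: ifP => _ /=; first exact: card_ord.
rewrite card_sum card_prod !card_ord (mulnC 3) subnK //.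
by apply: leq_trans (leq_divM n 4); rewrite leq_mul2l orbT.
Qed.

(* Main.v *)
(** Call a set of vertices bad if it induces a graph of the family E.  Bad sets have order
    3 mod 4, cost one vertex more than a quarter of their order allows, but become cheap
    (order minus three, over four) as soon as any one of their vertices is dominated from
    outside.  In a minimal counterexample this forbids a bad component behind a cut vertex,
    and more generally forces two independent edges leaving every bad component.

    If some vertex has degree 3, choose such a v and a component K of G - N[v] with |K|
    maximal.  Maximality forces a vertex of degree 3 in any other component to be adjacent
    to every neighbour of v that sees K, which makes the other components paths; comparing
    G - N[v] with G - N[u] for nearby u shows that K is bad and that there is no other
    component.  Then G has at most 19 vertices, and the remaining graphs are enumerated by
    computation.  If no vertex has degree 3, then G is a cycle. *)
From Stdlib Require Import Classical.
Require Import Defs.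
From mathcomp Require Import all_boot zify.
Set Implicit Arguments. Unset Strict Implicit. Unset Printing Implicit Defensive.


(** All costs are multiplied by four and compared with orders of vertex sets: dominating a vertex
    costs 4, and the induction hypothesis gives a good connected proper set of order m the cost m -
    m mod 4. The units saved by this rounding pay for the surplus of a bad component, so most
    contradictions are counts modulo 4. The obstacle is a bad component next to K that is a path on
    three vertices; there the exclusion of induced 6-cycles enters, because such a path attached at
    its ends to two distinct nonadjacent neighbours of v closes a 6-cycle through v. The maximum of
    |K| is taken over all vertices of degree 3 at once, so v may be traded for any u of degree 3
    whose closed neighbourhood avoids K. The bound 19 is 15 + 4: the largest member of the family
    with a star attached. The family and its extensions are coded as Boolean tables on natural
    numbers so that the checks run in the virtual machine; the searches for 6-cycles and
    isomorphisms recheck their results, so their pruning carries no proof obligation. *)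

(** * Coding the exceptional family on natural numbers *)

(** The counterpart of [simple_closure] over [nat], where it can be evaluated. *)
Definition symcl (r : rel nat) : rel nat := fun i j => (i != j) && (r i j || r j i).

Definition pathr : rel nat := fun i j => j == i.+1.
Definition cycler n : rel nat := fun i j => j == i.+1 %% n.
Definition edger (s : seq (nat * nat)) : rel nat := fun i j => (i.+1, j.+1) \in s.

Definition ord_graph (c : nat * rel nat) : sgraph :=
  @graph_of_rel 'I_c.1 [rel i j : 'I_c.1 | c.2 i j].

Definition codes : seq (nat * rel nat) :=
  [:: (3, pathr); (3, cycler 3); (7, cycler 7); (11, cycler 11);
   (7, edger [:: (1,7); (2,7); (6,7); (2,3); (3,4); (3,5); (4,5); (5,6)]);
   (7, edger [:: (1,7); (2,7); (6,7); (1,2); (2,3); (3,4); (3,5); (4,5); (5,6)]);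
   (7, edger [:: (1,7); (2,7); (6,7); (2,3); (3,4); (3,5); (4,5); (5,6); (1,4)]);
   (7, edger [:: (1,7); (2,7); (6,7); (1,2); (2,3); (3,4); (3,5); (4,5); (5,6);
                 (1,4)]);
   (7, edger [:: (1,2); (1,7); (2,3); (2,7); (3,4); (3,5); (4,6); (5,6); (6,7)]);
   (7, edger [:: (1,2); (1,7); (2,3); (2,7); (3,4); (3,5); (4,5); (4,6); (5,6);
                 (6,7)]);
   (11, edger [:: (1,2); (1,11); (2,11); (2,3); (3,4); (3,9); (4,5); (4,10); (5,6);
                  (6,7); (7,8); (8,9); (9,10); (10,11)]);
   (15, edger [:: (1,2); (1,15); (2,15); (2,3); (3,4); (3,13); (4,5); (4,14); (5,6);
                  (6,7); (6,11); (7,8); (7,12); (8,9); (8,10); (9,10); (10,11);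
                  (11,12); (12,13); (13,14); (14,15)])].

(** Holds by conversion, so the tables computed with below are the graphs of the statement. *)
Lemma family_E_codes : family_E = [seq ord_graph c | c <- codes].
Proof. by []. Qed.

Lemma List_In_map (A B : Type) (f : A -> B) s y :
  List.In y [seq f x | x <- s] <-> exists2 x, List.In x s & y = f x.
Proof.
elim: s => [|a s IHs] /=; first by split=> [[]|[x []]].
rewrite IHs; split=> [[<-|[x xs ->]]|[x [<-|xs] ->]].
- by exists a; [left|].
- by exists x; [right|].
- by left.
- by right; exists x.
Qed.

Section Ambient.
Variable G : sgraph.
Implicit Types (a b c d v w x y z : G) (S T R C D H K : {set G}).

Lemma adjC x y : adj x y = adj y x. Proof. exact: adj_sym. Qed.
Lemma adjxx x : adj x x = false. Proof. exact: adj_irr. Qed.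
Lemma adj_neq x y : adj x y -> x != y.
Proof. by apply: contraTneq => ->; rewrite adjxx. Qed.

(** [g] embeds the graph with vertices 0, ..., n - 1 and adjacency [e] as an induced subgraph of
    G. *)
Definition rep n (e : rel nat) (g : nat -> G) :=
  (forall i j, i < n -> j < n -> g i = g j -> i = j) /\
  (forall i j, i < n -> j < n -> adj (g i) (g j) = e i j).

Definition img (g : nat -> G) (l : seq nat) : {set G} := [set x in map g l].

Lemma imgP g l x : reflect (exists2 i, i \in l & x = g i) (x \in img g l).
Proof. by rewrite inE; apply: mapP. Qed.

Lemma mem_img g l i : i \in l -> g i \in img g l.
Proof. by move=> il; rewrite inE map_f. Qed.

Lemma rep_iso n r g S : rep n (symcl r) g -> S = img g (iota 0 n) ->
  iso (induced S) (ord_graph (n, r)).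
Proof.
move=> [gI gA] SE.
have gS (i : 'I_n) : g i \in S by rewrite SE mem_img // mem_iota /= ltn_ord.
pose h (i : 'I_n) : induced S := exist _ (g i) (gS i).
have hI : injective h.
  by move=> i j /(congr1 val) /= /gI E; apply/val_inj/E.
have hS (x : induced S) : exists i, h i == x.
  case: x => x xS; have := xS; rewrite {1}SE => /imgP[i]; rewrite mem_iota => /= iln xE.
  by exists (Ordinal iln); apply/eqP/val_inj.
pose k (x : induced S) := xchoose (hS x).
have kK : cancel k h by move=> x; apply/eqP/(xchooseP (hS x)).
exists k; split; first by exists h => // i; apply/hI/kK.
by move=> x y; rewrite -{2}(kK x) -{2}(kK y) /= /induced_adj /= gA //=.
Qed.

Lemma iso_rep n r S : 0 < n -> iso (induced S) (ord_graph (n, r)) ->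
  exists2 g, rep n (symcl r) g & S = img g (iota 0 n).
Proof.
case: n => // n _ [f [[h hK kK] fA]].
pose g i := val (h (inord i)).
have hA (i j : 'I_n.+1) : adj (h i) (h j) = symcl r i j by rewrite -fA !kK.
exists g.
  split=> i j ilt jlt; last by have := hA (inord i) (inord j); rewrite !inordK.
  by move=> /val_inj/(can_inj kK)/(congr1 val); rewrite /= !inordK.
apply/setP=> x; apply/idP/imgP => [xS|[i _ ->]]; last exact: valP (h _).
exists (f (exist _ x xS)); first by rewrite mem_iota /= ltn_ord.
by rewrite /g inord_val hK.
Qed.

Definition bad S := exists2 c, List.In c codes &
  exists2 g, rep c.1 (symcl c.2) g & S = img g (iota 0 c.1).

Lemma bad_iso S : bad S <-> iso_to_E (induced S).
Proof.
rewrite /iso_to_E family_E_codes; split.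
  move=> [c cin [g gr SE]]; exists (ord_graph c); first by apply/List_In_map; exists c.
  by case: c cin gr SE => n r _ gr SE; apply: rep_iso SE.
move=> [H /List_In_map [c cin ->] isoc]; exists c => //.
suff c0 : 0 < c.1 by case: c cin isoc c0 => n r _ isoc c0; apply: iso_rep.
by move: cin; rewrite /codes /=; do !(case=> [<- //|]).
Qed.

Lemma iso_trans_setT (F : sgraph) : iso (induced [set: G]) F -> iso G F.
Proof.
move=> [f [[h hK kK] fA]].
exists (fun x => f (exist _ x (in_setT x))); split; last by move=> x y; rewrite fA.
exists (fun u => val (h u)) => [x|u]; first by rewrite hK.
by rewrite -[RHS]kK; congr f; apply/val_inj.
Qed.

Lemma bad_setT : bad [set: G] -> iso_to_E G.
Proof.
by move/bad_iso=> [H Hin /iso_trans_setT isoH]; exists H.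
Qed.

Lemma induced_C6P :
  has_induced_C6 G <-> exists g, rep 6 (symcl (cycler 6)) g.
Proof.
split=> [[S /(iso_rep (n := 6) (r := cycler 6) isT) [g gr _]]|[g gr]]; first by exists g.
by exists (img g (iota 0 6)); apply: (rep_iso gr).
Qed.

(** * Isolating sets *)

Definition p3free S :=
  forall a b c, a \in S -> b \in S -> c \in S -> adj a b -> adj b c -> a = c.

(* [quiso S n]: four times the isolation number of G[S] is at most n.  The set D may use
   vertices outside S, which is harmless since only S = V(G) matters in the end. *)
Definition quiso S n := exists2 D : {set G}, 4 * #|D| <= n & p3free (S :\: closed_nbhd D).

Definition cnbhd x : {set G} := x |: nbhd x.

Lemma in_nbhd x y : (y \in nbhd x) = adj x y. Proof. by rewrite inE. Qed.
Lemma in_cnbhd x y : (y \in cnbhd x) = (y == x) || adj x y. Proof. by rewrite !inE. Qed.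

Lemma closed_nbhdU D D' : closed_nbhd (D :|: D') = closed_nbhd D :|: closed_nbhd D'.
Proof. exact: bigcup_setU. Qed.
Lemma closed_nbhd1 x : closed_nbhd [set x] = cnbhd x.
Proof. exact: big_set1. Qed.
Lemma closed_nbhd0 : closed_nbhd (@set0 G) = set0.
Proof. exact: big_set0. Qed.
Lemma in_closed_nbhd D x : reflect (exists2 d, d \in D & (x == d) || adj d x) (x \in closed_nbhd D).
Proof.
by apply: (iffP bigcupP) => -[d dD xd]; exists d; rewrite // ?inE // in xd *.
Qed.

Lemma p3free_sub S T : S \subset T -> p3free T -> p3free S.
Proof. by move=> /subsetP ST fT a b c /ST aT /ST bT /ST cT; apply: fT. Qed.

Lemma quiso_sub S T n : S \subset T -> quiso T n -> quiso S n.
Proof. by move=> ST [D Dn fD]; exists D => //; apply: p3free_sub fD; apply: setSD. Qed.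

Lemma quiso_leq S m n : m <= n -> quiso S m -> quiso S n.
Proof. by move=> mn [D Dn fD]; exists D => //; apply: leq_trans mn. Qed.

(** The union of the two dominating sets works: dominating more vertices creates no P3, and without
    edges between S and T every P3 lies on one side. *)
Lemma quisoU S T m n : (forall x y, x \in S -> y \in T -> ~~ adj x y) ->
  quiso S m -> quiso T n -> quiso (S :|: T) (m + n).
Proof.
move=> noST [D Dm fD] [D' Dn fD']; exists (D :|: D').
  by rewrite cardsU; lia.
rewrite closed_nbhdU => a b c.
rewrite !inE !negb_or => /andP[/andP[aD aD'] aST] /andP[/andP[bD bD'] bST].
move=> /andP[/andP[cD cD'] cST] ab bc.
case/orP: bST => [bS|bT].
  have aS : a \in S by case/orP: aST => // /(noST _ _ bS); rewrite adjC ab.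
  have cS : c \in S by case/orP: cST => // /(noST _ _ bS); rewrite bc.
  by apply: (fD a b c); rewrite // inE ?aD ?bD ?cD.
have aT : a \in T by case/orP: aST => // /noST /(_ bT); rewrite ab.
have cT : c \in T by case/orP: cST => // /noST /(_ bT); rewrite adjC bc.
by apply: (fD' a b c); rewrite // inE ?aD' ?bD' ?cD'.
Qed.

Lemma quiso_dom x S n : quiso (S :\: cnbhd x) n -> quiso S (4 + n).
Proof.
move=> [D Dn fD]; exists (x |: D); first by rewrite cardsU1; lia.
by rewrite /= closed_nbhdU closed_nbhd1 -setDDl.
Qed.

Lemma quiso_p3free S : p3free S -> quiso S 0.
Proof. by move=> fS; exists set0; rewrite ?cards0 // closed_nbhd0 setD0. Qed.

Lemma quiso0 : quiso set0 0.
Proof. by apply: quiso_p3free => a b c; rewrite inE. Qed.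

Lemma quiso_small S : #|S| <= 2 -> quiso S 0.
Proof.
move=> S2; apply: quiso_p3free => a b c aS bS cS ab bc.
apply/eqP; apply: contraT => ac.
have sub : [set a; b; c] \subset S by rewrite !subUset !sub1set aS bS cS.
have := subset_leq_card sub.
by rewrite -setUA !cardsU1 cards1 !inE negb_or (adj_neq ab) (adj_neq bc) ac; lia.
Qed.

(** * Connected sets and components *)

Definition closed_in R T := forall x y, x \in T -> y \in R -> adj x y -> y \in T.

Definition conn S := S != set0 /\
  forall T, T \subset S -> T != set0 -> closed_in S T -> S \subset T.

Definition comp R C := [/\ C \subset R, conn C & closed_in R C].

Lemma conn_ind S (T : {set G}) x : conn S -> x \in S -> x \in T ->
  (forall a b, a \in S -> a \in T -> b \in S -> adj a b -> b \in T) -> S \subset T.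
Proof.
move=> [_ cS] xS xT step; apply/subsetP=> s sS.
have: S \subset S :&: T.
  apply: cS; [exact: subsetIl | by apply/set0Pn; exists x; rewrite inE xS |].
  by move=> a b; rewrite !inE => /andP[aS aT] bS ab; rewrite bS (step a b).
by move/subsetP/(_ s sS); rewrite inE => /andP[].
Qed.

Lemma conn1 x : conn [set x].
Proof.
split; first by apply/set0Pn; exists x; rewrite inE.
move=> T /subsetP TS /set0Pn[y yT] _; rewrite sub1set.
by have := TS _ yT; rewrite inE => /eqP <-.
Qed.

Lemma conn_add S x y : conn S -> x \in S -> adj x y -> conn (y |: S).
Proof.
move=> cS xS xy; split; first by apply/set0Pn; exists y; rewrite !inE eqxx.
move=> T /subsetP TS /set0Pn[t tT] clT.
have yT : y \in T.
  have := TS _ tT; rewrite !inE => /orP[/eqP <- //|tS].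
  have/subsetP ST : S \subset T.
    apply: (conn_ind cS tS tT) => a b _ aT bS ab.
    by apply: (clT a b) => //; rewrite !inE bS orbT.
  by apply: (clT x y) => //; rewrite ?ST ?inE ?eqxx.
rewrite subUset sub1set yT; apply: (conn_ind cS xS) => [|a b _ aT bS ab].
  by apply: (clT y x); rewrite ?inE ?xS ?orbT // adjC.
by apply: (clT a b) => //; rewrite !inE bS orbT.
Qed.

(** A vertex with at most one neighbour in S is not a cut vertex of G[S]. *)
Lemma conn_del S x : conn S -> S :\ x != set0 ->
  (forall a b, a \in S -> b \in S -> adj x a -> adj x b -> a = b) -> conn (S :\ x).
Proof.
move=> cS nS xS1; split=> // T /subsetP TS /set0Pn[t tT] clT.
have tS : t \in S by have := TS _ tT; rewrite !inE => /andP[].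
(* T is enlarged by x exactly when x has a neighbour in T, so that the closure argument can run in S
   instead of S - x. *)
suff /subsetP sub : S \subset (T :|: [set z in [set x] | [exists a in T, adj x a]]).
  apply/subsetP=> s; rewrite !inE => /andP[sx sS].
  by have := sub s sS; rewrite !inE (negPf sx) orbF.
apply: (conn_ind cS tS); first by rewrite inE tT.
move=> a b aS; rewrite !inE => /orP[aT|/andP[/eqP-> /existsP[c /andP[cT xc]]]] bS ab.
  case: (eqVneq b x) => [bx|bx]; last by rewrite (clT a b) // !inE bx.
  by apply/orP; right; rewrite /= -bx; apply/existsP; exists a; rewrite aT adjC.
have cS' : c \in S by have := TS _ cT; rewrite !inE => /andP[].
by rewrite -(xS1 c b) // cT.
Qed.

Lemma comp_exists R x : x \in R -> exists2 C, comp R C & x \in C.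
Proof.
move=> xR; pose e := [rel a b | (b \in R) && adj a b].
pose C := [set z | connect e x z].
have CR : C \subset R.
  apply/subsetP=> z; rewrite inE => /connectP[p].
  elim/last_ind: p z => [|p a _] z /=; first by move=> _ ->.
  by rewrite rcons_path last_rcons => /andP[_ /andP[aR _]] ->.
have clC : closed_in R C.
  move=> a b; rewrite !inE => xa bR ab; apply: connect_trans xa (connect1 _).
  by rewrite /= bR.
exists C; last by rewrite inE connect0.
split=> //; split; first by apply/set0Pn; exists x; rewrite inE connect0.
move=> T /subsetP TC /set0Pn[t tT] clT.
have walk (a b : G) : a \in C -> connect e a b -> (a \in T) = (b \in T).
  move=> aC /connectP[p]; elim: p a aC => [a _ _ -> //|c p IH] a aC /=.
  move=> /andP[/andP[cR ac] pth] bE.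
  have cC : c \in C by apply: (clC a c).
  rewrite -(IH c) //; apply/idP/idP => inT; first exact: (clT a c).
  by apply: (clT c a) => //; rewrite adjC.
have xC : x \in C by rewrite inE connect0.
have xT : x \in T.
  by have := TC _ tT; rewrite inE => /(walk x t xC) ->.
by apply/subsetP=> s; rewrite inE => /(walk x s xC) <-.
Qed.

Lemma comp_max R C S : comp R C -> conn S -> S \subset R -> ~~ [disjoint S & C] -> S \subset C.
Proof.
move=> [CR cC clC] cS /subsetP SR; rewrite -setI_eq0 => /set0Pn[x].
rewrite inE => /andP[xS xC]; apply: (conn_ind cS xS xC) => a b _ aC bS ab.
by apply: (clC a b) => //; apply: SR.
Qed.

Lemma comp_eq R C C' x : comp R C -> comp R C' -> x \in C -> x \in C' -> C = C'.
Proof.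
move=> cC cC' xC xC'; apply/eqP; rewrite eqEsubset.
have nd : ~~ [disjoint C & C'] by apply/pred0Pn; exists x; rewrite /= xC xC'.
case: (cC) (cC') => [CR conC _] [CR' conC' _].
by rewrite (comp_max cC') // (comp_max cC) // disjoint_sym.
Qed.

Lemma comp_setD R C C' : comp R C -> comp (R :\: C) C' -> comp R C'.
Proof.
move=> [_ cC clC] [/subsetP CR' cC' clC']; split=> //.
  by apply/subsetP=> x /CR'; rewrite inE => /andP[].
move=> x y xC' yR xy; apply: (clC' x y) => //; rewrite inE yR andbT.
apply/negP=> yC; have := CR' _ xC'; rewrite inE => /andP[/negP xC xR].
by apply/xC/(clC y x); rewrite // adjC.
Qed.

Lemma comp_out R C x y : comp R C -> x \in C -> y \in R :\: C -> ~~ adj x y.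
Proof.
move=> [_ _ clC] xC; rewrite inE => /andP[yC yR].
by apply: contraNN yC => xy; apply: (clC x y).
Qed.

Lemma conn_card_gt0 S : conn S -> 0 < #|S|.
Proof. by case; rewrite card_gt0. Qed.

End Ambient.


(** * Finite graphs given by adjacency tables *)

(* Short-circuiting variants: [||] and [&&] are strict in the virtual machine. *)
Fixpoint hasl (T : Type) (p : T -> bool) (s : seq T) : bool :=
  if s is x :: s' then if p x then true else hasl p s' else false.
Fixpoint alll (T : Type) (p : T -> bool) (s : seq T) : bool :=
  if s is x :: s' then if p x then alll p s' else false else true.

Lemma haslE T p (s : seq T) : hasl p s = has p s.
Proof. by elim: s => //= x s ->; case: (p x). Qed.
Lemma alllE T p (s : seq T) : alll p s = all p s.
Proof. by elim: s => //= x s ->; case: (p x). Qed.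

Lemma alll_In T (p : T -> bool) s x : List.In x s -> alll p s -> p x.
Proof. by elim: s => //= a s IH [->|xs]; case: ifP => //= _; apply: IH. Qed.

Definition mat n (e : rel nat) : seq (seq bool) :=
  [seq [seq e i j | j <- iota 0 n] | i <- iota 0 n].
Definition tab (M : seq (seq bool)) : rel nat := fun i j => nth false (nth [::] M i) j.

Lemma tab_mat n e i j : i < n -> j < n -> tab (mat n e) i j = e i j.
Proof.
move=> ilt jlt; rewrite /tab (nth_map 0) ?size_iota // (nth_map 0) ?size_iota //.
by rewrite !nth_iota.
Qed.

Fixpoint subs k (l : seq nat) : seq (seq nat) :=
  match k, l with
  | 0, _ => [:: [::]]
  | _.+1, [::] => [::]
  | k'.+1, x :: l' => [seq x :: s | s <- subs k' l'] ++ subs k l'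
  end.

Lemma filter_subs (P : pred nat) l : [seq x <- l | P x] \in subs (count P l) l.
Proof.
elim: l => //= x l IH; case: (P x) => /=; first by rewrite add1n /= mem_cat map_f.
rewrite add0n; case: (count P l) IH => [|k] IH; last by rewrite /= mem_cat IH orbT.
by case: (l) IH.
Qed.

Lemma subs_sub k l s : s \in subs k l -> size s = k /\ {subset s <= l}.
Proof.
elim: l k s => [|x l IH] [|k] s //=; try by rewrite inE => /eqP->.
rewrite mem_cat => /orP[/mapP[t /IH[st tl] ->]|/IH[ss sl]] /=.
  split=> [|i]; first by rewrite st.
  by rewrite !inE => /orP[->//|/tl->]; rewrite orbT.
by split=> // i /sl; rewrite inE => ->; rewrite orbT.
Qed.

Definition undom (e : rel nat) (L D : seq nat) : seq nat :=
  [seq i <- L | ~~ hasl (fun d => (i == d) || e d i) D].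
Definition p3b (e : rel nat) (U : seq nat) : bool := alll (fun b => count (e b) U <= 1) U.
(** As in [quiso], the dominating set may leave the set [L] to be isolated: it ranges over 0, ..., n
    - 1. *)
Definition isolb e L k n := hasl (fun D => p3b e (undom e L D)) (subs k (iota 0 n)).
Definition degb (e : rel nat) n i := count (e i) (iota 0 n).
Definition subcubicb (e : rel nat) n := alll (fun i => degb e n i <= 3) (iota 0 n).

Definition isC6 (e : rel nat) n (p : seq nat) :=
  (6 <= size p) && alll (ltn^~ n) p && alll (fun i => alll (fun j =>
    e (nth 0 p i) (nth 0 p j) == symcl (cycler 6) i j) (iota 0 6)) (iota 0 6).

(** Paths are stored in reverse, with the start last. The start stays the smallest vertex, and a new
    vertex sees no earlier one besides the head, except possibly the start in the closing step.
    [isC6] tests the six vertices again. *)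
Definition extend_path (e : rel nat) n (close : bool) (p : seq nat) : seq (seq nat) :=
  let s := last 0 p in
  let q := behead p in
  let q' := if close then belast (head 0 q) (behead q) else q in
  [seq j :: p | j <- iota 0 n &
    if e (head 0 p) j then if s < j then ~~ hasl (e j) q' else false else false].

Definition C6b (e : rel nat) n :=
  let step c ps := flatten [seq extend_path e n c p | p <- ps] in
  let p5 := iter 4 (step false) [seq [:: i] | i <- iota 0 n] in
  hasl (isC6 e n) (step true p5).

Definition isPerm (e e' : rel nat) n (p : seq nat) :=
  [&& alll (ltn^~ n) p, uniq p, size p == n &
   alll (fun i => alll (fun j => e (nth 0 p i) (nth 0 p j) == e' i j) (iota 0 n)) (iota 0 n)].

(** Backtracking over partial isomorphisms; the complete map is tested again at the leaves by
    [isPerm]. *)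
Fixpoint iso_search (e e' : rel nat) n k (p : seq nat) : bool :=
  if k is k'.+1 then
    hasl (fun c => if c \in p then false else
      if alll (fun j => e c (nth 0 p j) == e' (size p) j) (iota 0 (size p))
      then iso_search e e' n k' (rcons p c) else false) (iota 0 n)
  else isPerm e e' n p.

Definition isoEb (e : rel nat) n :=
  hasl (fun c => if c.1 == n then
    let M := mat n (symcl c.2) in iso_search e (tab M) n n [::] else false) codes.

(* Row k lists the neighbours of the new vertex m + k among the smaller vertices. *)
Definition extend (e : rel nat) m (rows : seq (seq nat)) : rel nat := fun i j =>
  if (i < m) && (j < m) then e i j else
  if i < j then i \in nth [::] rows (j - m) else
  if j < i then j \in nth [::] rows (i - m) else false.

Definition connb (e : rel nat) (L : seq nat) :=
  let R := iter (size L) (fun s => [seq i <- L | (i \in s) || has (e i) s]) [:: head 0 L] in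
  alll (fun i => i \in R) L.

(** * Soundness of the table computations *)

Section Tables.
Variable G : sgraph.
Implicit Types (x y z v w : G) (S T : {set G}) (g : nat -> G).

Lemma rep_ext n e e' g : (forall i j, i < n -> j < n -> e i j = e' i j) ->
  rep n e g -> rep n e' g.
Proof. by move=> E [gI gA]; split=> // i j il jl; rewrite gA ?E. Qed.

Lemma rep_mat n e g : rep n e g -> rep n (tab (mat n e)) g.
Proof. by apply: rep_ext => i j il jl; rewrite tab_mat. Qed.

Lemma img_inj n e g i (L : seq nat) : rep n e g -> i < n -> {subset L <= iota 0 n} ->
  (g i \in img g L) = (i \in L).
Proof.
move=> [gI _] il Ln; apply/imgP/idP => [[j jL /gI E]|iL]; last by exists i.
by rewrite E //; have := Ln _ jL; rewrite mem_iota.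
Qed.

Lemma card_img n e g (L : seq nat) : rep n e g -> {subset L <= iota 0 n} -> uniq L ->
  #|img g L| = size L.
Proof.
move=> [gI _] Ln uL; rewrite cardsE -(size_map g); apply/card_uniqP.
rewrite map_inj_in_uniq // => i j /Ln + /Ln; rewrite !mem_iota => iL jL.
exact: gI.
Qed.

Lemma rep_p3free n e g U : rep n e g -> {subset U <= iota 0 n} -> p3b e U ->
  p3free (img g U).
Proof.
move=> [gI gA] Un; rewrite /p3b alllE => /allP p3 a b c.
move=> /imgP[i iU ->] /imgP[j jU ->] /imgP[k kU ->].
have lt t : t \in U -> t < n by move/Un; rewrite mem_iota.
rewrite adjC !gA ?lt // => ji jk; congr g.
have := p3 _ jU; rewrite -size_filter.
have iF : i \in [seq x <- U | e j x] by rewrite mem_filter ji.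
have kF : k \in [seq x <- U | e j x] by rewrite mem_filter jk.
case: [seq x <- U | e j x] iF kF => [|a0 [|a1 s]] //.
by rewrite !inE => /eqP-> /eqP->.
Qed.

Lemma img_undom n e g L D : rep n e g -> {subset L <= iota 0 n} ->
  {subset D <= iota 0 n} -> img g L :\: closed_nbhd (img g D) \subset img g (undom e L D).
Proof.
move=> [gI gA] Ln Dn; apply/subsetP=> x; rewrite inE => /andP[xD /imgP[i iL xE]].
rewrite xE mem_img // mem_filter iL andbT; apply/negP; rewrite haslE => /hasP[d dD id_].
case/negP: xD; apply/in_closed_nbhd; exists (g d); first exact: mem_img.
case/orP: id_ => [/eqP<-|edi]; first by rewrite xE eqxx.
have := Ln _ iL; have := Dn _ dD; rewrite !mem_iota /= => dn iN.
by rewrite xE gA // edi orbT.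
Qed.

Lemma card_img_leq g D : #|img g D| <= size D.
Proof. by rewrite cardsE; apply: leq_trans (card_size _) _; rewrite size_map. Qed.

Lemma rep_quiso n e g L k m : rep n e g -> {subset L <= iota 0 n} -> m <= n ->
  isolb e L k m -> quiso (img g L) (4 * k).
Proof.
move=> gr Ln mn; rewrite /isolb haslE => /hasP[D /subs_sub[sD Dm] p3].
have Dn : {subset D <= iota 0 n}.
  by move=> d /Dm; rewrite !mem_iota /= => /leq_trans; apply.
exists (img g D); first by rewrite leq_mul2l /= -sD card_img_leq.
apply: (p3free_sub (img_undom gr Ln Dn)); apply: (rep_p3free gr) p3.
by move=> i; rewrite mem_filter => /andP[_ /Ln].
Qed.

Lemma rep_C6 n e g : rep n e g -> C6b e n -> has_induced_C6 G.
Proof.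
move=> [gI gA]; rewrite /C6b haslE => /hasP[p _] /andP[/andP[sp]].
rewrite !alllE => /allP pn /allP pA; apply/induced_C6P.
exists (fun i => g (nth 0 p i)).
have pA' i j : i < 6 -> j < 6 -> e (nth 0 p i) (nth 0 p j) = symcl (cycler 6) i j.
  move=> il jl; have := pA i; rewrite mem_iota alllE il => /(_ isT)/allP/(_ j).
  by rewrite mem_iota jl => /(_ isT)/eqP.
have pl i : i < 6 -> nth 0 p i < n.
  by move=> il; apply: pn; apply: mem_nth; apply: leq_trans sp.
split=> i j il jl; last by rewrite gA ?pA' ?pl.
move=> gE.
(* Distinct vertices of a 6-cycle have distinct neighbourhoods, so injectivity follows from the
   adjacency pattern. *)
have E k : k < 6 -> symcl (cycler 6) i k = symcl (cycler 6) j k.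
  by move=> kl; rewrite -!pA' // -!gA ?pl // gE.
move: il jl (E 0 isT) (E 1 isT) (E 2 isT) (E 3 isT) (E 4 isT) (E 5 isT).
by case: i {E gE} => [|[|[|[|[|[|i]]]]]] //; case: j => [|[|[|[|[|[|j]]]]]].
Qed.

Lemma iso_searchP (e e' : rel nat) n k p : iso_search e e' n k p -> exists q, isPerm e e' n q.
Proof.
elim: k p => [|k IH] p /=; first by exists p.
by rewrite haslE => /hasP[c _]; case: ifP => // _; case: ifP => // _ /IH.
Qed.

Lemma rep_isoE n e g : rep n e g -> isoEb e n -> bad (img g (iota 0 n)).
Proof.
move=> [gI gA]; rewrite /isoEb.
have : forall s, (forall c, List.In c s -> List.In c codes) ->
  hasl (fun c => if c.1 == n then iso_search e (tab (mat n (symcl c.2))) n n [::]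
                 else false) s -> exists2 c, List.In c codes &
  c.1 == n /\ iso_search e (tab (mat n (symcl c.2))) n n [::].
  elim=> //= c s IH sc; case: ifP => [|_]; last by apply: IH => d ds; apply: sc; right.
  by case: ifP => // cn es _; exists c => //; apply: sc; left.
move=> /(_ codes (fun _ => id)) H /H[c cin [/eqP cn /iso_searchP[q]]].
case/and4P; rewrite !alllE => /allP qn uq /eqP sq /allP qA; exists c; rewrite // cn.
have ql i : i < n -> nth 0 q i < n by move=> il; apply/qn/mem_nth; rewrite sq.
exists (fun i => g (nth 0 q i)).
  split=> i j il jl.
    by move/gI => /(_ (ql _ il) (ql _ jl)) /eqP; rewrite nth_uniq ?sq // => /eqP.
  have := qA i; rewrite mem_iota il alllE => /(_ isT)/allP/(_ j).
  by rewrite mem_iota jl => /(_ isT)/eqP; rewrite tab_mat // gA ?ql // => ->.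
have qE : q =i iota 0 n.
  have := uniq_min_size uq (s2 := iota 0 n); rewrite size_iota sq leqnn.
  by case=> // i /qn; rewrite mem_iota.
apply/setP=> x; apply/imgP/imgP => -[i iI ->]; last first.
  exists (nth 0 q i) => //; rewrite -qE mem_nth // sq.
  by rewrite mem_iota in iI.
exists (index i q); last by rewrite nth_index ?qE.
by rewrite mem_iota /= -sq index_mem qE.
Qed.

Lemma rep_deg n e g i : (forall x, #|nbhd x| <= 3) -> rep n e g -> i < n -> degb e n i <= 3.
Proof.
move=> sc gr il; rewrite /degb -size_filter.
have sub : {subset [seq x <- iota 0 n | e i x] <= iota 0 n}.
  by move=> j; rewrite mem_filter => /andP[].
rewrite -(card_img gr sub) ?filter_uniq ?iota_uniq //.
apply: leq_trans (sc (g i)); apply: subset_leq_card; apply/subsetP=> x.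
case/imgP=> j; rewrite mem_filter mem_iota => /andP[eij /= jl] ->.
by rewrite inE; case: gr => _ ->.
Qed.

Lemma rep_subcubic n e g : (forall x, #|nbhd x| <= 3) -> rep n e g -> subcubicb e n.
Proof.
move=> sc gr; rewrite /subcubicb alllE; apply/allP=> i; rewrite mem_iota => /= il.
exact: rep_deg gr il.
Qed.

(** Closed sets through one vertex suffice: if T misses x, then S - T is closed and contains x. *)
Lemma conn_intro S x : x \in S ->
  (forall T, T \subset S -> x \in T -> closed_in S T -> S \subset T) -> conn S.
Proof.
move=> xS H; split=> [|T TS /set0Pn[t tT] clT]; first by apply/set0Pn; exists x.
case xT: (x \in T); first exact: H.
have /subsetP sub : S \subset S :\: T.
  apply: H; rewrite ?inE ?xT ?subsetDl // => a b.
  rewrite !inE => /andP[aT aS] bS ab; rewrite bS andbT; apply: contraNN aT => bT.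
  by apply: (clT b a) => //; rewrite adjC.
by have := sub t (subsetP TS _ tT); rewrite inE tT.
Qed.

Lemma rep_conn n e g (L : seq nat) : rep n e g -> {subset L <= iota 0 n} -> L != [::] ->
  connb e L -> conn (img g L).
Proof.
move=> [gI gA] Ln Lne; rewrite /connb alllE => /allP reach.
have hL : head 0 L \in L by case: (L) Lne => // a l _; rewrite mem_head.
have lt t : t \in L -> t < n by move/Ln; rewrite mem_iota.
apply: (@conn_intro _ (g (head 0 L))); first exact: mem_img.
move=> T _ hT clT; apply/subsetP=> x /imgP[i iL ->].
have := reach i iL; elim: (size L) i iL => [|k IH] i iL /=; first by rewrite inE => /eqP->.
rewrite mem_filter => /andP[/orP[/(IH i iL)//|/hasP[j js eij]] _].
have jL : j \in L.
  by move: js; case: (k) => [|k'] /=; [rewrite inE => /eqP-> | rewrite mem_filter => /andP[]].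
by apply: (clT (g j) (g i)); rewrite ?IH ?mem_img // adjC gA ?lt.
Qed.

Definition extend_fun g m (ys : seq G) (i : nat) : G :=
  if i < m then g i else nth (g 0) ys (i - m).

Lemma rep_extend m e g (ys : seq G) : rep m e g -> uniq ys ->
  (forall y, y \in ys -> y \notin img g (iota 0 m)) ->
  let g' := extend_fun g m ys in
  rep (m + size ys)
   (extend e m [seq [seq j <- iota 0 (m + k) | adj (g' (m + k)) (g' j)] |
     k <- iota 0 (size ys)]) g'.
Proof.
move=> [gI gA] uy yK g'.
have g'y i : m <= i -> i < m + size ys -> g' i \in ys.
  by move=> mi il; rewrite /g' /extend_fun ltnNge mi /= mem_nth // ltn_subLR.
have g'g i : i < m -> g' i = g i by rewrite /g' /extend_fun => ->.
have cross i j : i < m -> m <= j -> j < m + size ys -> g' i <> g' j.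
  move=> im mj jl E; have /yK/negP[] := g'y j mj jl.
  by rewrite -E g'g // mem_img // mem_iota.
split=> i j il jl.
  case: (ltnP i m) => im; case: (ltnP j m) => jm.
  - by rewrite !g'g //; apply: gI.
  - by move/cross; case.
  - by move/esym/cross; case.
  rewrite /g' /extend_fun ltnNge im ltnNge jm /= => /eqP.
  rewrite nth_uniq ?ltn_subLR // => /eqP; lia.
have row a b : a < b -> m <= b -> b < m + size ys -> adj (g' b) (g' a) =
   (a \in nth [::] [seq [seq j <- iota 0 (m + k) | adj (g' (m + k)) (g' j)] |
      k <- iota 0 (size ys)] (b - m)).
  move=> ab mb bl; have bs : b - m < size ys by rewrite ltn_subLR.
  rewrite (nth_map 0) ?size_iota // nth_iota // add0n subnKC // mem_filter mem_iota.
  by rewrite /= add0n ab andbT.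
rewrite /extend; case: ifP => [/andP[im jm]|ijm]; first by rewrite !g'g ?gA.
case: (ltngtP i j) => [ij|ji|->]; last by rewrite adjxx.
- by rewrite -row 1?adjC // leqNgt; apply: contraFN ijm => jm; rewrite jm (ltn_trans ij).
- by rewrite -row // leqNgt; apply: contraFN ijm => im; rewrite im (ltn_trans ji).
Qed.

End Tables.


(** * Computations on the twelve exceptional graphs *)

(** Criticality: since m is 3 modulo 4, [m %/ 4] is (m - 3) / 4, so deleting any vertex brings the
    cost down to m - 3. *)
Definition crit_check (c : nat * rel nat) :=
  let m := c.1 in let e := tab (mat m (symcl c.2)) in
  (m %% 4 == 3) && alll (fun x => isolb e (rem x (iota 0 m)) (m %/ 4) m) (iota 0 m).

Lemma crit_checkP : alll crit_check codes.
Proof. by vm_compute. Qed.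

(** The path P3, at the head of [codes], is the only member that fails this test; it therefore needs
    a separate treatment as a second component. *)
Definition degree_check (c : nat * rel nat) :=
  let m := c.1 in let e := tab (mat m (symcl c.2)) in
  all (fun i => 1 < degb e m i) (iota 0 m) ||
  (1 < count (fun i => degb e m i == 3) (iota 0 m)).

Lemma degree_checkP : alll degree_check (behead codes).
Proof. by vm_compute. Qed.

(** Degree at most two singles out the vertices that can have a neighbour outside the bad set. The
    orders below 4 are skipped because deleting the centre of P3 disconnects it. *)
Definition del_conn_check (c : nat * rel nat) :=
  let m := c.1 in let e := tab (mat m (symcl c.2)) in
  if m <= 4 then true else
  alll (fun z => if degb e m z <= 2 then connb e (rem z (iota 0 m)) else true) (iota 0 m).

Lemma del_conn_checkP : alll del_conn_check codes.
Proof. by vm_compute. Qed.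

Definition free_vertices (e : rel nat) m := [seq i <- iota 0 m | degb e m i <= 2].
(** The possible traces on K of a neighbour of v: one of its three places is taken by v, so it sees
    at most two vertices of K. *)
Definition small_subs (l : seq nat) := [::] :: subs 1 l ++ subs 2 l.

(* K is extended by a path z - y - v - y2, where y2 sees the set S in K; the vertices y2, v
   and y are numbered m, m + 1 and m + 2. *)
Definition ear_check (c : nat * rel nat) :=
  let m := c.1 in let e := tab (mat m (symcl c.2)) in
  let d := m %/ 4 in
  let ss := small_subs (free_vertices e m) in
  if m <= 4 then true else
  alll (fun z => alll (fun S =>
    if (S == [::]) || (S == [:: z]) then true else
    let e' := tab (mat (m + 3) (extend e m [:: S; [:: m]; [:: z; m.+1]])) in
    if subcubicb e' (m + 3) then
      if isolb e' (rem z (iota 0 m.+1)) d m then true else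
      if C6b e' (m + 3) then true else
      if (size S == 2) && (degb e m z == 2)
      then isolb e' ([seq i <- iota 0 m | i \notin S] ++ [:: m.+2]) d m else false
    else true) ss) (free_vertices e m).

Lemma ear_checkP : alll ear_check codes.
Proof. by vm_compute. Qed.

(** Some position is true in both lists: the same set D has to suit both remaining neighbours of
    v. *)
Fixpoint meet (a b : seq bool) : bool :=
  match a, b with
  | x :: a', y :: b' => if x then if y then true else meet a' b' else meet a' b'
  | _, _ => false
  end.

(* Vertex m + 3 is v, and m, m + 1, m + 2 are its neighbours y1, y2, y3, where y_i sees S_i
   in K. *)
Definition star_rows m (S1 S2 S3 : seq nat) (b12 b13 b23 : bool) : seq (seq nat) :=
  [:: S1; S2 ++ nseq b12 m; S3 ++ nseq b13 m ++ nseq b23 m.+1; [:: m; m.+1; m.+2]].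

(** The complete test of K with a star attached, for all eight choices of edges among the three
    neighbours of v. The guards discard configurations in which K is unattached or a degree exceeds
    3. *)
Definition star_slow (e : rel nat) m (S1 S2 S3 : seq nat) :=
  if (S1 == [::]) && (S2 == [::]) && (S3 == [::]) then true else
  if alll (fun i => degb e m i + (i \in S1) + (i \in S2) + (i \in S3) <= 3) (iota 0 m) then
    alll (fun b12 => alll (fun b13 => alll (fun b23 =>
      let n := m + 4 in
      let e' := tab (mat n (extend e m (star_rows m S1 S2 S3 b12 b13 b23))) in
      if subcubicb e' n then
        if isolb e' (iota 0 n) (n %/ 4) n then true else
        if C6b e' n then true else isoEb e' n
      else true) [:: true; false]) [:: true; false]) [:: true; false]
  else true.

(** Together with y1 the set D has (m + 1) / 4 elements, which is affordable for a graph of order m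
    + 4. *)
Definition star_cands (e : rel nat) m (S : seq nat) : seq (seq nat * seq nat) :=
  let l := [seq i <- iota 0 m | i \notin S] in
  [seq q <- [seq (D, undom e l D) | D <- subs (m %/ 4) (iota 0 m)] | p3b e q.2].

(* q = (D, U), where U is the part of K left undominated by y1 and D: a neighbour of v that
   sees S in K is harmless if it is dominated by D or does not see U. *)
Definition star_ok (S : seq nat) (q : seq nat * seq nat) :=
  if hasl (fun i => i \in q.1) S then true else ~~ hasl (fun i => i \in q.2) S.

Definition star_row e m S1 S := [seq star_ok S q | q <- star_cands e m S1].

(* By symmetry only sorted triples i1 <= i2 <= i3 of neighbourhoods are enumerated. *)
Definition star_check (c : nat * rel nat) :=
  let m := c.1 in let e := tab (mat m (symcl c.2)) in
  let ss := small_subs (free_vertices e m) in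
  let T := [seq (let cs := star_cands e m A1 in [seq [seq star_ok A q | q <- cs] | A <- ss])
           | A1 <- ss] in
  let look i j := nth [::] (nth [::] T i) j in
  let ns := iota 0 (size ss) in
  alll (fun i1 => let r1 := nth [::] T i1 in
  alll (fun i2 => let r12 := nth [::] r1 i2 in
  alll (fun i3 => if meet r12 (nth [::] r1 i3) then true else
    if meet (look i2 i1) (look i2 i3) then true else
    if meet (look i3 i1) (look i3 i2) then true else
    star_slow e m (nth [::] ss i1) (nth [::] ss i2) (nth [::] ss i3))
    (iota i2 (size ss - i2))) (iota i1 (size ss - i1))) (iota 0 (size ss)).

Lemma star_checkP : alll star_check codes.
Proof. by vm_compute. Qed.


(** The two adjacent transpositions generate all permutations of a triple. *)
Lemma sort3 (T : Type) (f : T -> nat) (P : T -> T -> T -> Prop) :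
  (forall a b c, P a b c -> P b a c) -> (forall a b c, P a b c -> P a c b) ->
  (forall a b c, f a <= f b -> f b <= f c -> P a b c) -> forall a b c, P a b c.
Proof.
move=> s12 s23 srt a b c.
have srt' x y z : f x <= f y -> P x y z.
  move=> xy; case: (leqP (f y) (f z)) => [yz|/ltnW zy]; first exact: srt.
  apply: s23; case: (leqP (f x) (f z)) => [xz|/ltnW zx]; first exact: srt.
  by apply: s12; apply: srt.
case: (leqP (f a) (f b)) => [ab|/ltnW ba]; first exact: srt'.
by apply: s12; apply: srt'.
Qed.

(** * Bad sets in a subcubic graph *)

Section Bad.
Variable G : sgraph.
Implicit Types (x y z v w : G) (S T K : {set G}) (g : nat -> G).
Hypothesis subcubicG : forall x : G, #|nbhd x| <= 3.

Lemma four_nbrs x (s : seq G) : uniq s -> all (adj x) s -> size s <= 3.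
Proof.
move=> us /allP sx; rewrite -(card_uniqP us); apply: leq_trans (subcubicG x).
by apply: subset_leq_card; apply/subsetP=> y /sx; rewrite inE.
Qed.

Definition two_nbrs S x := exists a b, [/\ a \in S, b \in S, a != b, adj x a & adj x b].
Definition three_nbrs S x := exists a b c,
  [/\ uniq [:: a; b; c], [&& a \in S, b \in S & c \in S] & [&& adj x a, adj x b & adj x c]].

Lemma rep_nbrs n e g i : rep n e g -> i < n ->
  exists s : seq G, [/\ uniq s, all (mem (img g (iota 0 n))) s, all (adj (g i)) s &
    size s = degb e n i].
Proof.
move=> [gI gA] il; exists [seq g j | j <- iota 0 n & e i j]; split.
- rewrite map_inj_in_uniq ?filter_uniq ?iota_uniq // => j k.
  by rewrite !mem_filter !mem_iota => /andP[_ jl] /andP[_ kl]; apply: gI.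
- by apply/allP=> x /mapP[j]; rewrite mem_filter => /andP[_ jl] ->; apply: mem_img.
- apply/allP=> x /mapP[j]; rewrite mem_filter mem_iota => /andP[ej /= jl] ->.
  by rewrite gA.
- by rewrite size_map size_filter.
Qed.

Lemma rep_two_nbrs n e g i : rep n e g -> i < n -> 1 < degb e n i ->
  two_nbrs (img g (iota 0 n)) (g i).
Proof.
move=> gr il d2; have [s [us sn sa ss]] := rep_nbrs gr il.
case: s us sn sa ss => [|a [|b s]] //=; try by move=> _ _ _ E; move: d2; rewrite -E.
rewrite inE negb_or => /andP[/andP[ab _] _] /and3P[an bn _] /and3P[ia ib _] _.
by exists a, b.
Qed.

Lemma rep_three_nbrs n e g i : rep n e g -> i < n -> 2 < degb e n i ->
  three_nbrs (img g (iota 0 n)) (g i).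
Proof.
move=> gr il d2; have [s [us sn sa ss]] := rep_nbrs gr il.
case: s us sn sa ss => [|a [|b [|c s]]]; try by move=> _ _ _ /= E; move: d2; rewrite -E.
move=> us /and4P[an bn cn _] /and4P[ia ib ic _] _; exists a, b, c; split.
- by move: us; rewrite -[[:: a, b, c & s]]/([:: a; b; c] ++ s) cat_uniq => /andP[].
- by apply/and3P.
- by apply/and3P.
Qed.

Lemma bad_mod S : bad S -> #|S| %% 4 = 3.
Proof.
move=> [c cin [g gr ->]]; rewrite (card_img gr) ?iota_uniq ?size_iota //.
by have /andP[/eqP] := alll_In cin crit_checkP.
Qed.

Lemma bad_crit S x : bad S -> x \in S -> quiso (S :\ x) (#|S| - 3).
Proof.
move=> bS xS; move: (bS) => [c cin [g gr SE]].
have /andP[_] := alll_In cin crit_checkP; rewrite alllE => /allP crit.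
move: xS; rewrite SE => /imgP[i iI xE].
have := crit i iI; move/(rep_quiso (rep_mat gr)) => /(_ _ (leqnn _)) H.
have cS : #|S| = c.1 by rewrite SE (card_img gr) ?iota_uniq ?size_iota.
rewrite -SE cS; have -> : c.1 - 3 = 4 * (c.1 %/ 4) by have := bad_mod bS; rewrite cS; lia.
apply: (quiso_sub _ (H _)); last by move=> j /mem_rem.
apply/subsetP=> y; rewrite !inE => /andP[yx]; rewrite SE => /imgP[j jI yE].
rewrite yE map_f // mem_rem_uniq ?iota_uniq // inE jI andbT.
by apply: contraNneq yx => ji; rewrite yE xE ji.
Qed.

(** The degree information used against a second bad component: apart from P3, a member of the
    family supplies two vertices of degree 3 in G, either outright or at the ends of two independent
    leaving edges. *)
Lemma bad_shape S : bad S ->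
  [\/ exists a b c, [/\ S = [set a; b; c], a != c, adj a b, adj b c & ~~ adj a c],
      forall x, x \in S -> two_nbrs S x |
      exists u u', [/\ u \in S, u' \in S, u != u', three_nbrs S u & three_nbrs S u']].
Proof.
move=> [c cin [g gr SE]].
have [cE|ct] : c = (3, pathr) \/ List.In c (behead codes).
  by case: cin => [<-|?]; [left|right].
- rewrite cE /= in gr SE; constructor 1; case: gr => gI gA; exists (g 0), (g 1), (g 2); split.
  + by apply/setP=> x; rewrite SE !inE orbA.
  + by apply/eqP=> /gI; move/(_ isT isT).
  + by rewrite gA.
  + by rewrite gA.
  + by rewrite gA.
have := alll_In ct degree_checkP; rewrite /degree_check /=.
set e := tab _ => /orP[/allP d2|].
  constructor 2 => x; rewrite SE => /imgP[i iI ->].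
  by apply: (rep_two_nbrs (rep_mat gr)); [rewrite mem_iota in iI | apply: d2].
rewrite -size_filter => d3; constructor 3.
have: uniq [seq i <- iota 0 c.1 | degb e c.1 i == 3] by rewrite filter_uniq ?iota_uniq.
case E : [seq i <- iota 0 c.1 | degb e c.1 i == 3] d3 => [|i [|j s]] //= _.
rewrite inE negb_or => /andP[/andP[ij _] _].
have /[!mem_filter] /andP[/eqP di] : i \in [seq i <- iota 0 c.1 | degb e c.1 i == 3].
  by rewrite E mem_head.
have /[!mem_filter] /andP[/eqP dj] : j \in [seq i <- iota 0 c.1 | degb e c.1 i == 3].
  by rewrite E !inE eqxx orbT.
rewrite !mem_iota /= => jl il; exists (g i), (g j).
rewrite SE !mem_img ?mem_iota //; split=> //.
- by apply: contraNneq ij; case: gr => gI _ /gI->.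
- by apply: (rep_three_nbrs (rep_mat gr)) => //; rewrite -/e di.
- by apply: (rep_three_nbrs (rep_mat gr)) => //; rewrite -/e dj.
Qed.

(** Dominating any vertex costs 4 and leaves at most |S| - 3 for the rest. *)
Lemma quiso_bad S : bad S -> quiso S (#|S|.+1).
Proof.
move=> bS; have S0 : 0 < #|S| by have := bad_mod bS; case: #|S|.
have [x xS] : exists x, x \in S by apply/set0Pn; rewrite -card_gt0.
apply: (@quiso_leq _ _ (4 + (#|S| - 3))); first by have := bad_mod bS; lia.
apply: (quiso_dom (x := x)); apply: quiso_sub (bad_crit bS xS).
by apply: setDS; rewrite sub1set !inE eqxx.
Qed.

Lemma out_degree n e g i y : rep n e g -> i < n -> y \notin img g (iota 0 n) ->
  adj y (g i) -> degb e n i <= 2.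
Proof.
move=> gr il yS yi; rewrite leqNgt; apply/negP => /(rep_three_nbrs gr il)[a [b [c []]]].
move=> u3 /and3P[aS bS cS] /and3P[ia ib ic].
have := @four_nbrs (g i) [:: y; a; b; c]; rewrite /= ia ib ic adjC yi /=.
move: u3 => /= ->; rewrite andbT !inE !negb_or.
have ne z : z \in img g (iota 0 n) -> y != z by apply: contraTneq => <-.
by rewrite !ne // => /(_ isT isT).
Qed.

Lemma bad_del_conn S z y : bad S -> 4 < #|S| -> z \in S -> y \notin S -> adj y z ->
  conn (S :\ z).
Proof.
move=> [c cin [g gr SE]] S4 zS yS yz.
have cS : #|S| = c.1 by rewrite SE (card_img gr) ?iota_uniq ?size_iota.
have := alll_In cin del_conn_checkP; rewrite /del_conn_check -cS leqNgt S4 /= cS.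
rewrite alllE => /allP chk.
move: zS; rewrite SE => /imgP[i iI zE].
have := chk i iI; rewrite (@out_degree _ _ g _ y (rep_mat gr)) -?SE //; last first.
- by rewrite -zE.
- by rewrite mem_iota in iI.
move/(rep_conn (rep_mat gr)) => H.
have -> : S :\ z = img g (rem i (iota 0 c.1)).
  apply/setP=> x; rewrite inE SE in_set1; apply/andP/imgP => [[xz /imgP[j jI xE]]|[j]].
    exists j => //; rewrite mem_rem_uniq ?iota_uniq // inE jI andbT.
    by apply: contraNneq xz => ji; rewrite xE zE ji.
  rewrite mem_rem_uniq ?iota_uniq // inE => /andP[ji jI] ->; split; last exact: mem_img.
  case: gr => gI _; rewrite zE; apply: contraNneq ji => /gI->//.
    by rewrite mem_iota in jI.
  by rewrite mem_iota in iI.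
apply: H; first by move=> j /mem_rem.
by rewrite -size_eq0 size_rem // size_iota -cS; case: #|S| S4 => [|[]].
Qed.

(** One place at y is taken by v, and a vertex with three neighbours inside the copy cannot see
    y. *)
Lemma nbr_list n e g y v : rep n e g -> y \notin img g (iota 0 n) ->
  v \notin img g (iota 0 n) -> adj y v ->
  [seq j <- iota 0 n | adj y (g j)] \in small_subs (free_vertices e n).
Proof.
move=> gr yS vS yv.
have -> : [seq j <- iota 0 n | adj y (g j)] =
          [seq j <- free_vertices e n | adj y (g j)].
  rewrite -filter_predI; apply: eq_in_filter => j; rewrite mem_iota => /= jl.
  case yj: (adj y (g j)) => //=.
  by rewrite (out_degree gr jl yS yj).
set P := fun j => adj y (g j); have := filter_subs P (free_vertices e n).
suff : count P (free_vertices e n) <= 2.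
  rewrite /small_subs in_cons mem_cat; case: (count _ _) => [|[|[|k]]] // _.
  + by case: (free_vertices e n) => [|a l]; rewrite inE => ->.
  + by move=> ->; rewrite orbT.
  + by move=> ->; rewrite !orbT.
pose s := [seq g j | j <- free_vertices e n & P j].
have := @four_nbrs y (v :: s); rewrite /= yv size_map size_filter; apply.
  have sub j : j \in [seq j <- free_vertices e n | P j] -> j < n.
    by rewrite !mem_filter mem_iota => /and3P[].
  apply/andP; split.
    apply: contra vS => /mapP[j /sub jl ->]; apply: mem_img.
    by rewrite mem_iota.
  rewrite map_inj_in_uniq ?filter_uniq ?iota_uniq // => j k /sub jl /sub kl.
  by case: gr => gI _; apply: gI.
by apply/allP=> x /mapP[j]; rewrite mem_filter => /andP[Pj _] ->.
Qed.
End Bad.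



(** * Bad sets extended by an ear or by a star *)

Section Extensions.
Variable G : sgraph.
Implicit Types (x y z v w : G) (S T K : {set G}) (g : nat -> G).
Hypothesis subcubicG : forall x : G, #|nbhd x| <= 3.

Lemma extend_fun_old g m (ys : seq G) i : i < m -> extend_fun g m ys i = g i.
Proof. by rewrite /extend_fun => ->. Qed.

Lemma extend_fun_new g m (ys : seq G) k : extend_fun g m ys (m + k) = nth (g 0) ys k.
Proof. by rewrite /extend_fun ltnNge leq_addr addKn. Qed.

Lemma rep_extend_rows m e g (ys : seq G) : rep m e g -> uniq ys ->
  (forall y, y \in ys -> y \notin img g (iota 0 m)) ->
  rep (m + size ys) (extend e m
   [seq (let y := nth (g 0) ys k in [seq j <- iota 0 m | adj y (g j)] ++
      [seq m + i | i <- iota 0 k & adj y (nth (g 0) ys i)]) | k <- iota 0 (size ys)])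
   (extend_fun g m ys).
Proof.
move=> gr uys ysK; have := rep_extend gr uys ysK; rewrite /=.
congr (rep _ (extend _ _ _) _); apply: eq_map => k.
have mE : iota m k = [seq m + i | i <- iota 0 k] by rewrite -iotaDl addn0.
rewrite extend_fun_new iotaD filter_cat add0n mE filter_map.
congr (_ ++ _); first by apply: eq_in_filter => j; rewrite mem_iota => /= jl;
  rewrite extend_fun_old.
by congr map; apply: eq_filter => i /=; rewrite extend_fun_new.
Qed.

(** Used for an ear z - y - v - y2 over K. The second outcome serves after dominating y, which
    removes z from K; the third after dominating y2, which leaves y but removes the neighbours of y2
    in K. Both remaining sets cost only |K| - 3. *)
Lemma bad_ear K z y2 v y : bad K -> 4 < #|K| -> z \in K ->
  y2 \notin K -> v \notin K -> y \notin K -> adj v y2 -> adj v y -> ~~ adj y y2 -> y != y2 ->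
  (forall k, k \in K -> ~~ adj v k) -> (forall k, k \in K -> adj y k = (k == z)) ->
  (exists2 x, x \in K & (x != z) && adj y2 x) ->
  [\/ has_induced_C6 G, quiso (y2 |: K :\ z) (#|K| - 3) |
   [/\ two_nbrs K y2, two_nbrs K z & quiso (y |: (K :\: nbhd y2)) (#|K| - 3)]].
Proof.
move=> bK K4 zK y2K vK yK vy2 vy yy2 yNy2 vN yN [x xK /andP[xz y2x]].
have Kmod := bad_mod bK.
case: (bK) => c cin [g gr KE].
have cS : #|K| = c.1 by rewrite KE (card_img gr) ?iota_uniq ?size_iota.
have d4 : 4 * (c.1 %/ 4) = c.1 - 3 by move: Kmod; rewrite cS; lia.
have {gr} gr := rep_mat gr.
have := alll_In cin ear_checkP; rewrite /ear_check -cS leqNgt K4 cS; cbv zeta beta.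
move: gr cS KE d4; move: (c.1) => m; set e := tab _ => gr cS KE d4; rewrite alllE => /allP chk.
pose ys := [:: y2; v; y].
have uys : uniq ys.
  by rewrite /= !inE negb_or (eq_sym y2 v) (adj_neq vy2) (adj_neq vy) eq_sym yNy2.
have ysK u : u \in ys -> u \notin img g (iota 0 m).
  by rewrite -KE !inE => /or3P[] /eqP->.
move: zK (zK); rewrite {1}KE => /imgP[iz izI zE] zK.
have izm : iz < m by rewrite mem_iota in izI.
pose A := [seq j <- iota 0 m | adj y2 (g j)].
have := rep_extend_rows gr uys ysK; rewrite /= -/A.
set g' := extend_fun g m ys.
have -> : [seq j <- iota 0 m | adj v (g j)] = [::].
  apply/eqP; rewrite -(negbK (_ == _)) -has_filter; apply/hasPn=> j jI.
  by apply: vN; rewrite KE mem_img.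
have -> : [seq j <- iota 0 m | adj y (g j)] = [:: iz].
  rewrite -(filter_pred1_uniq (iota_uniq 0 m) izI); apply: eq_in_filter => j jI /=.
  rewrite yN ?KE ?mem_img // zE; apply/eqP/eqP => [|->//].
  by case: gr => gI _ /gI; apply=> //; rewrite mem_iota in jI.
rewrite vy2 (adjC y v) vy (negPf yy2) /= cats0 addn0 addn1 => /rep_mat.
set e' := tab _ => gr'.
have AS : A \in small_subs (free_vertices e m).
  by apply: (nbr_list subcubicG gr _ _ (v := v)); rewrite -?KE // adjC.
have zf : iz \in free_vertices e m.
  rewrite mem_filter izI andbT; apply: (out_degree subcubicG gr izm (y := y)).
    by rewrite -KE.
  by rewrite -zE yN ?eqxx.
move: (chk _ zf) => {chk}; rewrite alllE => /allP/(_ _ AS).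
have [ix ixI xE] : exists2 i, i \in iota 0 m & x = g i by apply/imgP; rewrite -KE.
have ixA : ix \in A by rewrite mem_filter -xE y2x.
have -> : (A == [::]) || (A == [:: iz]) = false.
  apply/norP; split; apply/eqP=> AE; move: ixA; rewrite AE // inE => /eqP ixz.
  by rewrite xE zE ixz eqxx in xz.
rewrite -/e' (rep_subcubic subcubicG gr').
have g'new k : g' (m + k) = nth (g 0) ys k by apply: extend_fun_new.
case: ifP => [/(rep_quiso gr') Q _|_].
  constructor 2; rewrite -d4.
  apply: quiso_sub (Q _ (leq_addr _ _)).
    apply/subsetP=> u; rewrite !inE => /orP[/eqP->|/andP[uz]].
      have -> : y2 = g' m by rewrite -[m]addn0 g'new.
      by rewrite map_f // mem_rem_uniq ?iota_uniq // inE mem_iota add0n ltnSn gtn_eqF.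
    rewrite KE => /imgP[j jI uE]; have jm : j < m by rewrite mem_iota in jI.
    rewrite uE -(extend_fun_old g ys jm) map_f // mem_rem_uniq ?iota_uniq // inE mem_iota.
    rewrite add0n ltnS (ltnW jm) !andbT; apply: contraNneq uz => jz; rewrite uE zE jz //.
  move=> j /mem_rem; rewrite !mem_iota !add0n ltnS /= => /leq_ltn_trans; apply.
  by rewrite addn3 ltnS leqW.
case: ifP => [/(rep_C6 gr') C6 _|_]; first by constructor 1.
case: ifP => // /andP[/eqP A2 /eqP z2] /(rep_quiso gr') Q; constructor 3; split.
- have uA : uniq A by rewrite filter_uniq ?iota_uniq.
  have sA j : j \in A -> (j < m) && adj y2 (g j) by rewrite mem_filter mem_iota andbC.
  case: (A) A2 uA sA => [|a [|b []]] //= _; rewrite inE andbT => ab sA.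
  have /andP[am ya] := sA a (mem_head _ _).
  have /andP[bm yb] : (b < m) && adj y2 (g b) by apply: sA; rewrite !inE eqxx orbT.
  exists (g a), (g b); rewrite KE !mem_img ?mem_iota //; split=> //.
  by apply: contraNneq ab; case: gr => gI _ /gI->.
- by rewrite zE KE; apply: (rep_two_nbrs gr) => //; rewrite z2.
rewrite -d4; apply: quiso_sub (Q _ (leq_addr _ _)); last first.
  move=> j; rewrite mem_cat mem_filter !mem_iota inE /= => /orP[/andP[_ jm]|/eqP->].
    exact: leq_trans jm (leq_addr _ _).
  by rewrite addn3.
apply/subsetP=> u; rewrite !inE map_cat mem_cat => /orP[/eqP->|/andP[uy]].
  by rewrite /= inE -addn2 g'new eqxx orbT.
rewrite KE => /imgP[j jI uE]; have jm : j < m by rewrite mem_iota in jI.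
rewrite uE -(extend_fun_old g ys jm) map_f // mem_filter jI andbT mem_filter.
by rewrite negb_and -uE uy.
Qed.

Lemma meet_map (T : eqType) (f h : T -> bool) l :
  meet (map f l) (map h l) -> exists2 q, q \in l & f q && h q.
Proof.
elim: l => //= a l IH; case fa: (f a); first case ha: (h a).
- by exists a; rewrite ?mem_head // fa ha.
- by move/IH => [q ql fq]; exists q => //; rewrite inE ql orbT.
- by move/IH => [q ql fq]; exists q => //; rewrite inE ql orbT.
Qed.

Definition nbr_idx g m y := [seq j <- iota 0 m | adj y (g j)].

(** Take y1 together with the common D. What survives is contained in U, which has no P3, together
    with y2 and y3; those of the two that survive have no neighbour in U and can add at most the
    edge between them. *)
Lemma star_fast m e g v y1 y2 y3 : rep m e g ->
  (forall w, adj v w = (w \in [:: y1; y2; y3])) ->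
  (forall x, x \in img g (iota 0 m) \/ x \in [:: y1; y2; y3; v]) ->
  meet (star_row e m (nbr_idx g m y1) (nbr_idx g m y2))
       (star_row e m (nbr_idx g m y1) (nbr_idx g m y3)) ->
  quiso [set: G] (4 * (m %/ 4).+1).
Proof.
move=> gr vN cov /meet_map[[D U] /[!mem_filter] /andP[/= p3 /mapP[D' Ds [DE UE]]]].
rewrite -{}DE in Ds UE; have [sD Dm] := subs_sub Ds => /andP[ok2 ok3].
have Um j : j \in U -> j \in iota 0 m by rewrite UE !mem_filter => /and3P[].
have star y w : star_ok (nbr_idx g m y) (D, U) -> y \notin closed_nbhd (y1 |: img g D) ->
    w \in img g U -> ~~ adj y w.
  rewrite /star_ok !haslE; case: ifP => [/hasP[d /[!mem_filter] /andP[yd dm] dD] _|_].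
    case/negP; apply/in_closed_nbhd; exists (g d); rewrite ?inE 1?adjC ?yd ?orbT //.
    by rewrite map_f ?orbT.
  move=> /hasPn nU _ /imgP[i iU ->]; apply: contraL (iU) => yi; apply: nU.
  by rewrite mem_filter yi Um.
exists (y1 |: img g D).
  rewrite leq_mul2l /= cardsU1; apply: leq_trans (leq_add (leq_b1 _) (card_img_leq g D)) _.
  by rewrite sD.
set X := _ :\: _.
have XE x : x \in X -> [\/ x \in img g U, x = y2 | x = y3].
  rewrite in_setD in_setT andbT => xD.
  have xD1 : ~~ ((x == y1) || adj y1 x).
    apply: contra xD => ?; apply/in_closed_nbhd; exists y1 => //; exact: setU11.
  have {cov} [] := cov x; last first.
    rewrite !inE => /or4P[] /eqP xE; [|by constructor 2|by constructor 3|].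
      by rewrite xE eqxx in xD1.
    by rewrite xE adjC vN mem_head orbT in xD1.
  move=> /imgP[j jI xE]; constructor 1; rewrite UE.
  apply: (subsetP (img_undom gr _ Dm)); first by move=> i; rewrite mem_filter => /andP[].
  rewrite in_setD; apply/andP; split.
    apply: contra xD => /in_closed_nbhd[d dD xd]; apply/in_closed_nbhd; exists d => //.
    by rewrite inE dD orbT.
  rewrite xE mem_img // mem_filter jI andbT mem_filter jI andbT -xE.
  by move: xD1; rewrite negb_or => /andP[].
have Xd x : x \in X -> x \notin closed_nbhd (y1 |: img g D) by rewrite in_setD => /andP[].
have p3U := rep_p3free gr Um p3.
move=> a b c aX bX cX ab bc.
have nbU w : w \in X -> adj w b -> b \in img g U -> w \in img g U.
  move=> wX wb bU; case: (XE _ wX) => // wE; move: (Xd _ wX) wb; rewrite wE => yd yb.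
    by have := star y2 b ok2 yd bU; rewrite yb.
  by have := star y3 b ok3 yd bU; rewrite yb.
have nby (y y' w : G) : star_ok (nbr_idx g m y) (D, U) -> b = y ->
    (forall x, x \in X -> [\/ x \in img g U, x = y | x = y']) ->
    w \in X -> adj b w -> w = y'.
  move=> ok bE XE' wX bw; case: (XE' _ wX) => // wE.
    by have := star y w ok; rewrite -bE => /(_ (Xd _ bX) wE); rewrite bw.
  by rewrite wE bE adjxx in bw.
case: (XE _ bX) => [bU|bE|bE].
- by apply: (p3U a b c) => //; apply: nbU => //; rewrite adjC.
- have -> : a = y3 by apply: (nby y2) => //; rewrite adjC.
  by symmetry; apply: (nby y2).
- have XE' x : x \in X -> [\/ x \in img g U, x = y3 | x = y2].
    by move/XE => []; [constructor 1|constructor 3|constructor 2].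
  have -> : a = y2 by apply: (nby y3) => //; rewrite adjC.
  by symmetry; apply: (nby y3).
Qed.

Lemma star_slowP m e g v y1 y2 y3 : rep m e g -> m %% 4 = 3 ->
  uniq [:: y1; y2; y3] -> (forall w, adj v w = (w \in [:: y1; y2; y3])) ->
  (forall y, y \in [:: y1; y2; y3; v] -> y \notin img g (iota 0 m)) ->
  (forall x, x \in img g (iota 0 m) \/ x \in [:: y1; y2; y3; v]) ->
  (exists2 k, k \in img g (iota 0 m) & exists2 y, y \in [:: y1; y2; y3] & adj y k) ->
  star_slow e m (nbr_idx g m y1) (nbr_idx g m y2) (nbr_idx g m y3) ->
  [\/ has_induced_C6 G, quiso [set: G] #|G| | bad [set: G]].
Proof.
move=> gr m3 uy vN ysK cov [k kK [y0 y0y y0k]].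
have vy i : i \in [:: y1; y2; y3] -> adj v i by rewrite vN.
have uys : uniq [:: y1; y2; y3; v].
  rewrite -[X in uniq X]/(rcons [:: y1; y2; y3] v) rcons_uniq uy andbT -vN.
  by rewrite adjxx.
have := rep_extend_rows gr uys ysK; rewrite [iota 0 (size _)]/= [map _ _]/=.
set g' := extend_fun _ _ _; rewrite -!/(nbr_idx g m _) => gr'.
have imT : img g' (iota 0 (m + 4)) = [set: G].
  apply/setP=> x; rewrite in_setT; apply/imgP; case: (cov x) => [/imgP[i iI xE]|].
    have im : i < m by rewrite mem_iota in iI.
    by exists i; [rewrite mem_iota (leq_trans im) ?leq_addr | rewrite /g' extend_fun_old].
  move=> /(nthP (g 0))[i i4 <-]; exists (m + i); last by rewrite /g' extend_fun_new.
  by rewrite mem_iota /= ltn_add2l.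
have cG : #|G| = m + 4 by rewrite -cardsT -imT (card_img gr') ?iota_uniq ?size_iota.
rewrite /star_slow ifF; last first.
  apply/negP=> /andP[/andP[/eqP A1 /eqP A2] /eqP A3].
  have {kK y0k} [i iI y0i] : exists2 i, i \in iota 0 m & adj y0 (g i).
    by case/imgP: kK => i iI kE; exists i; rewrite -?kE.
  have : i \in nbr_idx g m y0 by rewrite mem_filter y0i.
  by move: y0y; rewrite !inE => /or3P[] /eqP->; rewrite ?A1 ?A2 ?A3.
rewrite ifT; last first.
  rewrite alllE; apply/allP=> i iI; have im : i < m by rewrite mem_iota in iI.
  have [s [us sK sa <-]] := rep_nbrs gr im.
  have nE y : (i \in nbr_idx g m y) = adj (g i) y by rewrite mem_filter iI andbT adjC.
  rewrite !nE; apply: leq_trans (four_nbrs subcubicG (x := g i)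
    (s := s ++ [seq y <- [:: y1; y2; y3] | adj (g i) y]) _ _).
  - by rewrite size_cat size_filter /= addn0 !addnA.
  - rewrite cat_uniq us filter_uniq // andbT; apply/hasPn=> y.
    rewrite mem_filter => /andP[_ yy]; apply: contra (ysK y _) => [/(allP sK)//|].
    by rewrite -[_ :: _]/(rcons [:: y1; y2; y3] v) mem_rcons inE yy orbT.
  - by rewrite all_cat sa filter_all.
have bb (p : bool -> bool) b : alll p [:: true; false] -> p b.
  by rewrite alllE /= andbT => /andP[]; case: b.
move/(bb _ (adj y2 y1))/(bb _ (adj y3 y1))/(bb _ (adj y3 y2)).
set rows := star_rows _ _ _ _ _ _ _.
(* The rows of [rep_extend_rows] agree with [star_rows] when the three Booleans are the actual
   adjacencies among y1, y2, y3. *)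
have rE : extend e m rows = extend e m
  [:: nbr_idx g m y1 ++ [::]; nbr_idx g m y2 ++ [seq m + i | i <- iota 0 1 & adj y2 (nth (g 0)
    [:: y1; y2; y3; v] i)];
      nbr_idx g m y3 ++ [seq m + i | i <- iota 0 2 & adj y3 (nth (g 0) [:: y1; y2; y3; v] i)];
      nbr_idx g m v ++ [seq m + i | i <- iota 0 3 & adj v (nth (g 0) [:: y1; y2; y3; v] i)]].
  congr extend; rewrite /rows /star_rows cats0 /=.
  have -> : nbr_idx g m v = [::].
    apply/eqP; rewrite -(negbK (_ == _)) -has_filter; apply/hasPn=> j jI.
    rewrite vN; apply: contraL (mem_img g jI) => gj; apply: ysK.
    by rewrite -[_ :: _]/(rcons [:: y1; y2; y3] v) mem_rcons inE gj orbT.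
  rewrite !vy ?inE ?eqxx ?orbT //= addn0 addn1 addn2.
  by case: (adj y2 y1); case: (adj y3 y1); case: (adj y3 y2);
     rewrite /= ?addn0 ?addn1 ?cats0.
cbv zeta; rewrite rE; move: gr' => /= /rep_mat gr'.
rewrite (rep_subcubic subcubicG gr').
case: ifP => [/(rep_quiso gr') Q _|_].
  constructor 2; rewrite cG -imT; apply: (quiso_leq _ (Q _ (leqnn _))) => //.
  by rewrite mulnC leq_divM.
case: ifP => [/(rep_C6 gr') C6 _|_]; first by constructor 1.
by move/(rep_isoE gr'); rewrite imT; constructor 3.
Qed.

Lemma bad_star K v y1 y2 y3 : bad K -> uniq [:: y1; y2; y3] ->
  (forall w, adj v w = (w \in [:: y1; y2; y3])) ->
  (forall y, y \in rcons [:: y1; y2; y3] v -> y \notin K) ->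
  (forall x, x \in K \/ x \in rcons [:: y1; y2; y3] v) ->
  (exists2 k, k \in K & exists2 y, y \in [:: y1; y2; y3] & adj y k) ->
  [\/ has_induced_C6 G, quiso [set: G] #|G| | bad [set: G]].
Proof.
move=> bK; case: (bK) => c cin [g gr KE].
have cS : #|K| = c.1 by rewrite KE (card_img gr) ?iota_uniq ?size_iota.
have m3 : c.1 %% 4 = 3 by rewrite -cS bad_mod.
have {gr} gr := rep_mat gr.
have := alll_In cin star_checkP; rewrite /star_check; cbv zeta.
move: gr m3 KE {cS cin}; move: (c.1) (tab _) => m e gr m3 KE.
set ss := small_subs _; set T := map _ ss => chk.
(* Neighbours of v are ordered by the position of their traces in [ss], to match the sorted
   enumeration of [star_check]. *)
pose f y := index (nbr_idx g m y) ss.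
pose Q s := uniq s -> (forall w, adj v w = (w \in s)) ->
  (forall y, y \in rcons s v -> y \notin K) -> (forall x, x \in K \/ x \in rcons s v) ->
  (exists2 k, k \in K & exists2 y, y \in s & adj y k) ->
  [\/ has_induced_C6 G, quiso [set: G] #|G| | bad [set: G]].
have Qperm s t : perm_eq t s -> Q s -> Q t.
  move=> st; rewrite /Q -(perm_uniq st) => Qs ut vN tK cov [k kK [y yt yk]].
  have E w := perm_mem st w.
  have E' w : (w \in rcons t v) = (w \in rcons s v) by rewrite !mem_rcons !inE E.
  apply: Qs => //; [by move=> w; rewrite -E|by move=> w; rewrite -E'; apply: tK| |].
    by move=> x; rewrite -E'.
  by exists k => //; exists y; rewrite // -E.
move: y1 y2 y3; apply: (@sort3 _ f (fun a b c => Q [:: a; b; c])).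
- by move=> a b d; apply: Qperm; rewrite (perm_catCA [:: b] [:: a] [:: d]).
- by move=> a b d; apply: Qperm; rewrite perm_cons (perm_catC [:: d] [:: b]).
move=> y1 y2 y3 f12 f23 uy vN yK cov link.
have yss y : y \in [:: y1; y2; y3] -> nbr_idx g m y \in ss.
  move=> yy; apply: (nbr_list subcubicG gr (v := v)); rewrite -?KE.
  - by apply: yK; rewrite mem_rcons inE yy orbT.
  - by apply: yK; rewrite mem_rcons inE eqxx.
  - by rewrite adjC vN.
have fl y : y \in [:: y1; y2; y3] -> f y < size ss by move/yss; rewrite index_mem.
have fE y : y \in [:: y1; y2; y3] -> nth [::] ss (f y) = nbr_idx g m y.
  by move/yss/nth_index->.
have y1i : y1 \in [:: y1; y2; y3] by rewrite !inE eqxx.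
have y2i : y2 \in [:: y1; y2; y3] by rewrite !inE eqxx orbT.
have y3i : y3 \in [:: y1; y2; y3] by rewrite !inE eqxx !orbT.
have TE x y : x \in [:: y1; y2; y3] -> y \in [:: y1; y2; y3] ->
    nth [::] (nth [::] T (f x)) (f y) = star_row e m (nbr_idx g m x) (nbr_idx g m y).
  by move=> xi yi; rewrite /T !(nth_map [::]) ?fl // !fE.
(* As m is 3 modulo 4, the cost is m + 1 = |K| + 1, and v lies outside K. *)
have fast : quiso [set: G] (4 * (m %/ 4).+1) -> quiso [set: G] #|G|.
  apply: quiso_leq; have vK : v \notin K by apply: yK; rewrite mem_rcons mem_head.
  have := max_card (mem (v |: K)).
  rewrite cardsU1 vK KE (card_img gr) ?iota_uniq // size_iota.
  by have := divn_eq m 4; rewrite m3; lia.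
move: chk; rewrite alllE => /allP/(_ (f y1)); rewrite mem_iota fl // => /(_ isT).
rewrite alllE => /allP/(_ (f y2)).
rewrite mem_iota f12 subnKC ?fl // ?(ltnW (fl _ _)) // => /(_ isT).
rewrite alllE => /allP/(_ (f y3)).
rewrite mem_iota f23 subnKC ?fl // ?(ltnW (fl _ _)) // => /(_ isT).
rewrite !TE // !fE //.
have cov' t : perm_eq t [:: y1; y2; y3] ->
    (forall w, adj v w = (w \in t)) /\ (forall x, x \in img g (iota 0 m) \/ x \in rcons t v).
  move=> st; split=> x; first by rewrite vN (perm_mem st).
  by rewrite -KE mem_rcons inE (perm_mem st) -in_cons -mem_rcons; apply: cov.
case: ifP => [F _|_].
  by constructor 2; apply/fast/(star_fast gr vN _ F); rewrite -KE.
case: ifP => [F _|_].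
  have [vN' c'] := cov' [:: y2; y1; y3] (introT permPl (perm_catCA [:: y2] [:: y1] [:: y3])).
  by constructor 2; apply/fast/(star_fast gr vN' c' F).
case: ifP => [F _|_].
  have [vN' c'] := cov' [:: y3; y1; y2] (introT permPl (perm_catC [:: y3] [:: y1; y2])).
  by constructor 2; apply/fast/(star_fast gr vN' c' F).
by apply: star_slowP; rewrite -?KE.
Qed.
End Extensions.


(** * Small configurations and connected sets of maximum degree two *)

Section General.
Variable G : sgraph.
Implicit Types (a b c d p q t u v w x y z : G) (S T R C D H K : {set G}).

Lemma card_setD_sub S T : T \subset S -> #|S :\: T| = #|S| - #|T|.
Proof. by move=> TS; rewrite cardsD (setIidPr TS). Qed.

Lemma comp_ext R R' C : comp R C -> R \subset R' ->
  (forall c w, c \in C -> w \in R' -> w \notin R -> ~~ adj c w) -> comp R' C.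
Proof.
move=> [CR cC clC] RR' out; split=> //; first exact: subset_trans RR'.
move=> c w cC' wR' cw; apply: (clC c w) => //; apply: contraT => wR.
by have := out c w cC' wR' wR; rewrite cw.
Qed.

Lemma comp_neq0 R C : comp R C -> exists x, x \in C.
Proof. by move=> [_ [/set0Pn[x xC] _] _]; exists x. Qed.

Lemma bad_P3 a b c : adj a b -> adj b c -> ~~ adj a c -> a != c -> bad [set a; b; c].
Proof.
move=> ab bc /negPf ac aNc; exists (3, pathr); first by left.
exists (nth a [:: a; b; c]); last by apply/setP=> x; rewrite !inE orbA.
have [aNb bNc] := (adj_neq ab, adj_neq bc).
split=> [] [|[|[|i]]] [|[|[|j]]] //= _ _; rewrite ?adjxx ?(adjC b a) ?(adjC c b) ?(adjC c a)
  ?ab ?bc ?ac //.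
- by move=> E; rewrite E eqxx in aNb.
- by move=> E; rewrite E eqxx in aNc.
- by move=> E; rewrite E eqxx in aNb.
- by move=> E; rewrite E eqxx in bNc.
- by move=> E; rewrite E eqxx in aNc.
- by move=> E; rewrite E eqxx in bNc.
Qed.

Lemma C6_intro a0 a1 a2 a3 a4 a5 :
  [&& adj a0 a1, adj a1 a2, adj a2 a3, adj a3 a4, adj a4 a5 & adj a5 a0] ->
  [&& ~~ adj a0 a2, ~~ adj a0 a3, ~~ adj a0 a4, ~~ adj a1 a3, ~~ adj a1 a4,
      ~~ adj a1 a5, ~~ adj a2 a4, ~~ adj a2 a5 & ~~ adj a3 a5] -> has_induced_C6 G.
Proof.
case/and5P=> e01 e12 e23 e34 /andP[e45 e50].
case/and5P=> /negPf n02 /negPf n03 /negPf n04 /negPf n13.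
case/and5P=> /negPf n14 /negPf n15 /negPf n24 /negPf n25 /negPf n35.
apply/induced_C6P; pose g := nth a0 [:: a0; a1; a2; a3; a4; a5]; exists g.
have gA i j : i < 6 -> j < 6 -> adj (g i) (g j) = symcl (cycler 6) i j.
  case: i => [|[|[|[|[|[|i]]]]]] // _; case: j => [|[|[|[|[|[|j]]]]]] // _;
  by rewrite /g /= /symcl /cycler /= ?adjxx // ?e01 ?e12 ?e23 ?e34 ?e45 ?e50 ?n02
     ?n03 ?n04 ?n13 ?n14 ?n15 ?n24 ?n25 ?n35 // adjC
     ?e01 ?e12 ?e23 ?e34 ?e45 ?e50 ?n02 ?n03 ?n04 ?n13 ?n14 ?n15 ?n24 ?n25 ?n35.
split=> // i j il jl gE.
have E k : k < 6 -> symcl (cycler 6) i k = symcl (cycler 6) j k.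
  by move=> kl; rewrite -!gA // gE.
move: il jl (E 0 isT) (E 1 isT) (E 2 isT) (E 3 isT) (E 4 isT) (E 5 isT).
by case: i {E gE} => [|[|[|[|[|[|i]]]]]] //; case: j => [|[|[|[|[|[|j]]]]]].
Qed.


Lemma ex_max (P : nat -> Prop) n : (exists k, P k) -> (forall k, P k -> k <= n) ->
  exists2 k, P k & forall j, P j -> j <= k.
Proof.
elim: n => [|n IH] [k Pk] Pn; first by exists k => // j /Pn; lia.
case: (classic (P n.+1)) => [Pn1|nP]; first by exists n.+1.
apply: IH; first by exists k.
move=> j Pj; have := Pn j Pj; rewrite leq_eqVlt => /orP[/eqP E|//].
by rewrite E in Pj.
Qed.

Lemma two_nbrsP S x a b : ~ two_nbrs S x -> a \in S -> b \in S -> adj x a -> adj x b -> a = b.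
Proof.
move=> n2 aS bS xa xb; apply/eqP; apply: contraT => ab.
by case: n2; exists a, b.
Qed.

Lemma three_nbrsP S x a b w : ~ three_nbrs S x -> a \in S -> b \in S -> a != b -> adj x a ->
  adj x b -> w \in S -> adj x w -> w = a \/ w = b.
Proof.
move=> n3 aS bS ab xa xb wS xw; case: (eqVneq w a) => [|wa]; first by left.
case: (eqVneq w b) => [|wb]; first by right.
case: n3; exists w, a, b; rewrite wS aS bS xa xb xw; split=> //.
by rewrite /= !inE negb_or wa wb ab.
Qed.

Lemma conn_nbr S x : conn S -> x \in S -> 1 < #|S| -> exists2 y, y \in S & adj x y.
Proof.
move=> cS xS S2; apply: NNPP => no; have : S \subset [set x].
  apply: (conn_ind cS xS); first exact: set11.
  move=> a b _; rewrite inE => /eqP-> bS xb; by case: no; exists b.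
by move/subset_leq_card; rewrite cards1 leqNgt S2.
Qed.

(* A longest path in S cannot be left, so it exhausts S. *)
Lemma path_or_cycle S x0 : conn S -> x0 \in S -> (forall x, x \in S -> ~ three_nbrs S x) ->
  exists p : seq G, [/\ uniq p, p =i S,
    forall i, i.+1 < size p -> adj (nth x0 p i) (nth x0 p i.+1) &
    forall i j, i < j -> j < size p -> adj (nth x0 p i) (nth x0 p j) ->
      j = i.+1 \/ (i = 0 /\ j = (size p).-1)].
Proof.
move=> cS x0S n3.
pose ok (p : seq G) := [/\ uniq p, {subset p <= S} &
  forall i, i.+1 < size p -> adj (nth x0 p i) (nth x0 p i.+1)].
have [k [p [up pS pA] <-] mx] : exists2 k, (exists2 p, ok p & size p = k) &
    forall j, (exists2 p, ok p & size p = j) -> j <= k.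
  apply: (ex_max (n := #|S|)).
    by exists 1, [:: x0] => //; split=> // x; rewrite inE => /eqP->.
  move=> k [p [up pS _] <-]; rewrite -(card_uniqP up).
  by apply: subset_leq_card; apply/subsetP.
have p0 : 0 < size p.
  by apply: (mx 1); exists [:: x0] => //; split=> // x; rewrite inE => /eqP->.
have long (q : seq G) : ok q -> size p < size q -> False.
  by move=> okq; rewrite ltnNge => /negP; apply; apply: mx; exists q.
have inS i : i < size p -> nth x0 p i \in S by move=> il; apply/pS/mem_nth.
have dist i j : i < size p -> j < size p -> i != j -> nth x0 p i != nth x0 p j.
  by move=> il jl; rewrite nth_uniq.
have inj i j : i < size p -> j < size p -> nth x0 p i = nth x0 p j -> i = j.
  by move=> il jl /eqP; rewrite nth_uniq // => /eqP.
have no3 i w : 0 < i -> i.+1 < size p -> w \in S -> adj (nth x0 p i) w ->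
    w = nth x0 p i.-1 \/ w = nth x0 p i.+1.
  case: i => // i _ il wS iw /=.
  apply: (three_nbrsP (n3 _ (inS i.+1 (ltnW il)))) => //; try by apply: inS; lia.
  - by apply: dist; lia.
  - by rewrite adjC pA; lia.
  - exact: pA.
have clp x w : x \in p -> w \in S -> adj x w -> w \in p.
  move=> /(nthP x0)[i il <-] wS iw; apply: contraT => wp.
  case: (posnP i) => [i0|i0].
    case: (@long (w :: p)) => //; split; first by rewrite /= wp.
      by move=> z; rewrite inE => /orP[/eqP->|/pS].
    by case=> [|j] /= jl; [rewrite adjC -{1}i0 | apply: pA].
  case: (ltnP i.+1 (size p)) => il'.
    by case: (no3 i w i0 il' wS iw) wp => ->; rewrite mem_nth //; lia.
  case: (@long (rcons p w)); last by rewrite size_rcons.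
  split; first by rewrite rcons_uniq wp.
    by move=> z; rewrite mem_rcons inE => /orP[/eqP->|/pS].
  move=> j; rewrite size_rcons ltnS => jl; rewrite !nth_rcons jl.
  case: ltnP => j1; first exact: pA.
  have -> : j.+1 == size p by rewrite eqn_leq jl j1.
  have -> : j = i by apply/eqP; rewrite eqn_leq -ltnS (leq_trans jl il') -ltnS (leq_trans il j1).
  exact: iw.
have pE : p =i S.
  move=> x; apply/idP/idP => [/pS//|]; apply/subsetP.
  have sub : S \subset [set z in p].
    apply: (conn_ind cS (inS 0 p0)); first by rewrite inE mem_nth.
    by move=> a b _; rewrite !inE => ap bS ab; apply: (clp a b).
  by apply/subsetP=> z /(subsetP sub); rewrite inE.
exists p; split=> // i j ij jl ija.
have il : i < size p by apply: ltn_trans jl.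
case: (posnP i) => i0.
  case: (ltnP j.+1 (size p)) => j1; last by right; lia.
  have j0 : 0 < j by lia.
  have jp : j.-1 < size p by lia.
  rewrite adjC in ija; case: (no3 j (nth x0 p i) j0 j1 (inS i il) ija) => /inj E.
    by left; have := E il jp; lia.
  by have := E il j1; lia.
have i1 : i.+1 < size p by lia.
have ip : i.-1 < size p by lia.
case: (no3 i (nth x0 p j) i0 i1 (inS j jl) ija) => /inj E.
  by have := E jl ip; lia.
by left; apply: E.
Qed.

Lemma path_ends S x : conn S -> 1 < #|S| -> (forall y, y \in S -> ~ three_nbrs S y) ->
  x \in S -> ~ two_nbrs S x ->
  exists h h', [/\ h \in S /\ h' \in S, h != h', ~ two_nbrs S h, ~ two_nbrs S h' &
    forall y, y \in S -> y != h -> y != h' -> two_nbrs S y].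
Proof.
move=> cS S2 n3 xS x2; have [p [up pE pA pC]] := path_or_cycle cS xS n3.
have sp : size p = #|S| by rewrite -(card_uniqP up); apply: eq_card.
have p2 : 1 < size p by rewrite sp.
have {S2 sp} inS i : i < size p -> nth x p i \in S by move=> il; rewrite -pE mem_nth.
have dist i j : i < size p -> j < size p -> i != j -> nth x p i != nth x p j.
  by move=> il jl; rewrite nth_uniq.
have ndist i j : i < size p -> j < size p -> nth x p i != nth x p j -> i <> j.
  by move=> il jl; rewrite nth_uniq // => /eqP.
pose l := (size p).-1.
have mid i : 0 < i -> i < l -> two_nbrs S (nth x p i).
  move=> i0 il; exists (nth x p i.-1), (nth x p i.+1); split; try by apply: inS; lia.
  - by apply: dist; lia.
  - by rewrite adjC -{2}(prednK i0) pA //; lia.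
  - by apply: pA; lia.
have idx z : z \in S -> exists2 i, i < size p & z = nth x p i.
  by rewrite -pE => /(nthP x)[i il <-]; exists i.
(* An edge closing the path into a cycle would give every vertex two neighbours, including x. *)
have nend : ~ (adj (nth x p 0) (nth x p l) /\ 1 < l).
  move=> [a0l l2]; apply: x2; have [i il {1}->] := idx x xS.
  case: (posnP i) => [->|i0].
    exists (nth x p 1), (nth x p l); split=> //; try by apply: inS; lia.
      by apply: dist; lia.
    by apply: pA; lia.
  case: (ltnP i l) => il'; first exact: mid.
  have -> : i = l by lia.
  exists (nth x p l.-1), (nth x p 0); split; try by apply: inS; lia.
  - by apply: dist; lia.
  - have l0 : 0 < l by lia.
    by rewrite adjC -{2}(prednK l0) pA //; lia.
  - by rewrite adjC.
exists (nth x p 0), (nth x p l); split.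
- by split; apply: inS; lia.
- by apply: dist; lia.
- move=> [a [b [/idx[i il ->] /idx[j jl ->] ij]]].
  have ne0 k : adj (nth x p 0) (nth x p k) -> 0 < k.
    by case: k => //; rewrite adjxx.
  move=> a0i a0j; have [i0 j0] := (ne0 _ a0i, ne0 _ a0j).
  have [i1|[_ i1]] := pC 0 i i0 il a0i; have [j1|[_ j1]] := pC 0 j j0 jl a0j.
  + by rewrite i1 j1 eqxx in ij.
  + by apply: nend; rewrite /l -j1; split=> //; have := ndist _ _ il jl ij; lia.
  + by apply: nend; rewrite /l -i1; split=> //; have := ndist _ _ il jl ij; lia.
  + by rewrite i1 j1 eqxx in ij.
- move=> [a [b [/idx[i il ->] /idx[j jl ->] ij]]].
  have nel k : k < size p -> adj (nth x p l) (nth x p k) -> k < l.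
    move=> kl lk; suff : k != l by lia.
    by apply: contraTneq lk => ->; rewrite adjxx.
  move=> ali alj; have [i0 j0] := (nel _ il ali, nel _ jl alj).
  have ll : l < size p by lia.
  rewrite adjC in ali; rewrite adjC in alj.
  have [i1|[i1 _]] := pC i l i0 ll ali; have [j1|[j1 _]] := pC j l j0 ll alj.
  + by have := ndist _ _ il jl ij; lia.
  + by apply: nend; rewrite -{1}j1; split=> //; have := ndist _ _ il jl ij; lia.
  + by apply: nend; rewrite -{1}i1; split=> //; have := ndist _ _ il jl ij; lia.
  + by rewrite i1 j1 eqxx in ij.
move=> y /idx[i il ->] y0 yl; apply: mid.
  by case: (posnP i) y0 => // ->; rewrite eqxx.
suff : i != l by lia.
by apply: contraNneq yl => ->.
Qed.

End General.


(** * The minimal counterexample *)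

Section MinimalCounterexample.
Variable G : sgraph.
Implicit Types (a b c d p q t u v w x y z : G) (S T R C D H K : {set G}).
Hypothesis subcubicG : forall x : G, #|nbhd x| <= 3.
Hypothesis connG : conn [set: G].
Hypothesis noC6 : ~ has_induced_C6 G.
Hypothesis not_badG : ~ bad [set: G].
(** The induction hypothesis. The bound |S| is rounded down because 4|D| is a multiple of four. *)
Hypothesis proper_good : forall S, S != [set: G] -> conn S -> ~ bad S ->
  quiso S (#|S| - #|S| %% 4).
Hypothesis cex : ~ quiso [set: G] #|G|.

Lemma neq_setT S x : x \notin S -> S != [set: G].
Proof. by apply: contraNneq => ->; rewrite inE. Qed.

Lemma quiso_conn S : S != [set: G] -> conn S -> quiso S #|S|.+1.
Proof.
move=> ST cS; case: (classic (bad S)) => [/quiso_bad //|nb].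
by apply: quiso_leq (proper_good ST cS nb); lia.
Qed.

Lemma quiso_good S : S != [set: G] -> conn S -> #|S| %% 4 != 3 -> quiso S (#|S| - #|S| %% 4).
Proof.
by move=> ST cS S3; apply: proper_good => // bS; rewrite (bad_mod bS) in S3.
Qed.

(** The usual way to contradict [cex]: dominate x and spend at most |G| - 4 on the rest. *)
Lemma dom_cex x n : quiso (~: cnbhd x) n -> n + 4 <= #|G| -> False.
Proof.
move=> Q nG; apply: cex; apply: (quiso_leq nG); rewrite addnC.
by apply: (quiso_dom (x := x)); rewrite setTD.
Qed.

(* A bad component that meets X becomes cheap enough once one vertex of X is removed
   from it. *)
Lemma quiso_comps R (X : {set G}) : R != [set: G] ->
  (forall C, comp R C -> bad C -> exists2 c, c \in C & c \in X) -> quiso (R :\: X) #|R|.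
Proof.
move: {2}#|R| (leqnn #|R|) => n; elim: n R => [|n IH] R.
  rewrite leqn0 cards_eq0 => /eqP -> _ _; rewrite set0D cards0; exact: quiso0.
move=> Rn RT fix_; case: (set_0Vmem R) => [->|[x xR]].
  by rewrite set0D cards0; apply: quiso0.
have [C cC xC] := comp_exists xR; have [CR conC _] := cC.
have C0 := conn_card_gt0 conC; have CRn := subset_leq_card CR.
have cR := card_setD_sub CR.
have CT : C != [set: G].
  by apply: contraNneq RT => CT; rewrite -subTset -CT.
have QC : quiso (C :\: X) #|C|.
  case: (classic (bad C)) => [bC|nb].
    have [c cC' cX] := fix_ C cC bC.
    apply: (quiso_leq (leq_subr 3 _)); apply: quiso_sub (bad_crit bC cC').
    by apply: setDS; rewrite sub1set.
  apply: (quiso_sub (subsetDl _ _)).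
  by apply: quiso_leq (proper_good CT conC nb); rewrite leq_subr.
have QR : quiso ((R :\: C) :\: X) #|R :\: C|.
  apply: IH; first by lia.
    by apply: contraNneq RT => RC; rewrite -subTset -RC subsetDl.
  by move=> C' /(comp_setD cC); apply: fix_.
have -> : #|R| = #|C| + #|R :\: C| by lia.
apply: quiso_sub (quisoU _ QC QR).
  by apply/subsetP=> y; rewrite !inE; case: (y \in C); case: (y \in X); case: (y \in R).
by move=> a b /setDP[aC _] /setDP[bR _]; apply: (comp_out cC).
Qed.

(** * How bad components are attached to the rest *)

Lemma conn_exit C x : x \in C -> C != [set: G] ->
  exists c w, [/\ c \in C, w \notin C & adj c w].
Proof.
move=> xC CT; apply: NNPP => no; case/negP: CT; rewrite -subTset.
apply: (conn_ind connG (in_setT x) xC) => a b _ aC _ ab.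
by apply: contraT => bC; case: no; exists a, b.
Qed.

Lemma compC1_link y C : comp (~: [set y]) C -> exists2 c, c \in C & adj y c.
Proof.
move=> cC; have [x xC] := comp_neq0 cC; have [CR _ clC] := cC.
have yC : y \notin C by apply/negP=> /(subsetP CR); rewrite !inE eqxx.
have [c [w [cC' wC cw]]] := conn_exit xC (neq_setT yC).
exists c => //; rewrite adjC; case: (eqVneq w y) => [<- //|wy].
by case/negP: wC; apply: (clC c w) => //; rewrite !inE.
Qed.

(** Since G is connected, dominating y touches every component of G - y, so H drops to |H| - 3 and
    no other bad component keeps its surplus. The total is 4 + (|H| - 3) + (|G| - 1 - |H|) = |G|. *)
Lemma bad_compC1 y H : comp (~: [set y]) H -> bad H -> False.
Proof.
move=> cH bH; have [x xH yx] := compC1_link cH; have [HR _ _] := cH.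
have yH : y \notin H by apply/negP=> /(subsetP HR); rewrite !inE eqxx.
set R := ~: [set y] :\: H.
have QR : quiso (R :\: cnbhd y) #|R|.
  apply: quiso_comps; first by apply: (@neq_setT _ y); rewrite !inE eqxx ?andbF.
  move=> C /(comp_setD cH) cC _; have [c cC' yc] := compC1_link cC.
  by exists c; rewrite // in_cnbhd yc orbT.
apply: (@dom_cex y (#|H| - 3 + #|R|)).
  apply: quiso_sub (quisoU _ (bad_crit bH xH) QR).
    apply/subsetP=> z; rewrite !inE !negb_or => /andP[zy yz].
    rewrite zy yz; case zH: (z \in H); rewrite /= ?orbT // orbF andbT.
    by apply: contraNneq yz => ->.
  by move=> a b /setD1P[_ aH] /setDP[bR _]; apply: (comp_out cH).
rewrite card_setD_sub // cardsC1.
have := subset_leq_card HR; rewrite cardsC1; have := bad_mod bH; lia.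
Qed.

(** If every leaving edge met x or y, dominating y would separate H - x, of cost |H| - 3, from the
    rest. A bad component of the rest not seen by y would be a component of G - x, against
    [bad_compC1]. *)
Lemma bad_exit H x y : bad H -> x \in H -> y \notin H -> adj y x ->
  exists a w, [/\ a \in H, w \notin H, adj a w, a != x & w != y].
Proof.
move=> bH xH yH yx; apply: NNPP => no.
have {no} no a w : a \in H -> w \notin H -> adj a w -> a = x \/ w = y.
  move=> aH wH aw; case: (eqVneq a x) => [|ax]; first by left.
  by case: (eqVneq w y) => [|wy]; [right | case: no; exists a, w].
set R := ~: (y |: H).
have cR : #|R| = #|G| - #|H|.+1 by rewrite cardsCs setCK cardsU1 yH.
have QR : quiso (R :\: cnbhd y) #|R|.
  apply: quiso_comps; first by apply: (@neq_setT _ y); rewrite !inE eqxx ?andbF.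
  move=> C cC bC; apply: NNPP => nlink.
  have ny c : c \in C -> ~~ adj y c.
    by move=> cC'; apply/negP=> yc; apply: nlink; exists c; rewrite // in_cnbhd yc orbT.
  apply: (@bad_compC1 x C) => //; apply: (comp_ext cC).
    by apply/subsetP=> z; rewrite !inE negb_or => /andP[_]; apply: contraNneq => ->.
  move=> c w cC'; rewrite !inE negbK => wx /orP[/eqP->|wH]; first by rewrite adjC ny.
  have cR' : c \in R by case: cC => /subsetP CR _ _; apply: CR.
  move: cR'; rewrite !inE negb_or => /andP[cy cH].
  apply/negP; rewrite adjC => wc; have [E|E] := no w c wH cH wc.
    by rewrite E eqxx in wx.
  by rewrite E eqxx in cy.
apply: (@dom_cex y (#|H| - 3 + #|R|)).
  apply: quiso_sub (quisoU _ (bad_crit bH xH) QR).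
    apply/subsetP=> z; rewrite !inE !negb_or => /andP[zy yz].
    rewrite zy yz; case zH: (z \in H); rewrite /= ?orbT // orbF andbT.
    by apply: contraNneq yz => ->.
  move=> a b /setD1P[ax aH]; rewrite !inE !negb_or => /andP[_ /andP[byn bH']].
  apply/negP => ab; have [E|E] := no a b aH bH' ab.
    by rewrite E eqxx in ax.
  by rewrite E eqxx in byn.
rewrite cR; have := bad_mod bH; have := max_card (mem (y |: H)).
by rewrite cardsU1 yH; lia.
Qed.

(** A bad component not seen by y1 would be a component of G - y2, so dominating y1 touches all of
    them, and y2 as well. *)
Lemma bad_compC2 y1 y2 H : adj y1 y2 -> comp (~: [set y1; y2]) H -> bad H -> False.
Proof.
move=> y12 cH bH.
have link C : comp (~: [set y1; y2]) C -> bad C -> exists2 c, c \in C & adj y1 c.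
  move=> cC bC; apply: NNPP => no; apply: (@bad_compC1 y2 C) => //.
  apply: (comp_ext cC); first by rewrite setCS subsetUr.
  move=> c w cC'; rewrite !inE negbK => wy2 /orP[/eqP->|/eqP E].
    by rewrite adjC; apply/negP=> yc; apply: no; exists c.
  by rewrite E eqxx in wy2.
have [x xH yx] := link H cH bH; have [HR _ _] := cH.
set R := ~: [set y1; y2] :\: H.
have QR : quiso (R :\: cnbhd y1) #|R|.
  apply: quiso_comps; first by apply: (@neq_setT _ y1); rewrite !inE eqxx andbF.
  move=> C /(comp_setD cH) cC bC; have [c cC' yc] := link C cC bC.
  by exists c; rewrite // in_cnbhd yc orbT.
apply: (@dom_cex y1 (#|H| - 3 + #|R|)).
  apply: quiso_sub (quisoU _ (bad_crit bH xH) QR).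
    apply/subsetP=> z; rewrite !inE !negb_or => /andP[zy yz].
    rewrite zy yz; case zH: (z \in H) => /=.
      by rewrite orbF andbT; apply: contraNneq yz => ->.
    by rewrite andbF; apply: contraNneq yz => ->.
  by move=> a b /setD1P[_ aH] /setDP[bR _]; apply: (comp_out cH).
have c2 : #|~: [set y1; y2]| = #|G| - 2 by rewrite cardsCs setCK cards2 (adj_neq y12).
rewrite card_setD_sub // c2; have := subset_leq_card HR; rewrite c2.
by have := bad_mod bH; lia.
Qed.

(** If t3 has no neighbour besides t2, then G is P3. Otherwise dominate such a neighbour p: the edge
    t1 t2 is left over for free, t3 is dominated, and a bad component not seen by p would hang on t3
    alone. *)
Lemma leaf_nbr t1 t2 t3 : t1 != t3 -> adj t1 t2 -> adj t2 t3 ->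
  (forall w, adj t1 w -> w = t2) -> (forall w, adj t2 w -> w = t1 \/ w = t3) -> False.
Proof.
move=> t13 a12 a23 n1 n2.
have na13 : ~~ adj t1 t3 by apply/negP=> /n1 E; rewrite E adjxx in a23.
case: (classic (exists2 p, adj t3 p & p != t2)) => [[p t3p pt2]|no]; last first.
  apply: not_badG; suff <- : [set t1; t2; t3] = [set: G] by apply: bad_P3.
  apply/eqP; rewrite -subTset; apply: (conn_ind connG (in_setT t1)).
    by rewrite !inE eqxx.
  move=> a b _; rewrite !inE -orbA => /or3P[]/eqP-> _ ab.
  - by rewrite (n1 _ ab) eqxx orbT.
  - by case: (n2 _ ab) => ->; rewrite eqxx ?orbT.
  - case: (eqVneq b t2) => [->|bt2]; first by rewrite orbT.
    by case: no; exists b.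
have t3t2 : t3 != t2 by rewrite eq_sym (adj_neq a23).
have pt1 : p != t1.
  by apply: contraTneq t3p => ->; rewrite adjC.
have pt3 : p != t3 by rewrite eq_sym (adj_neq t3p).
set R := ~: [set t1; t2; t3; p].
have cR : #|R| = #|G| - 4.
  rewrite cardsCs setCK -!setUA !cardsU1 cards1 !inE !negb_or (adj_neq a12) t13.
  by rewrite (adj_neq a23) !(eq_sym _ p) pt1 pt2 pt3.
have QR : quiso (R :\: cnbhd p) #|R|.
  apply: quiso_comps; first by apply: (@neq_setT _ p); rewrite !inE eqxx orbT.
  move=> C cC bC; apply: NNPP => no; apply: (@bad_compC1 t3 C) => //.
  have CR : {subset C <= R} by case: cC => /subsetP.
  apply: (comp_ext cC); first by rewrite setCS sub1set !inE eqxx orbT.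
  move=> c w cC'; have := CR c cC'; rewrite !inE negbK !negb_or -!andbA.
  move=> /and4P[c1 c2 c3 cp] wt3; rewrite -!orbA.
  case/or4P=> /eqP E; rewrite E adjC; apply/negP=> ac.
  - by rewrite (n1 _ ac) eqxx in c2.
  - by case: (n2 _ ac) => E'; [rewrite E' eqxx in c1|rewrite E' eqxx in c3].
  - by rewrite E eqxx in wt3.
  - by apply: no; exists c; rewrite // in_cnbhd ac orbT.
apply: (@dom_cex p (0 + #|R|)).
  apply: quiso_sub (quisoU (S := [set t1; t2]) _ _ QR).
  - apply/subsetP=> z; rewrite !inE !negb_or => /andP[zp pz].
    rewrite zp pz; case: (eqVneq z t1) => //=; case: (eqVneq z t2) => //= _ _.
    by rewrite andbT; apply: contraNneq pz => ->; rewrite adjC.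
  - move=> a b; rewrite !inE !negb_or -!andbA => aE /and5P[_ _ b1 b2 /andP[b3 _]].
    apply/negP=> ab; case/orP: aE => /eqP E; rewrite E in ab.
      by rewrite (n1 _ ab) eqxx in b2.
    by case: (n2 _ ab) => E'; [rewrite E' eqxx in b1|rewrite E' eqxx in b3].
  - by apply: quiso_small; rewrite cards2; case: (_ == _).
have := max_card (mem [set t1; t2; t3; p]).
rewrite cR -!setUA !cardsU1 cards1 !inE !negb_or (adj_neq a12) t13.
by rewrite (adj_neq a23) !(eq_sym _ p) pt1 pt2 pt3; lia.
Qed.


(** * Vertices of degree three and the components of G - N[v] *)

Definition N3 v y1 y2 y3 :=
  uniq [:: y1; y2; y3] /\ forall w, adj v w = (w \in [:: y1; y2; y3]).
Definition deg3 v := exists y1 y2 y3, N3 v y1 y2 y3.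

Lemma nbr3 v a b c w : uniq [:: a; b; c] -> adj v a -> adj v b -> adj v c -> adj v w ->
  [\/ w = a, w = b | w = c].
Proof.
move=> u3 va vb vc vw; case: (eqVneq w a) => [|wa]; first by constructor 1.
case: (eqVneq w b) => [|wb]; first by constructor 2.
case: (eqVneq w c) => [|wc]; first by constructor 3.
have := @four_nbrs _ subcubicG v [:: w; a; b; c]; rewrite cons_uniq u3 !inE !negb_or.
by rewrite wa wb wc /= va vb vc vw => /(_ isT isT).
Qed.

Lemma N3I v a b c : uniq [:: a; b; c] -> adj v a -> adj v b -> adj v c -> N3 v a b c.
Proof.
move=> u3 va vb vc; split=> // w; apply/idP/idP.
  by case/(nbr3 u3 va vb vc) => ->; rewrite !inE eqxx ?orbT.
by rewrite !inE => /or3P[]/eqP->.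
Qed.

Lemma deg3I v a b c : uniq [:: a; b; c] -> adj v a -> adj v b -> adj v c -> deg3 v.
Proof. by move=> *; exists a, b, c; apply: N3I. Qed.

Lemma uniq3 a b c : a != b -> a != c -> b != c -> uniq [:: a; b; c].
Proof. by move=> ab ac bc; rewrite /= !inE negb_or ab ac bc. Qed.

Lemma ndeg3 x a b w : ~ deg3 x -> adj x a -> adj x b -> a != b -> adj x w -> w = a \/ w = b.
Proof.
move=> nx xa xb ab xw; case: (eqVneq w a) => [|wa]; first by left.
case: (eqVneq w b) => [|wb]; first by right.
by case: nx; apply: (@deg3I x w a b) => //; apply: uniq3.
Qed.

Lemma four_neq x a b c d : adj x a -> adj x b -> adj x c -> adj x d ->
  a != b -> a != c -> a != d -> b != c -> b != d -> c != d -> False.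
Proof.
move=> xa xb xc xd ab ac ad bc bd cd.
have := @four_nbrs _ subcubicG x [:: a; b; c; d]; rewrite /= !inE !negb_or xa xb xc xd.
by rewrite ab ac ad bc bd cd => /(_ isT isT).
Qed.

Local Notation NV v := (~: cnbhd v).

Lemma in_NV v x : (x \in NV v) = (x != v) && ~~ adj v x.
Proof. by rewrite in_setC in_cnbhd negb_or. Qed.

Lemma card_cnbhd v : deg3 v -> #|cnbhd v| = 4.
Proof.
move=> [y1 [y2 [y3 [u3 vN]]]].
have -> : cnbhd v = [set x in v :: [:: y1; y2; y3]].
  by apply/setP=> x; rewrite in_cnbhd vN inE in_cons.
rewrite cardsE; apply/card_uniqP; rewrite cons_uniq u3 andbT -vN.
by rewrite adjxx.
Qed.

Lemma card_NV v : deg3 v -> #|NV v| + 4 = #|G|.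
Proof. by move=> /card_cnbhd <-; rewrite addnC cardsC. Qed.

Lemma NV_neq v : NV v != [set: G].
Proof. by apply: (@neq_setT _ v); rewrite in_NV eqxx. Qed.

(** Otherwise dominating v leaves |G| - 4 vertices in good components only. *)
Lemma deg3_bad v : deg3 v -> exists2 H, comp (NV v) H & bad H.
Proof.
move=> v3; apply: NNPP => no; apply: (@dom_cex v #|NV v|); last by rewrite card_NV.
rewrite -[X in quiso X]setD0; apply: quiso_comps; first exact: NV_neq.
by move=> C cC bC; case: no; exists C.
Qed.

Lemma compN_out v C c : comp (NV v) C -> c \in C -> (c != v) && ~~ adj v c.
Proof. by move=> [/subsetP CR _ _] /CR; rewrite in_NV. Qed.

Lemma compN_nbr v C c w : comp (NV v) C -> c \in C -> adj c w -> w \in C \/ adj v w.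
Proof.
move=> cC cC' cw; case vw: (adj v w); [by right|left].
have /andP[cv nvc] := compN_out cC cC'.
case: cC => _ _ clC; apply: (clC c w) => //; rewrite in_NV vw andbT.
by apply: contraNneq nvc => <-; rewrite adjC.
Qed.

Lemma compN_notin v C y : comp (NV v) C -> adj v y -> y \notin C.
Proof. by move=> cC vy; apply/negP=> /(compN_out cC); rewrite vy andbF. Qed.

Lemma compN_neq v C c y : comp (NV v) C -> c \in C -> adj v y -> c != y.
Proof. by move=> cC cC' vy; apply: contraNneq (compN_notin cC vy) => <-. Qed.

Lemma compN_link v C : comp (NV v) C -> exists c y, [/\ c \in C, adj v y & adj y c].
Proof.
move=> cC; have [x xC] := comp_neq0 cC.
have vC : v \notin C by apply/negP=> /(compN_out cC); rewrite eqxx.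
have [c [w [cC' wC cw]]] := conn_exit xC (neq_setT vC).
exists c, w; split=> //; last by rewrite adjC.
by case: (compN_nbr cC cC' cw) => // wC'; rewrite wC' in wC.
Qed.

Lemma comp_disj R C C' x : comp R C -> comp R C' -> C != C' -> x \in C -> x \notin C'.
Proof. by move=> cC cC' /negP CC' xC; apply/negP=> xC'; apply: CC';
  rewrite (comp_eq cC cC' xC xC'). Qed.

Lemma comp_nadj R C C' x y : comp R C -> comp R C' -> C != C' -> x \in C -> y \in C' ->
  ~~ adj x y.
Proof.
move=> cC cC' CC' xC yC'; apply: (comp_out cC xC); rewrite inE.
rewrite (comp_disj cC' cC) //=; last by rewrite eq_sym.
by case: cC' => /subsetP->.
Qed.

(** The second independent edge of [bad_exit]; an edge leaving a component of G - N[v] ends in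
    N(v). *)
Lemma bad_links v H x y : comp (NV v) H -> bad H -> x \in H -> adj v y -> adj y x ->
  exists x' y', [/\ x' \in H, x' != x, y' != y, adj v y' & adj y' x'].
Proof.
move=> cH bH xH vy yx.
have [a [w [aH wH aw ax wy]]] := bad_exit bH xH (compN_notin cH vy) yx.
exists a, w; split=> //; last by rewrite adjC.
by case: (compN_nbr cH aH aw) => // wH'; rewrite wH' in wH.
Qed.

(** * A pair (v, K) with |K| maximal *)

(** The comparison is with connected sets rather than components, so enlarging K by one vertex
    inside some G - N[u] is already a contradiction. *)
Definition maxpair v K := [/\ deg3 v, conn K, K \subset NV v &
  forall u T, deg3 u -> conn T -> T \subset NV u -> #|T| <= #|K|].

Lemma maxpair_exists v : deg3 v -> exists u K, maxpair u K.
Proof.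
move=> v3; have [H [HR cH _] _] := deg3_bad v3.
pose P k := exists u T, [/\ deg3 u, conn T, T \subset NV u & #|T| = k].
have [k [u [K [u3 cK KR <-]]] mx] : exists2 k, P k & forall j, P j -> j <= k.
  apply: (ex_max (n := #|G|)); first by exists #|H|, v, H.
  by move=> k [u [T [_ _ _ <-]]]; apply: max_card.
by exists u, K; split=> // w T w3 cT TR; apply: mx; exists w, T.
Qed.

Lemma maxpair_comp v K : maxpair v K -> comp (NV v) K.
Proof.
move=> [v3 cK KR mx]; have [x xK] : exists x, x \in K by case: cK => /set0Pn.
have [C cC xC] := comp_exists (subsetP KR _ xK).
have KC : K \subset C by apply: (comp_max cC) => //; apply/pred0Pn; exists x; apply/andP.
have [CR conC _] := cC.
by have /eqP -> : K == C by rewrite eqEcard KC (mx v C v3 conC CR).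
Qed.

(** If u missed y, then K with y added would be a larger connected set in G - N[u]. *)
Lemma maxpair_deg3 v K H u y k : maxpair v K -> comp (NV v) H -> H != K -> u \in H ->
  deg3 u -> adj v y -> k \in K -> adj y k -> adj u y.
Proof.
move=> mp cH HK uH u3 vy kK yk; have cK := maxpair_comp mp.
have [v3 conK KR mx] := mp; apply: contraT => uy.
have yK := compN_notin cK vy.
have := mx u (y |: K) u3; rewrite cardsU1 yK ltnn; apply.
  by apply: (conn_add conK kK); rewrite adjC.
apply/subsetP=> x; rewrite in_setU1 in_NV => /orP[/eqP->|xK].
  by rewrite uy andbT eq_sym (compN_neq cH).
have xH : x \notin H by apply: (comp_disj cK cH); rewrite // eq_sym.
rewrite (comp_nadj cH cK) // andbT; by apply: contraNneq xH => ->.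
Qed.

(** A neighbour y of v that sees K would be adjacent to v, to a vertex of K, and to both u and
    u'. *)
Lemma maxpair_one_deg3 v K H u u' : maxpair v K -> comp (NV v) H -> H != K -> u \in H ->
  u' \in H -> deg3 u -> deg3 u' -> u = u'.
Proof.
move=> mp cH HK uH u'H u3 u'3; have cK := maxpair_comp mp.
have [k [y [kK vy yk]]] := compN_link cK.
apply/eqP; apply: contraT => uu'.
have uk x : x \in H -> x != k.
  by move=> xH; apply: contraTneq kK => <-; rewrite (comp_disj cH cK).
have /andP[kv _] := compN_out cK kK.
have vH x : x \in H -> v != x by move=> /(compN_out cH)/andP[]; rewrite eq_sym.
have yv : adj y v by rewrite adjC.
have yu : adj y u by rewrite adjC (maxpair_deg3 mp cH HK uH u3 vy kK yk).
have yu' : adj y u' by rewrite adjC (maxpair_deg3 mp cH HK u'H u'3 vy kK yk).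
exfalso; apply: (four_neq yv yk yu yu' _ (vH u uH) (vH u' u'H) _ _ uu').
- by rewrite eq_sym.
- by rewrite eq_sym uk.
- by rewrite eq_sym uk.
Qed.

(** In the other cases of [bad_shape] two vertices of H have degree 3; when all vertices have two
    neighbours inside H, these are the ends of two independent leaving edges. *)
Lemma maxpair_bad_P3 v K H : maxpair v K -> comp (NV v) H -> H != K -> bad H ->
  exists a b c, [/\ H = [set a; b; c], a != c, adj a b, adj b c & ~~ adj a c].
Proof.
move=> mp cH HK bH; case: (bad_shape bH) => // [two|].
  have [x [y [xH vy yx]]] := compN_link cH.
  have [x' [y' [x'H xx' yy' vy' yx']]] := bad_links cH bH xH vy yx.
  have d3 w z : w \in H -> adj v z -> adj z w -> deg3 w.
    move=> wH vz zw; have [a [b [aH bH' ab wa wb]]] := two w wH.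
    apply: (@deg3I w a b z) => //; last by rewrite adjC.
    by apply: uniq3; rewrite // (compN_neq cH).
  move/eqP: xx'; case; exact: (maxpair_one_deg3 mp cH HK x'H xH (d3 _ _ x'H vy' yx') (d3 _ _ xH
    vy yx)).
have d3 w : three_nbrs H w -> deg3 w.
  by move=> [a [b [c [u3 _ /and3P[wa wb wc]]]]]; apply: (deg3I u3).
move=> [u [u' [uH u'H uu' /d3 u3 /d3 u'3]]].
by rewrite (maxpair_one_deg3 mp cH HK uH u'H u3 u'3) eqxx in uu'.
Qed.


(** * A second component is not bad *)

Lemma third_nbr v a b : deg3 v -> adj v a -> adj v b -> a != b ->
  exists2 c, uniq [:: a; b; c] & adj v c.
Proof.
move=> [y1 [y2 [y3 [u3 vN]]]] va vb ab; apply: NNPP => no.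
have {no} no c : adj v c -> c \in [:: a; b].
  move=> vc; apply: contraT; rewrite !inE negb_or => /andP[ca cb]; case: no; exists c => //.
  by apply: uniq3; rewrite // eq_sym.
have sub : {subset [:: y1; y2; y3] <= [:: a; b]} by move=> c; rewrite -vN; apply: no.
by have := uniq_leq_size u3 sub.
Qed.

(** Maximality speaks of |K| alone, so the pair can be recentred at u. *)
Lemma maxpair_move v K u : maxpair v K -> deg3 u -> K \subset NV u -> maxpair u K.
Proof. by move=> [_ cK _ mx] u3 KR; split. Qed.

Lemma maxpair_NV v K H u : maxpair v K -> comp (NV v) H -> H != K -> u \in H -> K \subset NV u.
Proof.
move=> mp cH HK uH; have cK := maxpair_comp mp; apply/subsetP=> x xK.
rewrite in_NV (comp_nadj cH cK) // andbT; apply: contraTneq xK => ->.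
by rewrite (comp_disj cH cK).
Qed.

(** Otherwise the bad set K would lie behind the cut vertex y1. *)
Lemma one_link_good v K y1 : comp (NV v) K -> adj v y1 ->
  (forall y k, adj v y -> k \in K -> adj y k -> y = y1) -> ~ bad K.
Proof.
move=> cK vy1 lk bK; apply: (@bad_compC1 y1 K) => //; apply: (comp_ext cK).
  by apply/subsetP=> x; rewrite in_NV !inE => /andP[_]; apply: contraNneq => ->.
move=> k w kK; rewrite !inE negbK => wy1 /orP[/eqP->|vw].
  by rewrite adjC; case/andP: (compN_out cK kK).
by rewrite adjC; apply: contra wy1 => wk; apply/eqP/(lk w k).
Qed.

Lemma card_comp2 v K H : deg3 v -> comp (NV v) K -> comp (NV v) H -> H != K ->
  #|K| + #|H| + 4 <= #|G|.
Proof.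
move=> v3 cK cH HK; rewrite -(card_NV v3) leq_add2r -cardsUI.
have -> : K :&: H = set0.
  apply/setP=> x; rewrite !inE; apply/andP=> -[xK xH].
  by have := comp_disj cH cK HK xH; rewrite xK.
by rewrite cards0 addn0 subset_leq_card // subUset; case: cK cH => -> _ _ [->].
Qed.

(** The third neighbour y1 of b is the only neighbour of v that sees K, so K is good. Recentred at
    b, the pair (b, K) has a bad component W other than K, which turns out to be the path on v, y2,
    y3. Hence G consists of K and a, b, c, v, y1, y2, y3, and the neighbours of c decide how to
    finish. *)
Lemma P3_center_deg3 v K H a b c y2 : maxpair v K -> comp (NV v) H -> H != K -> bad H ->
  H = [set a; b; c] -> a != c -> adj a b -> adj b c -> ~~ adj a c -> deg3 b ->
  adj v y2 -> adj a y2 -> False.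
Proof.
move=> mp cH HK bH HE ac ab bc nac b3 vy2 ay2.
have cK := maxpair_comp mp; have [v3 conK _ _] := mp.
have [aH bH' cH'] : [/\ a \in H, b \in H & c \in H] by rewrite HE !inE !eqxx ?orbT.
have [k [y1 [kK vy1 y1k]]] := compN_link cK.
have by1 : adj b y1 := maxpair_deg3 mp cH HK bH' b3 vy1 kK y1k.
have HN x : x \in H -> (x != v) && ~~ adj v x by apply: (compN_out cH).
have Hy x y : x \in H -> adj v y -> x != y by move=> xH; apply: (compN_neq cH).
have HKn x y : x \in H -> y \in K -> x != y.
  by move=> xH; apply: contraTneq => <-; rewrite (comp_disj cH cK).
have KN x : x \in K -> (x != v) && ~~ adj v x by apply: (compN_out cK).
have Ky x y : x \in K -> adj v y -> x != y by move=> xK; apply: (compN_neq cK).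
have ab' := adj_neq ab; have bc' := adj_neq bc.
have bN w : adj b w -> [\/ w = a, w = c | w = y1].
  apply: (nbr3 (uniq3 ac _ _)) => //; rewrite 1?adjC ?Hy //.
have nd x : x \in H -> x != b -> ~ deg3 x.
  by move=> xH /eqP xb x3; apply/xb/(maxpair_one_deg3 mp cH HK).
have vb : v != b by rewrite eq_sym; case/andP: (HN b bH').
have vk : v != k by rewrite eq_sym; case/andP: (KN k kK).
have y1N w : adj y1 w -> [\/ w = v, w = b | w = k].
  by apply: (nbr3 (uniq3 vb vk (HKn b k bH' kK))); rewrite // adjC.
have lk y k' : adj v y -> k' \in K -> adj y k' -> y = y1.
  move=> vy k'K yk'; have := maxpair_deg3 mp cH HK bH' b3 vy k'K yk'.
  by case/bN => // E; [have := Hy a y aH vy|have := Hy c y cH' vy]; rewrite E eqxx.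
have y12 : y1 != y2.
  apply/eqP=> E; rewrite -E adjC in ay2; case: (y1N _ ay2) => E'.
  - by have := HN a aH; rewrite E' eqxx.
  - by rewrite E' eqxx in ab'.
  - by have := HKn a k aH kK; rewrite E' eqxx.
have aN w : adj a w -> w = b \/ w = y2.
  by apply: ndeg3; rewrite ?Hy //; apply: nd.
have [y3 u3 vy3] := third_nbr v3 vy1 vy2 y12.
have vN w : adj v w -> [\/ w = y1, w = y2 | w = y3] by apply: nbr3.
have [y13 y23] : y1 != y3 /\ y2 != y3.
  by move: u3; rewrite /= !inE !negb_or => /and3P[/andP[_ ->] ->].
have nbK := one_link_good cK vy1 lk.
have mpb : maxpair b K by apply: (maxpair_move mp b3); apply: (maxpair_NV mp cH).
have cKb := maxpair_comp mpb.
have [W cW bW] := deg3_bad b3.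
have WK : W != K by apply/eqP=> E; apply: nbK; rewrite -E.
have nby y : adj v y -> y != y1 -> ~~ adj b y.
  move=> vy yy1; apply/negP=> /bN[] E; last by rewrite E eqxx in yy1.
    by have := Hy a y aH vy; rewrite E eqxx.
  by have := Hy c y cH' vy; rewrite E eqxx.
have y2W : y2 \in W -> v \in W.
  move=> y2W; case: (compN_nbr cW y2W (w := v)) => //; first by rewrite adjC.
  by rewrite adjC => vab; have := HN b bH'; rewrite vab andbF.
have lnkv y w : w \in W -> adj b y -> adj y w -> y != c -> v \in W.
  move=> wW by_ yw yc; have /andP[wb _] := compN_out cW wW.
  case: (bN _ by_) => E; last 2 first.
  - by rewrite E eqxx in yc.
  - rewrite E in yw; case: (y1N _ yw) => E'; first by rewrite -E'.
      by rewrite E' eqxx in wb.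
    by rewrite E' in wW; have := comp_disj cW cKb WK wW; rewrite kK.
  rewrite E in yw; case: (aN _ yw) => E'; first by rewrite E' eqxx in wb.
  by apply: y2W; rewrite -E'.
(* Two independent edges leave W, so one of them does not end in c; it ends in a or y1 and leads to
   v. *)
have vW : v \in W.
  have [w [y [wW by_ yw]]] := compN_link cW.
  have [w' [y' [w'W _ yy' by' yw']]] := bad_links cW bW wW by_ yw.
  case: (eqVneq y c) => [E|yc]; last exact: (lnkv y w).
  by apply: (lnkv y' w') => //; rewrite -E.
have inW y : adj v y -> y != y1 -> y \in W.
  move=> vy yy1; case: (compN_nbr cW vW vy) => // bay.
  by have := nby y vy yy1; rewrite bay.
have [y2W' y3W] : y2 \in W /\ y3 \in W by split; apply: inW; rewrite // eq_sym.
have [a' [b' [c' [WE ac' _ _ nac']]]] := maxpair_bad_P3 mpb cW WK bW.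
have WE' : W = [set v; y2; y3].
  apply/eqP; rewrite eq_sym eqEcard !subUset !sub1set vW y2W' y3W /=.
  rewrite -!setUA !cardsU1 cards1 !inE !negb_or (adj_neq vy2) (adj_neq vy3) y23.
  rewrite WE; apply: leq_trans (leq_card_setU _ _) _; rewrite cards1 cards2.
  by case: (a' != b').
have ny23 : ~~ adj y2 y3.
  apply/negP=> y23'; move: ac' nac'.
  have : a' \in W by rewrite WE !inE eqxx.
  have : c' \in W by rewrite WE !inE eqxx ?orbT.
  rewrite WE' !inE -!orbA => /or3P[]/eqP-> /or3P[]/eqP->; rewrite ?eqxx //;
    move=> _ /negP[]; first [exact: vy2|exact: vy3|exact: y23'|
    rewrite adjC; first [exact: vy2|exact: vy3|exact: y23']].
have WN x w : x \in W -> adj x w -> [|| w == v, w == y2, w == y3, w == a, w == c | w == y1].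
  move=> xW xw; case: (compN_nbr cW xW xw); first by rewrite WE' !inE => /orP[/orP[]|] ->;
    rewrite ?orbT.
  by case/bN => ->; rewrite eqxx ?orbT.
pose L := [:: y1; a; b; c; v; y2; y3].
have cov x : (x \in K) || (x \in L).
  have: [set: G] \subset K :|: [set z in L].
    apply: (conn_ind connG (in_setT v)); first by rewrite !inE eqxx !orbT.
    move=> p q _; rewrite in_setU [p \in [set z in L]]inE => /orP[pK|pL] _ pq.
      rewrite in_setU; case: (compN_nbr cK pK pq) => [->//|vq].
      have -> : q = y1 by apply: (lk q p); rewrite // adjC.
      by rewrite [y1 \in [set z in L]]inE mem_head orbT.
    suff : q \in K \/ q \in L by rewrite !inE => -[]->; rewrite ?orbT.
    move: pL; rewrite !inE; case/or4P=> [/eqP E|/eqP E|/eqP E|].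
    - by rewrite E in pq; case: (y1N _ pq) => ->; rewrite ?eqxx ?orbT; auto.
    - by rewrite E in pq; case: (aN _ pq) => ->; rewrite ?eqxx ?orbT; auto.
    - by rewrite E in pq; case: (bN _ pq) => ->; rewrite ?eqxx ?orbT; auto.
    case/or4P=> /eqP E; rewrite E in pq.
    - case: (compN_nbr cH cH' pq); first by rewrite HE !inE => /orP[/orP[]|] ->; rewrite ?orbT;
      auto.
      by case/vN => ->; rewrite ?eqxx ?orbT; auto.
    - by case: (vN _ pq) => ->; rewrite ?eqxx ?orbT; auto.
    - by right; case/or4P: (WN _ _ y2W' pq) => [->|->|->|/or3P[] ->]; rewrite ?orbT.
    - by right; case/or4P: (WN _ _ y3W pq) => [->|->|->|/or3P[] ->]; rewrite ?orbT.
  by move/subsetP/(_ x (in_setT x)); rewrite !inE.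
have H3 : #|H| = 3 by rewrite HE -!setUA !cardsU1 cards1 !inE !negb_or ab' ac bc'.
have cG := card_comp2 v3 cK cH HK; rewrite H3 in cG.
have ny3b : ~~ adj b y3 by apply: nby; rewrite // eq_sym.
have ny2b : ~~ adj b y2 by apply: nby; rewrite // eq_sym.
have nlk y x : adj v y -> y != y1 -> x \in K -> ~~ adj x y.
  by move=> vy yy1 xK; apply: contra yy1 => xy; apply/eqP/(lk y x); rewrite // adjC.
have ny3a : ~~ adj a y3.
  apply/negP=> /aN[] E; last by rewrite E eqxx in y23.
  by have := Hy b y3 bH' vy3; rewrite E eqxx.
have y21 : y2 != y1 by rewrite eq_sym.
have y31 : y3 != y1 by rewrite eq_sym.
case: (classic (exists2 y, adj v y & adj c y)) => [[y vy cy]|no].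
  have cb : adj c b by rewrite adjC.
  have cN w : adj c w -> w = b \/ w = y.
    by apply: ndeg3 => //; [apply: nd; rewrite // eq_sym | apply: Hy].
  case: (vN _ vy) => E; rewrite {y vy}E in cy cN.
  - rewrite adjC in cy; case: (y1N _ cy) => E.
    + by have := HN c cH'; rewrite E eqxx.
    + by rewrite E eqxx in bc'.
    + by have := HKn c k cH' kK; rewrite E eqxx.
  (* Dominating y2 hits a, c and v; there remain y3 and the connected set K + y1 + b, of cost at
     most |K| + 3. *)
  - have y1K := compN_notin cK vy1.
    have bK : b \notin y1 |: K.
      rewrite !inE negb_or Hy //=; apply/negP=> bK.
      by have := HKn b b bH' bK; rewrite eqxx.
    have con : conn (b |: (y1 |: K)).
      apply: (@conn_add _ _ y1); [|by rewrite !inE eqxx|by rewrite adjC].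
      by apply: (conn_add conK kK); rewrite adjC.
    have vT : v \notin b |: (y1 |: K).
      rewrite !inE !negb_or vb (adj_neq vy1) /=; apply/negP=> vK.
      by have := KN v vK; rewrite eqxx.
    have := quiso_conn (neq_setT vT) con; rewrite !cardsU1 bK y1K => Q.
    apply: (@dom_cex y2 (0 + #|K|.+3)); last by clear -cG; lia.
    apply: (quiso_sub _ (quisoU (S := [set y3]) _ _ Q)); last first.
    + by apply: quiso_small; rewrite cards1.
    + move=> p q; rewrite !inE => /eqP-> /or3P[/eqP->|/eqP->|qK]; rewrite adjC //.
        by apply/negP=> /y1N[] E; [have := adj_neq vy3|have := Hy b y3 bH' vy3|have := Ky k y3
          kK vy3]; rewrite E eqxx.
      exact: nlk.
    apply/subsetP=> x; rewrite in_NV => /andP[xy2 nx].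
    have := cov x; rewrite !inE => /orP[->|]; first by rewrite !orbT.
    case/or4P=> [/eqP->|/eqP E|/eqP->|]; rewrite ?eqxx ?orbT //.
      by rewrite E adjC ay2 in nx.
    case/or4P=> /eqP E; rewrite E ?eqxx ?orbT //.
    + by rewrite E adjC cy in nx.
    + by rewrite E adjC vy2 in nx.
    + by rewrite E eqxx in xy2.
  - apply: noC6; apply: (@C6_intro _ v y2 a b c y3).
      by rewrite vy2 (adjC y2 a) ay2 ab bc cy adjC.
    have ny2c : ~~ adj y2 c.
      rewrite adjC; apply/negP=> /cN[] E; last by rewrite E eqxx in y23.
      by have := Hy b y2 bH' vy2; rewrite E eqxx.
    case/andP: (HN a aH) => _ ->; case/andP: (HN b bH') => _ ->; case/andP: (HN c cH') => _ ->.
    by rewrite (adjC y2 b) ny2b ny2c ny23 nac ny3a ny3b.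
have cN w : adj c w -> w = b.
  move=> cw; case: (compN_nbr cH cH' cw) => [|vw]; last by case: no; exists w.
  rewrite HE !inE -orbA => /or3P[]/eqP E //; rewrite E in cw.
    by rewrite adjC (negPf nac) in cw.
  by rewrite adjxx in cw.
have nc x : x != b -> ~~ adj c x by move=> xb; apply: contra xb => /cN->.
(* Here c is a leaf: dominating y1 hits v and b and leaves the good set K and the pairs {a, y2} and
   {c, y3}, which are free. *)
apply: (@dom_cex y1 (#|K| + (0 + 0))); last by clear -cG; lia.
have KT : K != [set: G].
  apply: (@neq_setT _ v); apply/negP=> vK; by have := KN v vK; rewrite eqxx.
have QK : quiso K #|K|.
  by apply: quiso_leq (proper_good KT conK nbK); rewrite leq_subr.
apply: (quiso_sub _ (quisoU _ QK (quisoU (S := [set a; y2]) (T := [set c; y3]) _ _ _))).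
- apply/subsetP=> x; rewrite in_NV => /andP[xy1 nx].
  have := cov x; rewrite !inE => /orP[->//|].
  case/or4P=> [/eqP E|/eqP->|/eqP E|]; rewrite ?eqxx ?orbT //.
    by rewrite E eqxx in xy1.
    by rewrite E adjC by1 in nx.
  case/or4P=> /eqP E; rewrite E ?eqxx ?orbT //.
  by rewrite E adjC vy1 in nx.
- move=> x q xK; rewrite !inE -!orbA => /or4P[]/eqP->; [|exact: nlk| |exact: nlk].
    by rewrite adjC (comp_nadj cH cK).
  by rewrite adjC (comp_nadj cH cK).
- move=> p q; rewrite !inE => /orP[]/eqP-> /orP[]/eqP-> //.
  by rewrite adjC; apply: nc; rewrite eq_sym Hy.
- by apply: quiso_small; rewrite cards2; case: (_ == _).
- by apply: quiso_small; rewrite cards2; case: (_ == _).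
Qed.

(** Besides b, the vertex a sees y1 and a further neighbour y2 of v. If w differs from y2, then v y1
    a b c w is an induced 6-cycle. Otherwise y2 sees only v, a and c, so K is good and {c} is a
    component of G - N[a]; this one free vertex pays for the only bad component of G - N[a], the one
    through v. *)
Lemma P3_end_deg3 v K H a b c w : maxpair v K -> comp (NV v) H -> H != K ->
  H = [set a; b; c] -> a != c -> adj a b -> adj b c -> ~~ adj a c -> deg3 a ->
  adj v w -> adj c w -> False.
Proof.
move=> mp cH HK HE ac ab bc nac a3 vw cw.
have cK := maxpair_comp mp; have [v3 conK _ _] := mp.
have [aH bH cH'] : [/\ a \in H, b \in H & c \in H] by rewrite HE !inE !eqxx ?orbT.
have [k [y1 [kK vy1 y1k]]] := compN_link cK.
have ay1 : adj a y1 := maxpair_deg3 mp cH HK aH a3 vy1 kK y1k.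
have HN x : x \in H -> (x != v) && ~~ adj v x by apply: (compN_out cH).
have Hy x y : x \in H -> adj v y -> x != y by move=> xH; apply: (compN_neq cH).
have HKn x y : x \in H -> y \in K -> x != y.
  by move=> xH; apply: contraTneq => <-; rewrite (comp_disj cH cK).
have KN x : x \in K -> (x != v) && ~~ adj v x by apply: (compN_out cK).
have Ky x y : x \in K -> adj v y -> x != y by move=> xK; apply: (compN_neq cK).
have ab' := adj_neq ab; have bc' := adj_neq bc.
have nd x : x \in H -> x != a -> ~ deg3 x.
  by move=> xH /eqP xa x3; apply/xa/(maxpair_one_deg3 mp cH HK).
have va : v != a by rewrite eq_sym; case/andP: (HN a aH).
have vk : v != k by rewrite eq_sym; case/andP: (KN k kK).
have y1N x : adj y1 x -> [\/ x = v, x = a | x = k].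
  by apply: (nbr3 (uniq3 va vk (HKn a k aH kK))); rewrite // adjC.
have [y2 u3 ay2] := third_nbr a3 ab ay1 (Hy b y1 bH vy1).
have aN x : adj a x -> [\/ x = b, x = y1 | x = y2] by apply: nbr3.
have [by2 y12] : b != y2 /\ y1 != y2.
  by move: u3; rewrite /= !inE !negb_or => /and3P[/andP[_ ->] ->].
have vy2 : adj v y2.
  case: (compN_nbr cH aH ay2) => //; rewrite HE !inE -orbA => /or3P[]/eqP E.
  - by rewrite E adjxx in ay2.
  - by rewrite E eqxx in by2.
  - by rewrite E (negPf nac) in ay2.
have cb : adj c b by rewrite adjC.
have ba : adj b a by rewrite adjC.
have cN x : adj c x -> x = b \/ x = w.
  by apply: ndeg3; rewrite ?Hy //; apply: nd; rewrite // eq_sym.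
have bN x : adj b x -> x = a \/ x = c.
  by apply: ndeg3 => //; apply: nd; rewrite // eq_sym.
have nw1 : ~~ adj y1 w.
  apply/negP=> /y1N[] E; [have := adj_neq vw|have := Hy a w aH vw|have := Ky k w kK vw];
  by rewrite E eqxx.
have ny1c : ~~ adj y1 c.
  apply/negP=> /y1N[] E; [have := HN c cH'|by rewrite E eqxx in ac|have := HKn c k cH' kK];
  by rewrite E eqxx.
have w1 : w != y1 by apply: contraNneq ny1c => <-; rewrite adjC.
case: (eqVneq w y2) => [E|w2]; last first.
  apply: noC6; apply: (@C6_intro _ v y1 a b c w).
    by rewrite vy1 (adjC y1 a) ay1 ab bc cw adjC.
  case/andP: (HN a aH) => _ ->; case/andP: (HN b bH) => _ ->; case/andP: (HN c cH') => _ ->.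
  rewrite ny1c nw1 nac /=; apply/and3P; split.
  - apply/negP=> /y1N[] E; [have := HN b bH|by rewrite E eqxx in ab'|have := HKn b k bH kK];
    by rewrite E eqxx.
  - apply/negP=> /aN[] E; [have := Hy b w bH vw|move: w1|move: w2]; by rewrite E eqxx.
  - apply/negP=> /bN[] E; [have := Hy a w aH vw|have := Hy c w cH' vw]; by rewrite E eqxx.
rewrite {w vw w1 nw1}E in cw cN.
have vc : v != c by rewrite eq_sym; case/andP: (HN c cH').
have y2N x : adj y2 x -> [\/ x = v, x = a | x = c].
  by apply: (nbr3 (uniq3 va vc ac)); rewrite // adjC.
have lk y k' : adj v y -> k' \in K -> adj y k' -> y = y1.
  move=> vy k'K yk'; have := maxpair_deg3 mp cH HK aH a3 vy k'K yk'.
  case/aN => // E; first by have := Hy b y bH vy; rewrite E eqxx.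
  rewrite E in yk'; case: (y2N _ yk') => E'.
  - by have := KN k' k'K; rewrite E' eqxx.
  - by have := HKn a k' aH k'K; rewrite E' eqxx.
  - by have := HKn c k' cH' k'K; rewrite E' eqxx.
have nbK := one_link_good cK vy1 lk.
have mpa : maxpair a K by apply: (maxpair_move mp a3); apply: (maxpair_NV mp cH).
have cKa := maxpair_comp mpa.
have cc : comp (NV a) [set c].
  split; [|exact: conn1|].
    by rewrite sub1set in_NV eq_sym ac.
  move=> x y; rewrite inE => /eqP->; rewrite in_NV => /andP[_ nay] /cN[] E.
    by rewrite E ab in nay.
  by rewrite E ay2 in nay.
have badv C : comp (NV a) C -> bad C -> v \in C.
  move=> cC bC.
  have CK : C != K by apply/eqP=> E; apply: nbK; rewrite -E.
  have Cc : C != [set c] by apply/eqP=> E; have := bad_mod bC; rewrite E cards1.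
  have notc : c \notin C by apply/negP=> cC'; have := comp_disj cC cc Cc cC'; rewrite inE eqxx.
  have [x [y [xC ay yx]]] := compN_link cC; have /andP[xa _] := compN_out cC xC.
  case: (aN _ ay) => E; rewrite E in yx.
  - case: (bN _ yx) => E'; first by rewrite E' eqxx in xa.
    by rewrite E' (negPf notc) in xC.
  - case: (y1N _ yx) => E'; [by rewrite -E'|by rewrite E' eqxx in xa|].
    by rewrite E' in xC; have := comp_disj cC cKa CK xC; rewrite kK.
  - case: (y2N _ yx) => E'; [by rewrite -E'|by rewrite E' eqxx in xa|].
    by rewrite E' (negPf notc) in xC.
have [W cW bW] := deg3_bad a3; have vW := badv W cW bW.
have Wc : W != [set c] by apply/eqP=> E; have := bad_mod bW; rewrite E cards1.
have [WN _ _] := cW.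
set R := (NV a :\: W) :\ c.
have cin : c \in NV a :\: W.
  apply/setDP; split; first by rewrite in_NV eq_sym ac.
  by apply: (comp_disj cc cW); rewrite ?set11 // eq_sym.
have cR : #|NV a| = #|W| + #|R|.+1.
  have := cardsD1 c (NV a :\: W); rewrite cin card_setD_sub // -/R.
  have := subset_leq_card WN; clear; lia.
have QR : quiso R #|R|.
  rewrite -[X in quiso X]setD0; apply: quiso_comps.
    by apply: (@neq_setT _ a); rewrite !inE eqxx !andbF.
  move=> C cC bC; have sC : {subset C <= R} by case: cC => /subsetP.
  have cC' : comp (NV a) C.
    apply: (comp_ext cC); first by apply/subsetP=> x /setD1P[_ /setDP[]].
    move=> x y xC yN yR; have /setD1P[xc /setDP[xN xW]] := sC x xC.
    case: (eqVneq y c) => [->|yc].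
      by rewrite adjC (comp_out cc) ?set11 // in_setD in_set1 xc.
    have yW : y \in W.
      by apply: contraT => yW; case/negP: yR; apply/setD1P; split=> //; apply/setDP.
    by rewrite adjC (comp_out cW) // in_setD xW.
  by have /setD1P[_ /setDP[_]] := sC v (badv C cC' bC); rewrite vW.
apply: (@dom_cex a (#|W|.+1 + (0 + #|R|))); last first.
  by have := card_NV a3; rewrite cR; clear; lia.
apply: (quiso_sub _ (quisoU _ (quiso_bad bW) (quisoU (S := [set c]) _ _ QR))).
- apply/subsetP=> x xN; rewrite in_setU; case xW: (x \in W) => //.
  by rewrite in_setU in_set1 in_setD1 in_setD xN xW; case: (eqVneq x c).
- move=> p q pW; rewrite in_setU in_set1 => /orP[/eqP->|/setD1P[_ qR]].
    by rewrite (comp_out cW pW).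
  by rewrite (comp_out cW pW).
- move=> p q; rewrite in_set1 => /eqP-> /setD1P[qc /setDP[qN _]].
  by apply: (comp_out cc); rewrite ?set11 // in_setD in_set1 qc.
- by apply: quiso_small; rewrite cards1.
Qed.

(** The two preceding lemmas leave a path a b c without vertices of degree 3, attached through ya at
    a and yc at c. If ya and yc are adjacent, [bad_compC2] applies; if not, v ya a b c yc is an
    induced 6-cycle. *)
Lemma maxpair_other v K H : maxpair v K -> comp (NV v) H -> H != K -> ~ bad H.
Proof.
move=> mp cH HK bH.
have [a [b [c [HE ac ab bc nac]]]] := maxpair_bad_P3 mp cH HK bH.
have HE' : H = [set c; b; a].
  by rewrite HE; apply/setP=> x; rewrite !inE; case: (x == a); case: (x == b); case: (x == c).
have [cb ba] : adj c b /\ adj b a by rewrite (adjC c) (adjC b a).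
have nca : ~~ adj c a by rewrite adjC.
have ca : c != a by rewrite eq_sym.
have [x [y [xH vy yx]]] := compN_link cH.
have [x' [y' [x'H xx' yy' vy' yx']]] := bad_links cH bH xH vy yx.
have [aH bH' cH'] : [/\ a \in H, b \in H & c \in H] by rewrite HE !inE !eqxx ?orbT.
have lka z : adj v z -> adj z a -> deg3 b -> False.
  move=> vz za b3; rewrite adjC in za.
  exact: (P3_center_deg3 mp cH HK bH HE ac ab bc nac b3 vz za).
have lkc z : adj v z -> adj z c -> deg3 b -> False.
  move=> vz za b3; rewrite adjC in za.
  exact: (P3_center_deg3 mp cH HK bH HE' ca cb ba nca b3 vz za).
have lkb z : adj v z -> adj z b -> deg3 b.
  move=> vz zb; apply: (@deg3I b a c z) => //; last by rewrite adjC.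
  by apply: uniq3; rewrite // (compN_neq cH).
have Hcase z : z \in H -> [\/ z = a, z = b | z = c].
  by rewrite HE !inE -orbA => /or3P[]/eqP->; [constructor 1|constructor 2|constructor 3].
have nb3 : ~ deg3 b.
  move=> b3; case: (Hcase x xH) => E; rewrite E in yx xx'; [exact: lka yx b3| |exact: lkc yx b3].
  case: (Hcase x' x'H) => E'; rewrite E' in yx' xx'; [exact: lka yx' b3| |exact: lkc yx' b3].
  by rewrite eqxx in xx'.
have [ya [yc [vya vyc aya cyc yac]]] : exists ya yc,
    [/\ adj v ya, adj v yc, adj a ya, adj c yc & ya != yc].
  case: (Hcase x xH) => E; rewrite E in yx xx'; last 2 first.
  - by case: nb3; apply: lkb yx.
  - case: (Hcase x' x'H) => E'; rewrite E' in yx' xx'; last by rewrite eqxx in xx'.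
      by exists y', y; split; rewrite // adjC.
    by case: nb3; apply: lkb yx'.
  case: (Hcase x' x'H) => E'; rewrite E' in yx' xx'; first by rewrite eqxx in xx'.
    by case: nb3; apply: lkb yx'.
  by exists y, y'; split; rewrite // 1?adjC // eq_sym.
case: (classic (deg3 a)) => [a3|na3].
  exact: (P3_end_deg3 mp cH HK HE ac ab bc nac a3 vyc cyc).
case: (classic (deg3 c)) => [c3|nc3].
  exact: (P3_end_deg3 mp cH HK HE' ca cb ba nca c3 vya aya).
have Hy z t : z \in H -> adj v t -> z != t by move=> zH; apply: (compN_neq cH).
have HN z : z \in H -> (z != v) && ~~ adj v z by apply: (compN_out cH).
have aN w : adj a w -> w = b \/ w = ya by apply: ndeg3; rewrite ?Hy.
have cN w : adj c w -> w = b \/ w = yc by apply: ndeg3; rewrite ?Hy.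
have bN w : adj b w -> w = a \/ w = c by apply: ndeg3.
case yy: (adj ya yc).
  apply: (@bad_compC2 ya yc H) => //; apply: (comp_ext cH).
    apply/subsetP=> z; rewrite in_NV !inE => /andP[_ nz].
    by apply/norP; split; apply: contraNneq nz => ->.
  move=> h w hH; rewrite !inE negb_or negbK => /andP[wa wc] /orP[/eqP->|vw].
    by rewrite adjC; case/andP: (HN h hH).
  apply/negP; case: (Hcase h hH) => -> hw.
  - case: (aN _ hw) => E; last by rewrite E eqxx in wa.
    by have := Hy b w bH' vw; rewrite E eqxx.
  - by case: (bN _ hw) => E; [have := Hy a w aH vw|have := Hy c w cH' vw]; rewrite E eqxx.
  - case: (cN _ hw) => E; last by rewrite E eqxx in wc.
    by have := Hy b w bH' vw; rewrite E eqxx.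
apply: noC6; apply: (@C6_intro _ v ya a b c yc).
  by rewrite vya (adjC ya a) aya ab bc cyc adjC.
case/andP: (HN a aH) => _ ->; case/andP: (HN b bH') => _ ->; case/andP: (HN c cH') => _ ->.
rewrite yy nac /=; apply/and4P; split.
- by rewrite adjC; apply/negP=> /bN[] E; [have := Hy a ya aH vya|have := Hy c ya cH' vya];
  rewrite E eqxx.
- rewrite adjC; apply/negP=> /cN[] E; first by have := Hy b ya bH' vya; rewrite E eqxx.
  by rewrite E eqxx in yac.
- apply/negP=> /aN[] E; first by have := Hy b yc bH' vyc; rewrite E eqxx.
  by rewrite E eqxx in yac.
- by apply/negP=> /bN[] E; [have := Hy a yc aH vyc|have := Hy c yc cH' vyc]; rewrite E eqxx.
Qed.

Lemma maxpair_bad v K : maxpair v K -> bad K.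
Proof.
move=> mp; have [v3 _ _ _] := mp; have [H cH bH] := deg3_bad v3.
case: (eqVneq H K) => [<- //|HK]; by case: (maxpair_other mp cH HK).
Qed.

(** * A good second component *)

(** A nonzero residue of |H| would be saved by rounding and would pay the surplus of K, the only bad
    component. *)
Lemma other_mod v K H : maxpair v K -> comp (NV v) H -> H != K -> #|H| %% 4 = 0.
Proof.
move=> mp cH HK; have [v3 _ _ _] := mp; have cK := maxpair_comp mp.
have bK := maxpair_bad mp; have nbH := maxpair_other mp cH HK.
have [HR conH _] := cH; have [KR _ _] := cK.
apply/eqP; apply: contraT => H0; exfalso.
set R := (NV v :\: K) :\: H.
have HK' : H \subset NV v :\: K.
  by apply/subsetP=> x xH; rewrite in_setD (comp_disj cH cK) // (subsetP HR).
have cR : #|NV v| = #|K| + (#|H| + #|R|).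
  rewrite /R !card_setD_sub //; have := subset_leq_card KR; have := subset_leq_card HK'.
  by rewrite card_setD_sub //; clear; lia.
have vH : v \notin H by apply/negP=> /(compN_out cH); rewrite eqxx.
have QR : quiso R #|R|.
  rewrite -[X in quiso X]setD0; apply: quiso_comps.
    by apply: (@neq_setT _ v); rewrite !inE eqxx !andbF.
  move=> C cC bC; exfalso.
  have cC1 : comp (NV v :\: K) C.
    apply: (comp_ext cC); first exact: subsetDl.
    move=> c w cC' wR wR'; have /setDP[cR' cH'] : c \in R by case: cC => /subsetP->.
    have wH : w \in H by apply: contraT => wH; case/negP: wR'; apply/setDP.
    rewrite adjC (comp_out cH wH) // in_setD cH'.
    by case/setDP: cR'.
  have cC2 := comp_setD cK cC1; have [x xC] := comp_neq0 cC.
  case: (eqVneq C K) => [E|CK]; last exact: maxpair_other mp cC2 CK bC.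
  have /setDP[/setDP[_ xK] _] : x \in R by case: cC => /subsetP->.
  by rewrite -E xC in xK.
apply: (@dom_cex v (#|K|.+1 + ((#|H| - #|H| %% 4) + #|R|))); last first.
  have := card_NV v3; rewrite cR; have := leq_mod #|H| 4; move: H0.
  by move: (#|H| %% 4) => r; clear; lia.
have QH := proper_good (neq_setT vH) conH nbH.
apply: (quiso_sub _ (quisoU _ (quiso_bad bK) (quisoU _ QH QR))).
- apply/subsetP=> x xN; rewrite !in_setU !in_setD xN andbT.
  by case: (x \in K); case: (x \in H).
- move=> p q pK; rewrite in_setU => /orP[qH|/setDP[qR _]]; last exact: comp_out cK pK qR.
  by rewrite adjC (comp_nadj cH cK).
- move=> p q pH /setDP[/setDP[qN _] qH]; apply: (comp_out cH pH).
  by rewrite in_setD qH.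
Qed.

Lemma other_card v K H : maxpair v K -> comp (NV v) H -> H != K -> 4 <= #|H|.
Proof.
move=> mp cH HK; have := other_mod mp cH HK; have [_ conH _] := cH.
by have := conn_card_gt0 conH; move: #|H| => n; clear; lia.
Qed.

(** A neighbour of v that sees K would be a fourth neighbour of x. *)
Lemma other_three v K H x : maxpair v K -> comp (NV v) H -> H != K -> x \in H ->
  ~ three_nbrs H x.
Proof.
move=> mp cH HK xH [a [b [c [u3 /and3P[aH bH cH'] /and3P[xa xb xc]]]]].
have [k [y [kK vy yk]]] := compN_link (maxpair_comp mp).
have x3 := deg3I u3 xa xb xc; have xy := maxpair_deg3 mp cH HK xH x3 vy kK yk.
move: u3; rewrite /= !inE !negb_or => /and3P[/andP[ab ac] bc _].
by apply: (four_neq xa xb xc xy); rewrite // (compN_neq cH).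
Qed.

(** Such an x has degree 3, hence sees both of the neighbours of v that [bad_links] provides for K,
    besides a and b. *)
Lemma other_link_end v K H x y : maxpair v K -> comp (NV v) H -> H != K -> x \in H ->
  adj v y -> adj y x -> ~ two_nbrs H x.
Proof.
move=> mp cH HK xH vy yx [a [b [aH bH ab xa xb]]].
have cK := maxpair_comp mp; have bK := maxpair_bad mp.
have xy : adj x y by rewrite adjC.
have x3 : deg3 x.
  by apply: (@deg3I x a b y) => //; apply: uniq3; rewrite // (compN_neq cH).
have [k [y1 [kK vy1 yk]]] := compN_link cK.
have [k' [y2 [k'K _ y12 vy2 yk']]] := bad_links cK bK kK vy1 yk.
have xy1 := maxpair_deg3 mp cH HK xH x3 vy1 kK yk.
have xy2 := maxpair_deg3 mp cH HK xH x3 vy2 k'K yk'.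
by apply: (four_neq xa xb xy2 xy1); rewrite // (compN_neq cH).
Qed.

Lemma other_inner_nbr v K H x w : maxpair v K -> comp (NV v) H -> H != K -> x \in H ->
  two_nbrs H x -> adj x w -> w \in H.
Proof.
move=> mp cH HK xH x2 xw; case: (compN_nbr cH xH xw) => // vw.
by case: (other_link_end mp cH HK xH vw) => //; rewrite adjC.
Qed.

Lemma other_end_nbr v K H h : maxpair v K -> comp (NV v) H -> H != K -> h \in H ->
  ~ two_nbrs H h -> exists h2 h3, [/\ h2 \in H, h3 \in H, h3 != h, two_nbrs H h2 &
    [/\ adj h h2, adj h2 h3 & forall w, adj h2 w -> w = h \/ w = h3]].
Proof.
move=> mp cH HK hH h1; have H4 := other_card mp cH HK; have [_ conH _] := cH.
have [h2 h2H hh2] : exists2 h2, h2 \in H & adj h h2.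
  by apply: conn_nbr => //; apply: leq_trans H4.
have h2h : adj h2 h by rewrite adjC.
have h22 : two_nbrs H h2.
  apply: NNPP => n2; have : H \subset [set h; h2].
    apply: (conn_ind conH hH); first by rewrite !inE eqxx.
    move=> a b _; rewrite !inE => /orP[]/eqP-> bH ab.
      by rewrite (two_nbrsP h1 bH h2H) ?eqxx ?orbT.
    by rewrite (two_nbrsP n2 bH hH) ?eqxx.
  move/subset_leq_card/(leq_trans H4); rewrite cards2.
  by case: (h != h2).
have n3 := other_three mp cH HK h2H.
have [h3 h3H [h3h h23]] : exists2 h3, h3 \in H & h3 != h /\ adj h2 h3.
  have [a [b [aH bH ab ha hb]]] := h22.
  case: (eqVneq a h) => [E|ah]; last by exists a.
  by exists b; rewrite // -E eq_sym.
exists h2, h3; split=> //; split=> // w hw.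
apply: (three_nbrsP n3) => //; first by rewrite eq_sym.
exact: (other_inner_nbr mp cH HK h2H h22 hw).
Qed.

(** Otherwise h and its neighbour form a pendant path, which [leaf_nbr] excludes. *)
Lemma other_end_linked v K H h : maxpair v K -> comp (NV v) H -> H != K -> h \in H ->
  ~ two_nbrs H h -> exists2 y, adj v y & adj y h.
Proof.
move=> mp cH HK hH h1; apply: NNPP => no.
have [h2 [h3 [h2H h3H h3h h22 [hh2 h23 h2N]]]] := other_end_nbr mp cH HK hH h1.
apply: (@leaf_nbr h h2 h3) => //; first by rewrite eq_sym.
move=> w hw; case: (compN_nbr cH hH hw) => [wH|vw].
  exact: (two_nbrsP h1).
by case: no; exists w; rewrite // adjC.
Qed.

Definition ends H h h' := [/\ h \in H /\ h' \in H, h != h', ~ two_nbrs H h,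
  ~ two_nbrs H h' & forall y, y \in H -> y != h -> y != h' -> two_nbrs H y].

Lemma other_ends v K H : maxpair v K -> comp (NV v) H -> H != K -> exists h h', ends H h h'.
Proof.
move=> mp cH HK; have H4 := other_card mp cH HK; have [_ conH _] := cH.
have [x [y [xH vy yx]]] := compN_link cH.
apply: (path_ends conH _ _ xH); first exact: leq_trans H4.
  by move=> z; apply: other_three mp cH HK.
exact: (other_link_end mp cH HK xH vy).
Qed.

(** Dominating y removes both ends of H. The interior A has order 2 modulo 4 and saves two units; G
    - y - H is connected and may cost one extra. The total 4 + (|H| - 4) + (|G| - |H|) is |G|. *)
Lemma other_same_end v K H h h' y : maxpair v K -> comp (NV v) H -> H != K ->
  ends H h h' -> adj v y -> adj y h -> adj y h' -> False.
Proof.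
move=> mp cH HK [[hH h'H] hh' h1 h'1 mid] vy yh yh'.
have [_ conH _] := cH; have H4 := other_card mp cH HK; have Hm := other_mod mp cH HK.
have vh x : x \in H -> v != x by move=> /(compN_out cH)/andP[]; rewrite eq_sym.
have yN w : adj y w -> [\/ w = v, w = h | w = h'].
  by apply: (nbr3 (uniq3 (vh h hH) (vh h' h'H) hh')); rewrite // adjC.
have yH := compN_notin cH vy.
have vH : v \notin H by apply/negP=> /(compN_out cH); rewrite eqxx.
set A := (H :\ h) :\ h'.
have h'A : h' \in H :\ h by rewrite !inE eq_sym hh'.
have cA : #|H| = #|A|.+2.
  by have := cardsD1 h H; have := cardsD1 h' (H :\ h); rewrite hH h'A -/A; clear; lia.
have A0 : A != set0 by rewrite -card_gt0; move: H4; rewrite cA; clear; lia.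
have conA : conn A.
  apply: conn_del => //.
    apply: conn_del => //; first by apply/set0Pn; exists h'.
    by move=> a b; apply: two_nbrsP.
  by move=> a b /setD1P[_ aH] /setD1P[_ bH]; apply: (two_nbrsP h'1).
have vA : v \notin A by rewrite !inE (negPf vH) !andbF.
have Am : #|A| %% 4 = 2 by move: Hm; rewrite cA; clear; lia.
have QA : quiso A (#|A| - 2).
  by rewrite -Am; apply: quiso_good; rewrite ?Am // (neq_setT vA).
set R := ~: (y |: H).
have yR : y \notin R by rewrite !inE eqxx.
have cR : #|R| + #|H|.+1 = #|G| by have := cardsC (y |: H); rewrite cardsU1 yH -/R; clear; lia.
have inR x : (x \in R) = (x != y) && (x \notin H) by rewrite !inE negb_or.
have vR : v \in R by rewrite inR (adj_neq vy).
have conR : conn R.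
  apply: (conn_intro vR) => T TR vT clT.
  have sub : [set: G] \subset T :|: (y |: H).
    apply: (conn_ind connG (in_setT v)); first by rewrite inE vT.
    move=> a b _; rewrite !in_setU !in_set1 => aT _ ab.
    case bR : (b \in R); last first.
      by move: bR; rewrite inR => /negbT; rewrite negb_and !negbK => ->; rewrite orbT.
    have [bT|/orP[/eqP E|aH]] := orP aT; first by rewrite (clT a b).
      rewrite E in ab; move: bR; rewrite inR => /andP[_ bH].
      by case: (yN _ ab) bH => ->; rewrite ?vT ?hH ?h'H.
    case: (compN_nbr cH aH ab) => [->|vb]; first by rewrite !orbT.
    by rewrite (clT v b).
  apply/subsetP=> x; rewrite inR => /andP[xy xH].
  by have := subsetP sub x (in_setT x); rewrite !in_setU in_set1 (negPf xy) (negPf xH) !orbF.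
have QR := quiso_conn (neq_setT yR) conR.
apply: (@dom_cex y (#|A| - 2 + #|R|.+1)); last first.
  by rewrite -cR cA; move: H4; rewrite cA; clear; lia.
apply: (quiso_sub _ (quisoU _ QA QR)).
  apply/subsetP=> x; rewrite in_NV => /andP[xy nyx]; rewrite in_setU inR xy /=.
  case xH: (x \in H); rewrite ?orbT // orbF !inE xH andbT.
  by apply/andP; split; apply: contraNneq nyx => ->.
move=> a b /setD1P[ah' /setD1P[ah aH]]; rewrite inR => /andP[_ bH].
apply/negP=> ab; case/negP: bH.
exact: (other_inner_nbr mp cH HK aH (mid a aH ah ah') ab).
Qed.

(** Here N(y) = {v, h, z}. Exchanging z for y2 in K gives a connected set T0 of order |K| in G -
    N[y]; by maximality it has no further neighbour there, which determines G outside K and H. The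
    outcomes of [bad_ear] then yield two ways to save. *)
Lemma other_oriented v K H h h' y y' z : maxpair v K -> comp (NV v) H -> H != K ->
  ends H h h' -> adj v y -> adj y h -> adj v y' -> adj y' h' -> y != y' ->
  z \in K -> adj y z -> False.
Proof.
move=> mp cH HK eH vy yh vy' yh' yy' zK yz.
have [[hH h'H] hh' h1 h'1 mid] := eH.
have cK := maxpair_comp mp; have bK := maxpair_bad mp; have [v3 conK _ mx] := mp.
have [HR conH _] := cH; have H4 := other_card mp cH HK; have Hm := other_mod mp cH HK.
have K4 : 4 < #|K|.
  have := leq_trans H4 (mx v H v3 conH HR); have := bad_mod bK.
  by move: #|K| => n; clear; lia.
have HN x : x \in H -> (x != v) && ~~ adj v x by apply: (compN_out cH).
have Hy x w : x \in H -> adj v w -> x != w by move=> xH; apply: (compN_neq cH).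
have HKn x w : x \in H -> w \in K -> x != w.
  by move=> xH; apply: contraTneq => <-; rewrite (comp_disj cH cK).
have KN x : x \in K -> (x != v) && ~~ adj v x by apply: (compN_out cK).
have Ky x w : x \in K -> adj v w -> x != w by move=> xK; apply: (compN_neq cK).
have KHn x w : x \in K -> w \in H -> ~~ adj x w.
  by move=> xK wH; rewrite adjC (comp_nadj cH cK).
have vh : v != h by rewrite eq_sym; case/andP: (HN h hH).
have vz : v != z by rewrite eq_sym; case/andP: (KN z zK).
have yv : adj y v by rewrite adjC.
have u3 := uniq3 vh vz (HKn h z hH zK).
have yN w : adj y w -> [\/ w = v, w = h | w = z] by apply: nbr3.
have y3 : deg3 y := deg3I u3 yv yh yz.
have yK := compN_notin cK vy; have y'K := compN_notin cK vy'.
have yH := compN_notin cH vy; have y'H := compN_notin cH vy'.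
have vK : v \notin K by apply/negP=> /KN; rewrite eqxx.
have vH : v \notin H by apply/negP=> /HN; rewrite eqxx.
have [x [y2 [xK xz y2y vy2 y2x]]] := bad_links cK bK zK vy yz.
have y2K := compN_notin cK vy2; have y2H := compN_notin cH vy2.
have nyv w : adj v w -> ~~ adj y w.
  move=> vw; apply/negP=> /yN[] E; [have := adj_neq vw|have := Hy h w hH vw|have := Ky z w zK vw];
  by rewrite E eqxx.
have conKz : conn (K :\ z) by apply: (bad_del_conn subcubicG bK K4 zK yK).
set T0 := y2 |: K :\ z.
have conT0 : conn T0.
  by apply: (conn_add conKz (x := x)); rewrite ?inE ?xz // adjC.
have cT0 : #|T0| = #|K|.
  rewrite cardsU1 !inE (negPf y2K) andbF /=.
  by have := cardsD1 z K; rewrite zK; clear; lia.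
have inT0 w : (w \in T0) = (w == y2) || (w != z) && (w \in K) by rewrite !inE.
have T0N : T0 \subset NV y.
  apply/subsetP=> w; rewrite inT0 in_NV => /orP[/eqP->|/andP[wz wK]].
    by rewrite y2y nyv.
  rewrite (Ky w y wK vy) /=; apply/negP=> /yN[] E; last by rewrite E eqxx in wz.
    by have := KN w wK; rewrite E eqxx.
  by have := HKn h w hH wK; rewrite E eqxx.
have maxT t w : t \in T0 -> adj t w -> w \notin T0 -> w \in NV y -> False.
  move=> tT tw wT wN; have := mx y (w |: T0) y3 (conn_add conT0 tT tw).
  by rewrite subUset sub1set wN T0N cardsU1 wT cT0 ltnn => /(_ isT).
have y2T : y2 \in T0 by rewrite inT0 eqxx.
have nyh' : ~~ adj y h'.
  apply/negP=> /yN[] E; [have := HN h' h'H|by rewrite E eqxx in hh'|have := HKn h' z h'H zK];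
  by rewrite E eqxx.
have y'2 : y' != y2.
  apply/eqP=> E; apply: (maxT y2 h') => //; first by rewrite -E.
    rewrite inT0 (negPf (Hy h' y2 h'H vy2)) /=; apply/negP=> /andP[_ h'K].
    by have := HKn h' h' h'H h'K; rewrite eqxx.
  by rewrite in_NV (Hy h' y).
have y'T : y' \notin T0 by rewrite inT0 (negPf y'2) (negPf y'K) andbF.
have y'NV : y' \in NV y by rewrite in_NV nyv // eq_sym yy'.
have vN w : adj v w -> [\/ w = y, w = y2 | w = y'].
  by apply: nbr3 => //; apply: uniq3; rewrite // eq_sym.
have ny2' : ~~ adj y2 y' by apply/negP=> ?; apply: (maxT y2 y').
have nKy' k : k \in K -> k != z -> ~~ adj k y'.
  move=> kK kz; have kT : k \in T0 by rewrite inT0 kz kK orbT.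
  by apply/negP=> ky'; apply: (maxT k y').
have y2N w : adj y2 w -> [\/ w \in K, w = v | w = h].
  move=> y2w; case wN: (w \in NV y).
    case wT: (w \in T0).
      move: wT; rewrite inT0 => /orP[/eqP E|/andP[_ ?]]; last by constructor 1.
      by rewrite E adjxx in y2w.
    by case: (maxT y2 w) => //; rewrite wT.
  move: wN; rewrite in_NV => /negbT; rewrite negb_and !negbK => /orP[/eqP E|/yN[] ->].
  - by rewrite E adjC in y2w; have := nyv _ vy2; rewrite y2w.
  - by constructor 2.
  - by constructor 3.
  - by constructor 1.
(* The neighbours of y and y2 are known, so a third component could be attached to y' only, with
   both of its ends. *)
have only C : comp (NV v) C -> C != K -> C = H.
  move=> cC CK; apply/eqP; apply: contraT => CH; exfalso.
  have lk g : g \in C -> ~ two_nbrs C g -> adj y' g.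
    move=> gC g1; have [w vw wg] := other_end_linked mp cC CK gC g1.
    have gK : g \notin K by apply: (comp_disj cC cK).
    have gH : g \notin H by apply: (comp_disj cC cH).
    have /andP[gv _] := compN_out cC gC.
    case: (vN _ vw) => E; rewrite E in wg => //.
    + case: (yN _ wg) => E'; [by rewrite E' eqxx in gv|by rewrite E' hH in gH|].
      by rewrite E' zK in gK.
    + case: (y2N _ wg) => E'; [by rewrite E' in gK|by rewrite E' eqxx in gv|].
      by rewrite E' hH in gH.
  have [g [g' eg]] := other_ends mp cC CK.
  have [[gC g'C] _ g1 g'1 _] := eg.
  by apply: (other_same_end mp cC CK eg vy'); apply: lk.
have cov w : [\/ w \in K, w \in H | w \in [:: v; y; y2; y']].
  case wN : (w \in NV v).
    have [C cC wC] := comp_exists wN; case: (eqVneq C K) => [<-|CK]; first by constructor 1.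
    by constructor 2; rewrite -(only C cC CK).
  constructor 3; move: wN; rewrite in_NV => /negbT; rewrite negb_and !negbK => /orP[/eqP->|].
    by rewrite mem_head.
  by case/vN => ->; rewrite !inE eqxx ?orbT.
have cG := card_comp2 v3 cK cH HK.
have yKz k : k \in K -> adj y k = (k == z).
  move=> kK; apply/idP/eqP => [/yN[] E //|->//].
    by have := KN k kK; rewrite E eqxx.
  by have := HKn h k hH kK; rewrite E eqxx.
have vKn k : k \in K -> ~~ adj v k by move/KN=> /andP[].
have yy2 : y != y2 by rewrite eq_sym.
have exx : exists2 x, x \in K & (x != z) && adj y2 x by exists x; rewrite // xz.
have [//|Q|[[s1 [s2 [s1K s2K s12 ys1 ys2]]] [z1 [z2 [z1K z2K z12 zz1 zz2]]] Q]] :=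
  bad_ear subcubicG bK K4 zK y2K vK yK vy2 vy (nyv _ vy2) yy2 vKn yKz exx.
  (* Dominate y: T0 costs |K| - 3, and H with h replaced by y' keeps its order, a multiple of four.
     The total is |K| + |H| + 1. *)
  set B := y' |: H :\ h.
  have h'B : h' \in H :\ h by rewrite !inE eq_sym hh'.
  have conB : conn B.
    apply: (conn_add _ h'B); last by rewrite adjC.
    apply: conn_del => //; first by apply/set0Pn; exists h'.
    by move=> a b; apply: two_nbrsP.
  have cB : #|B| = #|H|.
    rewrite cardsU1 !inE (negPf y'H) andbF /=.
    by have := cardsD1 h H; rewrite hH; clear; lia.
  have vB : v \notin B by rewrite !inE negb_or (adj_neq vy') (negPf vH) andbF.
  have QB : quiso B #|H|.
    have := quiso_good (neq_setT vB) conB; rewrite cB Hm subn0; exact.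
  apply: (@dom_cex y (#|K| - 3 + #|H|)); last by move: cG K4; clear; lia.
  apply: (quiso_sub _ (quisoU _ Q QB)).
    apply/subsetP=> w; rewrite in_NV => /andP[wy nyw]; rewrite in_setU inT0 !inE.
    case: (cov w) => [wK|wH|].
    + rewrite wK andbT; have -> : w != z by apply: contraNneq nyw => ->.
      by rewrite orbT.
    + rewrite wH andbT; have -> : w != h by apply: contraNneq nyw => ->.
      by rewrite !orbT.
    + rewrite !inE => /or4P[]/eqP E; rewrite E ?eqxx ?orbT //.
        by rewrite E yv in nyw.
      by rewrite E eqxx in wy.
  move=> p q; rewrite inT0 !inE => /orP[/eqP->|/andP[pz pK]] /orP[/eqP->|/andP[qh qH]] //.
  - apply/negP=> /y2N[] E; [|by rewrite E (negPf vH) in qH|by rewrite E eqxx in qh].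
    by have := HKn q q qH E; rewrite eqxx.
  - exact: nKy'.
  - exact: KHn.
(* Dominate y2 and the neighbour h2 of h. The rest of H together with y' has order |H| - 2, which is
   2 modulo 4, and costs |H| - 4; the part at K costs |K| - 3. The total is again |K| + |H| + 1. *)
have y2v : adj y2 v by rewrite adjC.
have vs1 : v != s1 by rewrite eq_sym; case/andP: (KN s1 s1K).
have vs2 : v != s2 by rewrite eq_sym; case/andP: (KN s2 s2K).
have zy : adj z y by rewrite adjC.
have nzy' : ~~ adj z y'.
  apply/negP=> zy'; apply: (four_neq zz1 zz2 zy zy') => //; exact: Ky.
have [h2 [h3 [h2H h3H h3h h22 [hh2 h23 h2N]]]] := other_end_nbr mp cH HK hH h1.
have h2h' : h2 != h' by apply: contra_not_neq h'1 => <-.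
have h32 : h3 != h2 by rewrite eq_sym (adj_neq h23).
have h2h : h2 != h by rewrite eq_sym (adj_neq hh2).
have h3h' : h3 != h'.
  apply/eqP=> E; have : H \subset [set h; h2; h3].
    apply: (conn_ind conH hH); first by rewrite !inE eqxx.
    move=> a b _; rewrite !inE -!orbA => /or3P[]/eqP-> bH ab.
    + by rewrite (two_nbrsP h1 bH h2H) ?eqxx ?orbT.
    + by case: (h2N _ ab) => ->; rewrite eqxx ?orbT.
    + rewrite E in ab; rewrite (two_nbrsP h'1 bH h2H) ?eqxx ?orbT //.
      by rewrite -E adjC.
  move/subset_leq_card/(leq_trans H4); rewrite -setUA !cardsU1 cards1.
  by case: (_ \notin _); case: (_ \notin _).
set A := ((H :\ h) :\ h2) :\ h3.
have inA w : (w \in A) = [&& w != h3, w != h2, w != h & w \in H] by rewrite !inE.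
have h'A : h' \in A by rewrite inA h'H !(eq_sym h') h3h' h2h' hh'.
have conA : conn A.
  apply: conn_del; [|by apply/set0Pn; exists h'|].
    apply: conn_del; [|by apply/set0Pn; exists h3; rewrite !inE h32 h3h|].
      apply: conn_del => //; first by apply/set0Pn; exists h'; rewrite !inE eq_sym hh'.
      by move=> a b; apply: two_nbrsP.
    move=> a b /setD1P[ah aH] /setD1P[bh bH] /h2N[] Ea; first by rewrite Ea eqxx in ah.
    by case/h2N => Eb; [rewrite Eb eqxx in bh | rewrite Ea Eb].
  move=> a b /setD1P[a2 /setD1P[ah aH]] /setD1P[b2 /setD1P[bh bH]] h3a h3b.
  apply/eqP; apply: contraT => ab; exfalso; apply: (other_three mp cH HK h3H).
  exists h2, a, b; rewrite h2H aH bH h3a h3b (adjC h3) h23; split=> //.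
  by apply: uniq3; rewrite // eq_sym.
have cA : #|H| = #|A| + 3.
  have := cardsD1 h H; have := cardsD1 h2 (H :\ h); have := cardsD1 h3 ((H :\ h) :\ h2).
  by rewrite !inE h32 h3h h3H h2h h2H hH -/A /=; clear; lia.
set B := y' |: A.
have conB : conn B by apply: (conn_add conA h'A); rewrite adjC.
have y'A : y' \notin A by rewrite inA (negPf y'H) !andbF.
have cB : #|B| = #|A|.+1 by rewrite cardsU1 y'A.
have vB : v \notin B by rewrite in_setU1 negb_or (adj_neq vy') inA (negPf vH) !andbF.
have Bm : #|B| %% 4 = 2 by move: Hm; rewrite cB cA; clear; lia.
have QB : quiso B (#|B| - 2).
  by rewrite -Bm; apply: quiso_good; rewrite ?Bm // (neq_setT vB).
apply: (@dom_cex y2 (4 + (#|K| - 3 + (#|B| - 2)))); last first.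
  by move: cG K4; rewrite cB cA; clear; lia.
apply: (quiso_dom (x := h2)).
apply: (quiso_sub _ (quisoU _ Q QB)).
  apply/subsetP=> w; rewrite in_setD in_NV in_cnbhd negb_or => /andP[/andP[w2 nh2w] /andP[wy2
    ny2w]].
  rewrite in_setU !in_setU1 in_setD in_nbhd inA ny2w w2 /=.
  case: (cov w) => [->|wH|]; first by rewrite orbT.
    rewrite wH andbT; have -> : w != h3 by apply: contraNneq nh2w => ->.
    have -> : w != h by apply: contraNneq nh2w => ->; rewrite adjC.
    by rewrite !orbT.
  rewrite !inE => /or4P[]/eqP E; rewrite E ?eqxx ?orbT //.
    by rewrite E y2v in ny2w.
  by rewrite E eqxx in wy2.
move=> p q; rewrite !in_setU1 in_setD in_nbhd inA.
move=> /orP[/eqP->|/andP[_ pK]] /orP[/eqP->|/and4P[_ _ qh qH]].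
- exact: nyv.
- apply/negP=> /yN[] E; [by rewrite E (negPf vH) in qH|by rewrite E eqxx in qh|].
  by have := HKn q z qH zK; rewrite E eqxx.
- by case: (eqVneq p z) => [->//|pz]; apply: nKy'.
- exact: KHn.
Qed.

(** The ends of H use two neighbours of v that do not see K, and the bad set K needs two others, so
    v would have degree four. *)
Lemma other_none v K H : maxpair v K -> comp (NV v) H -> H = K.
Proof.
move=> mp cH; apply/eqP; apply: contraT => HK; exfalso.
have cK := maxpair_comp mp; have bK := maxpair_bad mp.
have [h [h' eH]] := other_ends mp cH HK; have [[hH h'H] hh' h1 h'1 mid] := eH.
have [y vy yh] := other_end_linked mp cH HK hH h1.
have [y' vy' yh'] := other_end_linked mp cH HK h'H h'1.
have yy' : y != y'.
  by apply/eqP=> E; apply: (other_same_end mp cH HK eH vy yh); rewrite E.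
have eH' : ends H h' h.
  split=> //; first by rewrite eq_sym.
  by move=> w wH wh' wh; apply: mid.
have ny k : k \in K -> ~~ adj y k.
  by move=> kK; apply/negP=> yk; apply: (other_oriented mp cH HK eH vy yh vy' yh' yy' kK yk).
have ny' k : k \in K -> ~~ adj y' k.
  move=> kK; apply/negP=> yk; rewrite eq_sym in yy'.
  by apply: (other_oriented mp cH HK eH' vy' yh' vy yh yy' kK yk).
have [k [y1 [kK vy1 yk]]] := compN_link cK.
have [k' [y2 [k'K _ y12 vy2 yk']]] := bad_links cK bK kK vy1 yk.
apply: (four_neq vy vy' vy1 vy2) => //.
- by apply: contraTneq yk => <-; apply: ny.
- by apply: contraTneq yk' => <-; apply: ny.
- by apply: contraTneq yk => <-; apply: ny'.
- by apply: contraTneq yk' => <-; apply: ny'.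
- by rewrite eq_sym.
Qed.

(** * The endgame: a star over K, or a cycle *)

Lemma no_deg3 v : ~ deg3 v.
Proof.
move=> /maxpair_exists[u [K mp]]; have cK := maxpair_comp mp; have bK := maxpair_bad mp.
have [[y1 [y2 [y3 [u3 uN]]]] _ _ _] := mp.
have vK : u \notin K by apply/negP=> /(compN_out cK); rewrite eqxx.
have yK y : y \in rcons [:: y1; y2; y3] u -> y \notin K.
  rewrite mem_rcons in_cons => /orP[/eqP->//|]; rewrite -uN; exact: compN_notin.
have cov x : x \in K \/ x \in rcons [:: y1; y2; y3] u.
  rewrite mem_rcons in_cons -uN; case xN: (x \in NV u).
    by left; have [C cC xC] := comp_exists xN; rewrite -(other_none mp cC).
  by right; move: xN; rewrite in_NV => /negbT; rewrite negb_and !negbK.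
have lk : exists2 k, k \in K & exists2 y, y \in [:: y1; y2; y3] & adj y k.
  by have [k [y [kK uy yk]]] := compN_link cK; exists k => //; exists y; rewrite -?uN.
by case: (bad_star subcubicG bK u3 uN yK cov lk).
Qed.

Lemma no_counterexample : False.
Proof.
have [x0 _] : exists x0, x0 \in [set: G] by case: connG => /set0Pn.
case: (leqP #|G| 2) => [n2|n3].
  apply: cex; apply: (quiso_leq (leq0n _)); apply: quiso_small; by rewrite cardsT.
have noT x : x \in [set: G] -> ~ three_nbrs [set: G] x.
  by move=> _ [a [b [c [u3 _ /and3P[xa xb xc]]]]]; apply: (no_deg3 (deg3I u3 xa xb xc)).
have [p [up pE pA pC]] := path_or_cycle connG (in_setT x0) noT.
have sp : size p = #|G| by rewrite -(card_uniqP up) -cardsT; apply: eq_card.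
rewrite sp in pA pC; move: (#|G|) n3 sp pA pC (@dom_cex) => n n3 sp pA pC dcex.
pose g := nth x0 p.
have gA i : i.+1 < n -> adj (g i) (g i.+1) := pA i.
have gC i j : i < j -> j < n -> adj (g i) (g j) -> j = i.+1 \/ i = 0 /\ j = n.-1 := pC i j.
have gI i j : i < n -> j < n -> g i = g j -> i = j.
  by move=> il jl /eqP; rewrite nth_uniq ?sp // => /eqP.
have idx x : exists2 i, i < n & x = g i.
  have : x \in p by rewrite pE in_setT.
  by move=> /(nthP x0)[i]; rewrite sp => il <-; exists i.
have nadj i j : i.+1 < j -> j < n -> (i == 0) && (j == n.-1) = false -> ~~ adj (g i) (g j).
  move=> ij jl e; apply/negP=> aij; case: (gC i j _ jl aij) => [|E|[E1 E2]].
  - by clear -ij; lia.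
  - by clear -ij E; lia.
  - by rewrite E1 E2 !eqxx in e.
clear pA pC up pE sp; clearbody g.
have cyc : adj (g 0) (g n.-1).
  apply: contraT => ncyc; exfalso.
  have nd x : ~ deg3 x := @no_deg3 x.
  have a01 : adj (g 0) (g 1) by apply: gA; clear -n3; lia.
  have a12 : adj (g 1) (g 2) by apply: gA; clear -n3; lia.
  have d02 : g 0 != g 2 by apply/eqP=> /gI E; suff : 0 = 2 by []; apply: E; clear -n3; lia.
  apply: (leaf_nbr d02 a01 a12) => w; last first.
    by apply: (ndeg3 (nd _)) => //; rewrite adjC.
  have [i il ->] := idx w => a0i.
  have i0 : 0 < i by case: (i) a0i => //; rewrite adjxx.
  case: (gC 0 i i0 il a0i) => [->//|[_ E]].
  by rewrite E (negPf ncyc) in a0i.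
have gr : rep n (symcl (cycler n)) g.
  split=> // i j il jl; rewrite /symcl /cycler.
  have md (a : nat) : a < n -> a.+1 %% n = if a == n.-1 then 0 else a.+1.
    move=> al; case: eqP => [->|na]; first by rewrite prednK ?modnn //; clear -n3; lia.
    by rewrite modn_small //; clear -al na n3; lia.
  rewrite !md //.
  have lt (a b : nat) : a < b -> b < n -> adj (g a) (g b) =
      (b == (if a == n.-1 then 0 else a.+1)) || (a == (if b == n.-1 then 0 else b.+1)).
    move=> ab bl; have -> : (a == n.-1) = false by clear -ab bl; lia.
    case: (eqVneq b a.+1) => [->|ba] /=; first by apply: gA; clear -ab bl; lia.
    case: (eqVneq b n.-1) => bn.
      case: (eqVneq a 0) => [->|a0]; first by rewrite bn cyc.
      by apply: negbTE; apply: nadj; rewrite ?(negPf a0) //; clear -ab ba; lia.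
    rewrite (negbTE (nadj a b _ bl _)) ?(negPf bn) ?andbF //; last by clear -ab ba; lia.
    by symmetry; clear -ab; lia.
  case: (ltngtP i j) => [ij|ji|->]; last by rewrite adjxx.
    by rewrite lt.
  by rewrite adjC lt // orbC.
have seg_sub (a k : nat) : a + k <= n -> {subset iota a k <= iota 0 n}.
  by move=> ak i; rewrite !mem_iota; clear -ak; lia.
have seg_conn (a k : nat) : a + k.+1 <= n -> conn (img g (iota a k.+1)).
  elim: k => [|k IH] ak.
    have -> : img g (iota a 1) = [set g a] by apply/setP=> x; rewrite !inE.
    exact: conn1.
  have -> : img g (iota a k.+2) = g (a + k.+1) |: img g (iota a k.+1).
    have E : iota a k.+2 = iota a k.+1 ++ [:: a + k.+1] by rewrite -[k.+2]addn1 iotaD.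
    by apply/setP=> x; rewrite E in_setU1 !in_set map_cat mem_cat mem_seq1 orbC.
  apply: (@conn_add _ _ (g (a + k))).
  - by apply: IH; clear -ak; lia.
  - by apply: mem_img; rewrite mem_iota; clear; lia.
  - by rewrite addnS; apply: gA; clear -ak; lia.
(* The residue 3 is left out because only then could the segment be bad. *)
have seg_q (a k : nat) : 0 < a -> a + k = n -> 0 < k -> k %% 4 != 3 -> quiso (img g (iota a k))
  (k - k %% 4).
  move=> a0 ak k0 k3; have cS : #|img g (iota a k)| = k.
    by rewrite (card_img gr) ?iota_uniq ?size_iota //; apply: seg_sub; rewrite ak.
  rewrite -{2 3}cS; apply: quiso_good; rewrite ?cS //.
    apply: (@neq_setT _ (g 0)); rewrite (img_inj gr) ?mem_iota.
    + by clear -a0; lia.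
    + by clear -n3; lia.
    + by apply: seg_sub; rewrite ak.
  by case: (k) k0 ak => // k' _ ak; apply: seg_conn; rewrite ak.
have dom i k : i.+1 < n -> 0 < i -> g k \notin cnbhd (g i) -> (k < i.-1) || (i.+1 < k).
  move=> il i0 gk; apply: contraT; rewrite negb_or -!leqNgt => /andP[k1 k2].
  case/negP: gk; rewrite in_cnbhd.
  have [E|[E|E]] : k = i \/ k = i.-1 \/ k = i.+1 by clear -k1 k2 i0; lia.
  - by rewrite E eqxx.
  - by have := gA i.-1; rewrite E adjC prednK // => ->; rewrite ?orbT // ltnW.
  - by rewrite E gA ?orbT.
have far (L L' : seq nat) : (forall i, i \in L -> 0 < i) -> (forall i j, i \in L -> j \in L' ->
  i.+1 < j < n) ->
    forall x y, x \in img g L -> y \in img g L' -> ~~ adj x y.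
  move=> L0 LL x y /imgP[i iL ->] /imgP[j jL ->]; have /andP[ij jl] := LL i j iL jL.
  by apply: nadj => //; have := L0 i iL; clear; case: i.
have two (a b : nat) : quiso (img g [:: a; b]) 0.
  by apply: quiso_small; apply: leq_trans (card_img_leq _ _) _.
have r4 : n %% 4 < 4 by apply: ltn_mod.
have badn (c : rel nat) : List.In (n, c) codes -> symcl c = symcl (cycler n) -> False.
  move=> cin cE; apply: not_badG; exists (n, c) => //=; exists g; first by rewrite cE.
  by apply/setP=> x; rewrite in_setT; have [i il ->] := idx x; rewrite mem_img // mem_iota.
case r : (n %% 4) r4 => [|[|[|[|]]]] // _.
(* For residues 0 and 1 the segment left by dominating [g 1] has residue 1 or 2 and saves at least
   the one unit required. *)
- apply: (dcex (g 1) (n - 3 - (n - 3) %% 4)); last by clear -r n3; lia.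
  apply: quiso_sub (seg_q 3 (n - 3) _ _ _ _); rewrite ?subnKC //; try by clear -r n3; lia.
  apply/subsetP=> x; have [i il ->] := idx x; rewrite in_setC => /dom; move/(_ n3 isT) => /= H.
  by apply: mem_img; rewrite mem_iota; clear -il H; lia.
- apply: (dcex (g 1) (n - 3 - (n - 3) %% 4)); last by clear -r n3; lia.
  apply: quiso_sub (seg_q 3 (n - 3) _ _ _ _); rewrite ?subnKC //; try by clear -r n3; lia.
  apply/subsetP=> x; have [i il ->] := idx x; rewrite in_setC => /dom; move/(_ n3 isT) => /= H.
  by apply: mem_img; rewrite mem_iota; clear -il H; lia.
(* One dominated vertex would leave residue 3. A second one five steps further leaves the free pair
   3, 4 and a segment of order n - 8, of residue 2. The remaining order 6 is the excluded cycle. *)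
- case: (ltnP n 10) => n10.
    have E : n = 6 by clear -r n3 n10; lia.
    by apply: noC6; apply/induced_C6P; exists g; rewrite E in gr.
  apply: (dcex (g 1) (4 + (0 + (n - 8 - (n - 8) %% 4)))); last by clear -r n10; lia.
  apply: (quiso_dom (x := g 6)).
  apply: (quiso_sub _ (quisoU _ (two 3 4) (seg_q 8 (n - 8) _ _ _ _)));
    rewrite ?subnKC //; try by clear -r n10; lia.
    apply/subsetP=> x; have [i il ->] := idx x; rewrite in_setD in_setC => /andP[d6 d1].
    have := dom 1 i n3 isT d1; have := dom 6 i _ isT d6; rewrite /= => H6 H1.
    have {H6} H6 : (i < 5) || (7 < i) by apply: H6; clear -n10; lia.
    rewrite in_setU; case: (ltnP i 5) => i5.
      by rewrite mem_img // !inE; clear -H1 i5; lia.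
    by rewrite orbC mem_img // mem_iota; clear -H6 il i5; lia.
  apply: far => [i|i j]; rewrite !inE; first by case/orP=> /eqP->.
  by rewrite mem_iota; clear -n10; lia.
(* The orders 3, 7 and 11 are in the family. From 15 on, three vertices spaced by five leave two
   free pairs and a segment of order n - 13, of residue 2. *)
case: (ltnP n 15) => n15.
  have [E|[E|E]] : n = 3 \/ n = 7 \/ n = 11 by clear -r n3 n15; lia.
  - by apply: (badn (cycler n)); rewrite // E; right; left.
  - by apply: (badn (cycler n)); rewrite // E; do 2 right; left.
  - by apply: (badn (cycler n)); rewrite // E; do 3 right; left.
apply: (dcex (g 1) (4 + (4 + (0 + (0 + (n - 13 - (n - 13) %% 4)))))); last by clear -r n15; lia.
apply: (quiso_dom (x := g 6)); apply: (quiso_dom (x := g 11)).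
apply: (quiso_sub _ (quisoU _ (two 3 4) (quisoU _ (two 8 9) (seg_q 13 (n - 13) _ _ _ _))));
  rewrite ?subnKC //; try by clear -r n15; lia.
- apply/subsetP=> x; have [i il ->] := idx x; rewrite !in_setD in_setC => /and3P[d11 d6 d1].
  have := dom 1 i n3 isT d1; have := dom 6 i _ isT d6; have := dom 11 i _ isT d11.
  rewrite /= => H11 H6 H1.
  have {H6} H6 : (i < 5) || (7 < i) by apply: H6; clear -n15; lia.
  have {H11} H11 : (i < 10) || (12 < i) by apply: H11; clear -n15; lia.
  rewrite !in_setU; case: (ltnP i 5) => i5.
    by rewrite mem_img // !inE; clear -H1 i5; lia.
  case: (ltnP i 10) => i10.
    by rewrite orbCA mem_img // !inE; clear -H6 i5 i10; lia.
  by rewrite orbA orbC mem_img // mem_iota; clear -H11 il i10; lia.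
- move=> x y xI; rewrite in_setU => /orP[] yI; move: x y xI yI; apply: far => [i|i j];
  rewrite !inE ?mem_iota; clear -n15; lia.
- apply: far => [i|i j]; rewrite !inE ?mem_iota; clear -n15; lia.
Qed.

End MinimalCounterexample.


(** * From minimal counterexamples to the theorem *)

Lemma isolating_P3 (G : sgraph) (D : {set G}) :
  isolating (path_graph 3) D <-> p3free (~: closed_nbhd D).
Proof.
split=> [/existsP isoD a b c aD bD cD ab bc|p3].
  apply/eqP; apply: contraT => ac; exfalso; apply: isoD.
  pose s : seq (induced (~: closed_nbhd D)) := [:: exist _ a aD; exist _ b bD; exist _ c cD].
  exists [ffun i : 'I_3 => nth (exist _ a aD) s i]; apply/andP; split.
    apply/injectiveP=> i j; rewrite !ffunE.
    have [ab' bc'] := (adj_neq ab, adj_neq bc).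
    case: i => [[|[|[|i]]] Hi] //; case: j => [[|[|[|j]]] Hj] //= E; try exact: val_inj;
    by move/(congr1 val): E => /= E; move: ab' bc' ac; rewrite E eqxx.
  apply/forallP=> i; apply/forallP=> j; rewrite !ffunE; apply/implyP.
  case: i => [[|[|[|i]]] Hi] //; case: j => [[|[|[|j]]] Hj] //= _;
  by rewrite /induced_adj /= // adjC.
apply/existsP=> -[f /andP[/injectiveP fI /forallP fA]].
have fE (i j : path_graph 3) : adj i j -> adj (val (f i)) (val (f j)).
  by move=> ij; have /forallP/(_ j)/implyP/(_ ij) := fA i.
pose o k := inord k : path_graph 3.
have oA k : k < 2 -> adj (o k) (o k.+1).
  move=> k2; rewrite /= /simple_closure /= -val_eqE /= !inordK ?(ltn_trans k2) //.
  by rewrite eqxx neq_ltn ltnSn.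
have := p3 _ _ _ (valP (f (o 0))) (valP (f (o 1))) (valP (f (o 2))) (fE _ _ (oA 0 isT)) (fE _ _
  (oA 1 isT)).
by move=> /val_inj/fI/(congr1 val); rewrite /= !inordK.
Qed.

Lemma isolation_leq (G : sgraph) (D : {set G}) : p3free (~: closed_nbhd D) ->
  isolation_number G (path_graph 3) <= #|D|.
Proof.
have F0 : 0 < #|path_graph 3| by rewrite card_ord.
by move=> p3; apply: (isolation_numberP G F0).2; apply/isolating_P3.
Qed.

(** * Passage between connected sets and induced subgraphs *)

Section Transfer.
Variables (G : sgraph) (S : {set G}).

Lemma connected_conn : 0 < #|G| -> connected G -> conn [set: G].
Proof.
move=> G0 cG; have [x xT] : exists x : G, x \in [set: G].
  by apply/set0Pn; rewrite -card_gt0 cardsT.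
apply: (conn_intro xT) => T _ xT' clT; apply/subsetP=> y _.
have cl : closed (@adj G) T.
  move=> a b ab; apply/idP/idP => ?; first by apply: (clT a b).
  by apply: (clT b a); rewrite // adjC.
by rewrite -(closed_connect cl (cG x y)).
Qed.

Lemma conn_connected : conn S -> connected (induced S).
Proof.
move=> cS x y; pose T := val @: [set z | connect (@adj (induced S)) x z].
have xT : val x \in T by apply: imset_f; rewrite inE connect0.
have sub : S \subset T.
  apply: (conn_ind cS (valP x) xT) => a b _ /imsetP[z zT ->] bS zb.
  apply/imsetP; exists (exist _ b bS) => //; rewrite !inE in zT *.
  by apply: connect_trans zT (connect1 _).
have /imsetP[z] := subsetP sub _ (valP y).
by rewrite inE => xz /val_inj ->.
Qed.

Lemma card_induced : #|induced S| = #|S|.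
Proof. by rewrite /= card_sig; apply: eq_card => x; rewrite !inE. Qed.

Lemma induced_nbhd x : #|@nbhd (induced S) x| <= #|nbhd (val x)|.
Proof.
rewrite -(card_imset _ val_inj); apply: subset_leq_card; apply/subsetP=> y.
by case/imsetP=> z; rewrite inE => xz ->; rewrite inE.
Qed.

Lemma induced_C6 : has_induced_C6 (induced S) -> has_induced_C6 G.
Proof.
move=> /induced_C6P[g [gI gA]]; apply/induced_C6P; exists (fun i => val (g i)).
by split=> i j il jl; [move/val_inj/gI; apply | apply: gA].
Qed.

(** The residue in [proper_good] originates here: 4|D| <= n forces 4|D| <= n - n mod 4. *)
Lemma induced_quiso n : quiso [set: induced S] n -> quiso S (n - n %% 4).
Proof.
move=> [D Dn p3]; exists (val @: D).
  have -> : #|val @: D| = #|D| by apply/card_imset/val_inj.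
  by move: #|D| Dn => d; clear; lia.
have inD a (aS : a \in S) : a \notin closed_nbhd (val @: D) ->
    exist _ a aS \in [set: induced S] :\: closed_nbhd D.
  move=> aD; rewrite !inE andbT; apply: contra aD => /in_closed_nbhd[d dD ad].
  apply/in_closed_nbhd; exists (val d); first exact: imset_f.
  by move: ad; rewrite -val_eqE.
move=> a b c /setDP[aS aD] /setDP[bS bD] /setDP[cS cD] ab bc.
have := p3 _ _ _ (inD a aS aD) (inD b bS bD) (inD c cS cD) ab bc.
by move/(congr1 val).
Qed.

End Transfer.

Lemma subcubic_nbhd (G : sgraph) (x : G) : subcubic G -> #|nbhd x| <= 3.
Proof. by apply: leq_trans; apply: leq_bigmax. Qed.

Lemma quiso_main (G : sgraph) : connected G -> subcubic G -> ~ has_induced_C6 G ->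
  ~ iso_to_E G -> quiso [set: G] #|G|.
Proof.
move: {2}#|G| (leqnn #|G|) => n; elim: n G => [|n IH] G Gn cG sG C6 nE.
  by apply: quiso_leq (quiso_small _) => //; rewrite cardsT; apply: leq_trans Gn _.
case: (posnP #|G|) => [G0|G0].
  by apply: quiso_leq (quiso_small _) => //; rewrite cardsT G0.
apply: NNPP => cex; apply: (@no_counterexample G) => //.
- by move=> x; apply: subcubic_nbhd.
- exact: connected_conn.
- by move/bad_setT.
move=> S ST cS nb; rewrite -{1 2}(card_induced S); apply: induced_quiso; apply: IH.
- rewrite card_induced -ltnS; apply: leq_trans Gn; rewrite -cardsT.
  by apply: proper_card; rewrite properT.
- exact: conn_connected.
- by apply/bigmax_leqP=> x _; apply: leq_trans (induced_nbhd x) (subcubic_nbhd _ sG).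
- by move/induced_C6.
- by move/bad_iso.
Qed.

(** * The extremal graphs *)

(** The first a path vertices dominate everything, the leaves included, since these hang on vertex
    a. Conversely every F_k is joined only to vertex k, so D must meet each of the a disjoint blocks
    formed by k and F_k. *)
Lemma isolation_Bgraph (G : sgraph) : ~ iso_to_E G -> iso G (Bgraph #|G|) ->
  isolation_number G (path_graph 3) = #|G| %/ 4.
Proof.
move=> nE; rewrite /Bgraph; case: ifP => [n3|/negbT n3].
  move=> isoP; rewrite divn_small; last by rewrite ltnS.
  apply/eqP; rewrite -leqn0.
  apply: leq_trans (isolation_leq (D := set0) _) _; last by rewrite cards0.
  (* The empty set isolates: two edges sharing a vertex would force order 3, and G would be the path
     P3 of the family. *)
  rewrite closed_nbhd0 setC0 => a b c _ _ _ ab bc; apply/eqP; apply: contraT => ac.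
  case: nE; exists (path_graph 3); first by left.
  have -> : 3 = #|G|; last by [].
  apply/eqP; rewrite eqn_leq n3 andbT -cardsT.
  have: [set a; b; c] \subset [set: G] by apply: subsetT.
  move/subset_leq_card; rewrite -setUA !cardsU1 cards1 !inE negb_or ac.
  by rewrite (adj_neq ab) (adj_neq bc).
set a := #|G| %/ 4; set b := #|G| - 3 * a => -[f [[h hK kK] fA]].
have a0 : 0 < a by rewrite divn_gt0 // ltnNge.
have ab : a <= b by rewrite /b /a; move: #|G| => n; clear; lia.
have {fA} hA x y : adj (h x) (h y) = adj x y by rewrite -fA !kK.
apply/eqP; rewrite eqn_leq; apply/andP; split.
  pose D := [set h (inl (widen_ord ab k)) | k : 'I_a].
  apply: leq_trans (isolation_leq (D := D) _) _; last first.
    by apply: leq_trans (leq_imset_card _ _) _; rewrite card_ord.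
  suff -> : closed_nbhd D = [set: G] by rewrite setCT => ? ? ?; rewrite inE.
  apply/setP=> x; rewrite inE; apply/in_closed_nbhd.
  rewrite -[x]hK; case: (f x) => [i|[k u]].
    case: (ltnP i a) => ia.
      exists (h (inl i)); last by rewrite eqxx.
      by apply/imsetP; exists (Ordinal ia) => //; congr (h (inl _)); apply: val_inj.
    have a1 : a.-1 < a by rewrite prednK.
    exists (h (inl (widen_ord ab (Ordinal a1)))); first by apply: imset_f.
    rewrite hA /= /simple_closure /= (prednK a0) eqxx ia !orbT andbT orbC.
    by apply/orP; left; apply/eqP=> -[E]; move: ia; rewrite -E /=; lia.
  exists (h (inl (widen_ord ab k))); first by apply: imset_f.
  by rewrite hA /= /simple_closure /= eqxx orbT.
have F0 : 0 < #|path_graph 3| by rewrite card_ord.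
have [D isoD <-] := (isolation_numberP G F0).1.
have p3 : p3free (~: closed_nbhd D) by apply/isolating_P3.
(* The index of the block of a vertex; the leaves get indices at least a and so count for no
   block. *)
pose blk x := match f x with inl i => nat_of_ord i | inr (k, _) => nat_of_ord k end.
rewrite -(size_iota 0 a) cardE -(size_map blk); apply: uniq_leq_size (iota_uniq _ _) _.
move=> k; rewrite mem_iota => /= ka; apply: contraT => kD; exfalso.
have out u : h (inr (Ordinal ka, u)) \in ~: closed_nbhd D.
  rewrite inE; apply/in_closed_nbhd=> -[d dD]; apply/negP; apply: contra kD => dk.
  suff <- : blk d = k by apply: map_f; rewrite mem_enum.
  rewrite /blk; case/orP: dk => [/eqP <-|]; first by rewrite kK.
  rewrite -[d in adj d _]hK hA /= /simple_closure /=.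
  case: (f d) => [i|[l w]] /=; first by rewrite orbF => /eqP.
  by case/andP=> _ /orP[] /andP[/eqP E _]; rewrite ?E // -E.
pose o i := inord i : path_graph 3.
have oA i : i < 2 -> adj (o i) (o i.+1).
  move=> i2; rewrite /= /simple_closure /= -val_eqE /= !inordK ?(ltn_trans i2) //.
  by rewrite eqxx neq_ltn ltnSn.
have hoA i : i < 2 -> adj (h (inr (Ordinal ka, o i))) (h (inr (Ordinal ka, o i.+1))).
  move=> i2; have oi := oA i i2; rewrite hA /= /simple_closure; apply/andP; split.
    by apply/eqP=> -[E]; move: oi; rewrite E adjxx.
  by apply/orP; left; apply/andP; split; [exact: eqxx | exact: oi].
have := p3 _ _ _ (out (o 0)) (out (o 1)) (out (o 2)) (hoA 0 isT) (hoA 1 isT).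
by move=> /(can_inj kK) [] /(congr1 val); rewrite /= !inordK.
Qed.

Theorem theorem1p2 (G : sgraph) (notE : ~ iso_to_E G) :
  (connected G -> subcubic G -> ~ has_induced_C6 G ->
   isolation_number G (path_graph 3) <= #|G| %/ 4) /\
  (iso G (Bgraph #|G|) ->
   isolation_number G (path_graph 3) = #|G| %/ 4).
Proof.
split=> [cG sG C6|]; last exact: isolation_Bgraph.
have [D Dn] := quiso_main cG sG C6 notE; rewrite setTD => /isolation_leq iD.
by apply: leq_trans iD _; rewrite leq_divRL // mulnC.
Qed.
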